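(* Let $\mu$ be a pure dominant integral weight and suppose that $j$ and $j+1$ both belong to $\mathrm{Crit}(\mu)$. For $\phi\in\mathrm H^t_c(S^G_K,\mathcal V^\mu_{\mathcal O})^{Q\text{-}\mathrm{ord}}$ the following equality holds in $\mathcal O[[\mathscr C\!\ell_F^+(p^\infty)]]$: $$\varepsilon_{\mathrm{cyc}}(\boldsymbol\mu^{j,\eta}_\phi)=\boldsymbol\mu^{j+1,\eta}_\phi,$$ where $\varepsilon_{\mathrm{cyc}}$ denotes the automorphism of $\mathcal O[[\mathscr C\!\ell_F^+(p^\infty)]]$ sending $[x]$ to $\varepsilon([x])[x]$. Hence $\boldsymbol\mu^\eta_\phi=\varepsilon_{\mathrm{cyc}}^{-j}(\boldsymbol\mu^{j,\eta}_\phi)\in\mathcal O[[\mathscr C\!\ell_F^+(p^\infty)]]$ is independent of $j\in\mathrm{Crit}(\mu)$.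
   Context: Groups. $F$ is a totally real field, $\mathcal O_F$ its ring of integers, $\Sigma_\infty$ its real places, $n\ge1$, $p$ a prime, $F_p=F\otimes\mathbb Q_p$. $G=\mathrm{Res}_{\mathcal O_F/\mathbb Z}\mathrm{GL}_{2n}$ with center $Z$, $N\subset G$ the subgroup of upper triangular unipotent matrices, $H=\mathrm{Res}_{\mathcal O_F/\mathbb Z}(\mathrm{GL}_n\times\mathrm{GL}_n)$, $\iota(h_1,h_2)=\mathrm{diag}(h_1,h_2)$, $Q\subset G$ the block upper triangular parabolic of type $(n,n)$. $K_\infty=\prod_\sigma\mathrm O_{2n}(\mathbb R)\cdot Z(\mathbb R)$, $L_\infty=H(\mathbb R)\cap K_\infty$; $\circ$ denotes identity components of real groups. $t=|\Sigma_\infty|(n^2+n-1)$. Weights and lattices. $E/\mathbb Q_p$ is a finite, large enough extension with ring of integers $\mathcal O$; identify $\Sigma_\infty$ with $\mathrm{Hom}(F,E)$. $\mu=(\mu_\sigma)$ with integers $\mu_{\sigma,1}\ge\dots\ge\mu_{\sigma,2n}$ is a dominant weight, $V^\mu$ the irreducible algebraic representation of $G$ of highest weight $\mu$; $\mu$ is pure of purity weight $\mathsf w\in\mathbb Z$ if $V^\mu\cong(V^\mu)^\vee\otimes(\mathrm N_{F/\mathbb Q}\circ\det)^{\mathsf w}$. $\mathrm{Crit}(\mu)=\{j\in\mathbb Z:\mu_{\sigma,n}\ge j\ge\mu_{\sigma,n+1}\ \forall\sigma\}$. $\mu^\vee_{\sigma,i}=-\mu_{\sigma,2n+1-i}$.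 $v_0\in V^\mu_E$ is a non-zero lowest weight vector (the diagonal torus acts on it by $-\mu^\vee$). With $\mathfrak n_{\mathcal O}$ the Lie algebra of $N$ over $\mathcal O$ (strictly upper triangular matrices over $\mathcal O_F\otimes\mathcal O$) and $\mathcal U(\mathfrak n_{\mathcal O})$ its enveloping algebra over $\mathcal O$, put $V^\mu_{\mathcal O}=\mathcal U(\mathfrak n_{\mathcal O})v_0$, an $\mathcal O$-lattice in $V^\mu_E$ endowed with the natural action of $G(\mathcal O)$. For $\mathfrak p\mid p$ fix a uniformizer $\varpi_{\mathfrak p}$, $t_{\mathfrak p}=\iota(\varpi_{\mathfrak p}1_n,1_n)$; for $\beta=(\beta_{\mathfrak p})_{\mathfrak p\mid p}$, $\beta_{\mathfrak p}\in\mathbb Z_{\ge0}$, put $t_p^\beta=\prod t_{\mathfrak p}^{\beta_{\mathfrak p}}$, and let $p^\beta$ also denote the ideal $\prod\mathfrak p^{\beta_{\mathfrak p}}$. $J_{\mathfrak p}\subset\mathrm{GL}_{2n}(\mathcal O_{F,\mathfrak p})$ consists of the matrices with reduction mod $\mathfrak p$ in $Q$; $J_p=\prod J_{\mathfrak p}$. The semigroup $\Lambda_p=J_p\{t_p^\beta\}J_p$ acts on $V^\mu_{\mathcal O}$ by the $\bullet$-action, the unique extension of the $J_p$-action for which every $t_p^\beta$ fixes $v_0$; thus $t_p^\beta\bullet v=\mu^\vee(t_p^\beta)\,(t_p^\beta\cdot v)$, where $\mu^\vee(t_p^\beta)=\prod_{\mathfrak p}\prod_{\sigma\in\Sigma_{\mathfrak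 p}}\sigma(\varpi_{\mathfrak p})^{\beta_{\mathfrak p}\sum_{i\le n}\mu^\vee_{\sigma,i}}$ ($\Sigma_{\mathfrak p}$: the $\sigma$ inducing $\mathfrak p$). Level. $K=K^{(p)}\prod_{\mathfrak p\mid p}K_{\mathfrak p}\subset G(\mathbb A_f)$ is open compact with: $K^{(p)}$ the principal congruence subgroup of modulus $\mathfrak m$, $\mathfrak m$ prime to $p$, such that $K'=K^{(p)}G(\mathbb Z_p)$ satisfies $G(\mathbb Q)\cap gK'K_\infty^\circ g^{-1}=Z(\mathbb Q)\cap K'K^\circ_\infty$ for all $g\in G(\mathbb A)$; and $\begin{pmatrix}T_n(\mathcal O_{F,\mathfrak p})&M_n(\mathcal O_{F,\mathfrak p})\\0&T_n(\mathcal O_{F,\mathfrak p})\end{pmatrix}\subseteq K_{\mathfrak p}\subseteq J_{\mathfrak p}$ for all $\mathfrak p\mid p$ ($T_n$: diagonal matrices). $S^G_K=G(\mathbb Q)\backslash G(\mathbb A)/KK_\infty^\circ$, and $\mathcal V^\mu_{\mathcal O}$ is the sheaf of locally constant sections of $G(\mathbb Q)\backslash(G(\mathbb A)\times V^\mu_{\mathcal O})/KK_\infty^\circ$, with $\gamma(g,v)k=(\gamma gk,k_p^{-1}\cdot v)$. Hecke operators. For $s=t_p^\beta$, $[KsK]^\circ$ on $\mathrm H^q_c(S^G_K,\mathcal V^\mu_{\mathcal O})$ is the composite of pullback to level $K\cap s^{-1}Ks$, the map to level $sKs^{-1}\cap K$ induced by $(g,v)\mapsto(gs^{-1},s\bullet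 v)$, and the trace to level $K$. $U_{\mathfrak p}^\circ=[Kt_{\mathfrak p}K]^\circ$ and $U^\circ_{p^\beta}=[Kt_p^\beta K]^\circ$. $\mathrm H^t_c(S^G_K,\mathcal V^\mu_{\mathcal O})^{Q\text{-}\mathrm{ord}}$ is the maximal $\mathcal O$-submodule of $\mathrm H^t_c(S^G_K,\mathcal V^\mu_{\mathcal O})$ on which all $U_{\mathfrak p}^\circ$, $\mathfrak p\mid p$, are invertible. $E$ is assumed large enough that all $U_{\mathfrak p}^\circ$-eigenvalues lie in $\mathcal O$. Cycles. $w_n=(\delta_{i,n-j+1})$; $\xi\in\mathrm{GL}_{2n}(\mathbb A_F)$ has components $\begin{pmatrix}1_n&w_n\\0&w_n\end{pmatrix}$ at $\mathfrak p\mid p$ and $1$ elsewhere. $L_\beta=L^{(p)}\prod_{\mathfrak p}L_{\mathfrak p}^{\beta_{\mathfrak p}}\subset H(\mathbb A_f)$ with $L^{(p)}=K^{(p)}\cap H$, $L_{\mathfrak p}^{\beta_{\mathfrak p}}=H(F_{\mathfrak p})\cap K_{\mathfrak p}\cap\xi t_{\mathfrak p}^{\beta_{\mathfrak p}}K_{\mathfrak p}t_{\mathfrak p}^{-\beta_{\mathfrak p}}\xi^{-1}$; $\tilde S^H_{L_\beta}=H(\mathbb Q)\backslash H(\mathbb A)/L_\beta L_\infty^\circ$, whose components have dimension $t$. $I(\mathfrak a)$ is the open compact subgroup of $\mathbb A_{F,f}^\times$ of modulus $\mathfrak a$ (unit ideles $\equiv1$ mod $\mathfrak a$); $\mathscr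 C\!\ell_F^+(\mathfrak a)=F^\times\backslash\mathbb A_F^\times/I(\mathfrak a)F_\infty^{\times\circ}$; $\mathscr C\!\ell_F^+(p^\infty)=\varprojlim_\beta\mathscr C\!\ell_F^+(p^\beta)$. The map $(h_1,h_2)\mapsto(\det h_1/\det h_2,\det h_2)$ identifies $\pi_0(\tilde S^H_{L_\beta})$ with $\mathscr C\!\ell_F^+(p^\beta\mathfrak m)\times\mathscr C\!\ell_F^+(\mathfrak m)$, with section $\delta(x,y)=(\mathrm{diag}(xy,1,\dots,1),\mathrm{diag}(y,1,\dots,1))$; $\tilde S^H_{L_\beta}[\delta]$ is the component of $\delta$. Components are oriented by a fixed orientation of $H(\mathbb R)^\circ/L_\infty^\circ$ transported by translation by $\delta\in H(\mathbb A_f)$ from the identity component, giving fundamental classes $\theta_{[\delta]}$ in Borel–Moore homology. The $p$-adic cyclotomic character $\varepsilon$, on ideles, is $y\mapsto\mathrm N_{F_p/\mathbb Q_p}(y_p)|y_f|_F\prod_\sigma\mathrm{sgn}(y_\sigma)$; it factors through a character $\mathscr C\!\ell_F^+(p^\infty)\to\mathbb Z_p^\times$. Evaluations. For $j\in\mathrm{Crit}(\mu)$ the space of linear forms $\kappa$ on $V^\mu_E$ with $\kappa(\iota(h_1,h_2)v)=\mathrm N_{F/\mathbb Q}(\det(h_1)^j\det(h_2)^{\mathsf w-j})\kappa(v)$ for $(h_1,h_2)\in H$ is one-dimensional; $\kappa_j^\circ$ is its unique element with $\kappa_j^\circ(\xi v_0)=1$; it maps $V^\mu_{\mathcal O}$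 onto $\mathcal O$. Let $\mathcal V^{(j,\mathsf w-j)}_{\mathcal O}$ be the sheaf on $\tilde S^H_{L_\beta}$ attached (by the same recipe) to $\mathcal O$ with $L_\beta$ acting through $l\mapsto\mathrm N_{F_p/\mathbb Q_p}(\det(l_{1,p})^j\det(l_{2,p})^{\mathsf w-j})$. Let $\iota_\beta:\tilde S^H_{L_\beta}\to S^G_K$, $[h]\mapsto[\iota(h)\xi t_p^\beta]$ (a proper map), and $\iota:\tilde S^H_{L_\beta}\to S^G_K$, $[h]\mapsto[\iota(h)]$; let $\tau_\beta^\circ:\iota_\beta^*\mathcal V^\mu_{\mathcal O}\to\iota^*\mathcal V^\mu_{\mathcal O}$ be induced by $(h,v)\mapsto(h,(\xi t_p^\beta)\bullet v)$; let $\mathrm{triv}_\delta^*$ be the isomorphism from $\mathcal V^{(j,\mathsf w-j)}_{\mathcal O}|_{\tilde S^H_{L_\beta}[\delta]}$ to the constant sheaf $\mathcal O$ inverse to the one induced by $(\gamma\delta lh_\infty,v)\mapsto(\gamma\delta lh_\infty,l_p^{-1}\cdot v)$ ($\gamma\in H(\mathbb Q)$, $l\in L_\beta$, $h_\infty\in H(\mathbb R)^\circ$). Put, on $\mathrm H^t_c(S^G_K,\mathcal V^\mu_{\mathcal O})$, $$\mathcal E^{j,\mathsf w}_{\beta,[\delta]}=\varepsilon(\det(\delta_1)^j\det(\delta_2)^{\mathsf w-j})\cdot(-\cap\theta_{[\delta]})\circ\mathrm{triv}^*_\delta\circ\kappa^\circ_j\circ\tau_\beta^\circ\circ\iota_\beta^*,$$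 with values in $\mathcal O$. $\eta_0$ is an $\mathcal O$-valued finite order idele class character of $F$ trivial on $I(\mathfrak m)$, $\eta=\eta_0|\cdot|_F^{-\mathsf w}$, and $$\mathcal E^{j,\eta}_{\beta}=\sum_{[\bar x]\in\mathscr C\!\ell_F^+(p^\beta)}\mathcal E^{j,\eta}_{\beta,[\bar x]}[\bar x]\in\mathcal O[\mathscr C\!\ell^+_F(p^\beta)],\qquad \mathcal E^{j,\eta}_{\beta,[\bar x]}=\sum_{[y]\in\mathscr C\!\ell_F^+(\mathfrak m)}\ \sum_{[x]\mapsto[\bar x]}\eta_0([y])\,\mathcal E^{j,\mathsf w}_{\beta,[\delta(x,y)]},$$ $[x]$ running over the elements of $\mathscr C\!\ell_F^+(p^\beta\mathfrak m)$ above $[\bar x]$. Measures. For $\phi\in\mathrm H^t_c(S^G_K,\mathcal V^\mu_{\mathcal O})^{Q\text{-}\mathrm{ord}}$, $\boldsymbol\mu^{j,\eta}_\phi=\left(\mathcal E^{j,\eta}_\beta((U^\circ_{p^\beta})^{-1}\phi)\right)_\beta\in\varprojlim_\beta\mathcal O[\mathscr C\!\ell_F^+(p^\beta)]=\mathcal O[[\mathscr C\!\ell_F^+(p^\infty)]]$ ($\beta_{\mathfrak p}\ge1$ for all $\mathfrak p\mid p$). *)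

(* Defs.v *)
From HB Require Import structures.
From mathcomp Require Import all_boot all_order all_algebra all_field.
From mathcomp Require Import finmap generic_quotient.
From mathcomp Require Import all_classical all_reals all_analysis.

Set Implicit Arguments.
Unset Strict Implicit.
Unset Printing Implicit Defensive.

Import Order.TTheory GRing.Theory Num.Theory.
Import numFieldNormedType.Exports.

Local Open Scope classical_set_scope.
Local Open Scope ring_scope.

(* The value at 0 is a dummy, fixed so that equal valuations are equal records. *)
Record dval (k : fieldType) := DVal {
  ord :> k -> int;
  ord0 : ord 0 = 0;
  ordM : forall x y, x != 0 -> y != 0 -> ord (x * y) = ord x + ord y;
  ordD : forall x y, x != 0 -> y != 0 -> x + y != 0 ->
    Num.min (ord x) (ord y) <= ord (x + y);
  ord_onto : exists2 x, x != 0 & ord x = 1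
}.

HB.instance Definition _ (k : fieldType) := gen_eqMixin (dval k).
HB.instance Definition _ (k : fieldType) := gen_choiceMixin (dval k).

Definition ordge (k : fieldType) (v : dval k) (a : int) (x : k) : bool :=
  (x == 0) || (a <= v x).

(* A completion is determined by v up to a unique isomorphism over k. *)
Record completion (k : fieldType) (v : dval k) := Completion {
  cfield :> fieldType;
  cval : dval cfield;
  cinj : {rmorphism k -> cfield};
  cinjE : forall x, cval (cinj x) = v x;
  cdense : forall (x : cfield) (a : int), exists y, ordge cval a (x - cinj y);
  ccomplete : forall u : nat -> cfield,
    (forall a : int, exists i, forall j j',
       (i <= j)%N -> (i <= j')%N -> ordge cval a (u j - u j')) ->
    exists l, forall a : int, exists i, forall j,
       (i <= j)%N -> ordge cval a (u j - l)
}.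

(* F is totally real: it has [F : Q] distinct embeddings into R, indexed by
   Sinf. The places of F are its normalised discrete valuations, i.e. the
   nonzero prime ideals of its ring of integers. *)
Record field_data (R : realType) := FieldData {
  NF :> fieldExtType rat;
  Sinf : finType;
  Sinf_card : #|Sinf| = \dim {: NF};
  realemb : Sinf -> {rmorphism NF -> R};
  realemb_inj : forall s s', realemb s =1 realemb s' -> s = s';
  Fv : forall v : dval NF, completion v
}.
Arguments Sinf {R}.
Arguments realemb {R}.
Arguments Fv {R}.

Notation place N := (dval (NF N)).

(* Sinf also indexes the [F : Q] embeddings of F into E, which is the
   identification of Sinf with Hom(F, E). The embedding emb s extends to the
   completion at the place plc s inducing it, and maps its integers into those
   of E; these conditions determine plc s and ext s. *)
Definition integers_over (K : fieldType) (v : dval K) (L : fieldExtType K)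
    : set L :=
  [set x | exists P : {poly L}, [/\ P \is monic, root P x &
     forall i, exists2 a : K, ordge v 0 a & P`_i = a%:A]].
Arguments integers_over {K} v {L}.

Record coef_data (R : realType) (p : nat) (N : field_data R) := CoefData {
  vp : dval rat;
  vp_p : 0 < vp p%:R;
  Qp : completion vp;
  EF : fieldExtType Qp;
  emb : Sinf N -> {rmorphism N -> EF};
  emb_inj : forall s s', emb s =1 emb s' -> s = s';
  plc : Sinf N -> place N;
  ext : forall s, {rmorphism Fv N (plc s) -> EF};
  ext_emb : forall s x, ext s (cinj (Fv N (plc s)) x) = emb s x;
  ext_int : forall s x, ordge (cval (Fv N (plc s))) 0 x ->
    integers_over (cval Qp) (ext s x)
}.
Arguments EF {R p N}.
Arguments emb {R p N}.
Arguments plc {R p N}.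
Arguments ext {R p N}.

Definition OE (R : realType) (p : nat) (N : field_data R) (C : coef_data p N)
    : set (EF C) :=
  integers_over (cval (Qp C)).

Section Adeles.
Context (R : realType) (N : field_data R).

Definition OF : set N := [set x | integralOver (intr : int -> N) x].

Definition finmx (m : nat) := forall v : place N, 'M[Fv N v]_m.
Definition infmx (m : nat) := {ptws Sinf N -> 'M[R]_m}.
Definition adm (m : nat) : Type := (finmx m * infmx m)%type.

Definition GLO m (v : place N) : set 'M[Fv N v]_m :=
  [set g | [/\ g \in unitmx, forall i j, ordge (cval (Fv N v)) 0 (g i j) &
               ordge (cval (Fv N v)) 0 (\det g)^-1]].
Arguments GLO {m} v.

Definition Kprin m (v : place N) (a : nat) : set 'M[Fv N v]_m :=
  [set g | GLO v g /\
     forall i j, ordge (cval (Fv N v)) a%:Z (g i j - (i == j)%:R)].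
Arguments Kprin {m} v a.

Definition GLfin m : set (finmx m) :=
  [set g | (forall v, g v \in unitmx) /\
           finite_set [set v | ~ GLO v (g v)]].
Definition GLinf m : set (infmx m) := [set g | forall s, g s \in unitmx].
Definition GLA m : set (adm m) := [set g | GLfin g.1 /\ GLinf g.2].

Definition mulfin m (g h : finmx m) : finmx m := fun v => g v *m h v.
Definition mulinf m (g h : infmx m) : infmx m := fun s => g s *m h s.
Definition mulad m (g h : adm m) : adm m :=
  (mulfin g.1 h.1, mulinf g.2 h.2).
Definition onefin m : finmx m := fun v => 1%:M.
Definition oneinf m : infmx m := fun s => 1%:M.
Definition finad m (g : finmx m) : adm m := (g, oneinf m).
Definition ratad m (g : 'M[N]_m) : adm m :=
  (fun v => map_mx (cinj (Fv N v)) g, fun s => map_mx (realemb N s) g).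

HB.instance Definition _ m := gen_eqMixin (adm m).
HB.instance Definition _ m := gen_choiceMixin (adm m).

(* The topology inducing on GLA that of the restricted product. *)
Definition adm_open m (U : set (adm m)) : Prop :=
  forall g, U g -> exists (a : place N -> nat) (W : set (infmx m)),
    [/\ finite_set [set v | a v <> 0%N], nbhs g.2 W &
        forall k h, (forall v, Kprin v (a v) (k v)) -> W h ->
          U (mulfin g.1 k, h)].

Lemma adm_openT m : adm_open (@setT (adm m)).
Proof.
move=> g _; exists (fun=> 0%N), setT; split=> //; last exact: filterT.
by rewrite (_ : [set _ | _] = set0) // -subset0 => v /=.
Qed.

Lemma Kprin_le m v a b : (a <= b)%N -> @Kprin m v b `<=` Kprin v a.
Proof.
move=> ab g [gO gb]; split=> // i j; have := gb i j; rewrite /ordge.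
by case/orP => [->//|h]; apply/orP; right; apply: le_trans h; rewrite lez_nat.
Qed.

Lemma adm_openI m : setI_closed (@adm_open m).
Proof.
move=> U U' oU oU' g [Ug U'g].
have [a [W [fa gW aU]]] := oU _ Ug.
have [a' [W' [fa' gW' aU']]] := oU' _ U'g.
exists (fun v => maxn (a v) (a' v)), (W `&` W'); split.
- apply: (@sub_finite_set _ _ ([set v | a v <> 0%N] `|` [set v | a' v <> 0%N])).
    move=> v /= h; have [a0|/eqP] := eqVneq (a v) 0%N; last by left.
    by right => a'0; apply: h; rewrite a0 a'0.
  by rewrite finite_setU.
- exact: filterI.
- move=> k h kK [Wh W'h]; split.
    by apply: aU => // v; apply: Kprin_le (kK v); rewrite leq_maxl.
  by apply: aU' => // v; apply: Kprin_le (kK v); rewrite leq_maxr.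
Qed.

Lemma adm_open_bigU m (I : Type) (f : I -> set (adm m)) :
  (forall i, adm_open (f i)) -> adm_open (\bigcup_i f i).
Proof.
move=> fo g [i _ fig]; have [a [W [fa gW aU]]] := fo i g fig.
by exists a, W; split=> // k h kK Wh; exists i => //; exact: aU.
Qed.

HB.instance Definition _ m := isOpenTopological.Build (adm m)
  (@adm_openT m) (@adm_openI m) (@adm_open_bigU m).

Definition fidele := forall v : place N, Fv N v.
Definition idele := (fidele * {ptws Sinf N -> R})%type.

Definition is_fidele (y : fidele) : Prop :=
  (forall v, y v != 0) /\ finite_set [set v | cval (Fv N v) (y v) <> 0].
Definition is_idele (y : idele) : Prop :=
  is_fidele y.1 /\ forall s, y.2 s != 0.
Definition mulid (x y : idele) : idele :=
  (fun v => x.1 v * y.1 v, fun s => x.2 s * y.2 s).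
Definition finid (y : fidele) : idele := (y, fun=> 1).
Definition ratid (x : N) : idele :=
  (fun v => cinj (Fv N v) x, fun s => realemb N s x).

(* A nonzero ideal of the ring of integers of F is given by its exponents. *)
Definition is_modulus (a : place N -> nat) : Prop :=
  finite_set [set v | a v <> 0%N].

Definition congr_ideles (a : place N -> nat) : set fidele :=
  [set u | forall v, [/\ u v != 0, cval (Fv N v) (u v) = 0 &
                         ordge (cval (Fv N v)) (a v)%:Z (u v - 1)]].

Definition real_units : set {ptws Sinf N -> R} := [set r | forall s, r s != 0].

Definition class_of (a : place N -> nat) (y : idele) : set idele :=
  [set z | exists g u r, [/\ g != 0, congr_ideles a u,
     connected_component real_units (fun=> 1) r &
     z = mulid (mulid (ratid g) y) (u, r)]].

Definition Clp (a : place N -> nat) : Type :=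
  {c : set idele | exists2 y, is_idele y & c = class_of a y}.

HB.instance Definition _ a := gen_eqMixin (Clp a).
HB.instance Definition _ a := gen_choiceMixin (Clp a).

Definition proj_class a y (hy : is_idele y) : Clp a :=
  exist _ (class_of a y) (ex_intro2 _ _ y hy erefl).

Definition above_class a b (c : Clp a) : set (Clp b) :=
  [set d | sval d `<=` sval c].

Definition residue_class (v : place N) (x : N) : set N :=
  [set y | OF y /\ ordge v 1 (x - y)].
Definition normv (v : place N) : nat :=
  #|` fset_set [set residue_class v x | x in OF]|.

Definition idele_norm_fin (y : fidele) : rat :=
  \big[*%R/1]_(v \in [set: place N])
    ((normv v)%:R : rat) ^ (- cval (Fv N v) (y v)).

End Adeles.
Arguments oneinf {R} N m.
Arguments above_class {R N a} b c.
Arguments onefin {R} N m.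
Arguments GLO {R N m} v.
Arguments Kprin {R N m} v a.

Definition overp (p : nat) (R : realType) (N : field_data R) (v : place N)
  : bool := 0 < v p%:R.

Section Cyclotomic.
Context (R : realType) (p : nat) (N : field_data R) (C : coef_data p N).

(* The norm of F_p / Q_p, as an element of E. *)
Definition normFp (y : fidele N) : EF C := \prod_s ext C s (y (plc C s)).

Definition eps_cyclo (y : idele N) : EF C :=
  normFp y.1 * ratr (idele_norm_fin y.1)
  * \prod_s (if y.2 s < 0 then -1 else 1).

End Cyclotomic.

(* The quotient of D by the partition into the sets cl x. *)
Section QuotientSpace.
Context (T : topologicalType) (D : set T) (cl : T -> set T).

Definition qrel (x y : D) : bool := `[< cl (val x) = cl (val y) >].

Lemma qrel_equiv : equiv_class_of qrel.
Proof.
split=> [x|x y|y x z]; rewrite /qrel.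
- by apply/asboolP.
- by apply/asboolP/asboolP => ->.
- by move=> /asboolP -> /asboolP ->; apply/asboolP.
Qed.

Canonical qrel_canonical := EquivRelPack qrel_equiv.

Definition qspace : topologicalType :=
  quotient_topology {eq_quot qrel_canonical}%qT.

Definition fiber (x : qspace) : set T :=
  cl (val (repr (x : {eq_quot qrel_canonical}%qT))).

End QuotientSpace.

Section Simplices.
Context (R : realType).

Definition stdsimplex (q : nat) : set 'rV[R]_q.+1 :=
  [set x | (forall i, 0 <= x 0 i) /\ \sum_i x 0 i = 1].

Arguments stdsimplex : clear implicits.

Definition face_vec q (i : 'I_q.+2) (x : 'rV[R]_q.+1) : 'rV[R]_q.+2 :=
  \row_j (if unlift i j is Some k then x 0 k else 0).

Lemma face_vec_simplex q (i : 'I_q.+2) (x : stdsimplex q) :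
  face_vec i (val x) \in stdsimplex q.+1.
Proof.
have [x0 x1] := set_mem (valP x); apply/mem_set; split=> [j|] /=.
  by rewrite mxE; case: unlift.
rewrite (bigD1_ord i) //= mxE unlift_none add0r -[RHS]x1.
by apply: eq_bigr => j _; rewrite mxE liftK.
Qed.

Definition face q (i : 'I_q.+2) (x : stdsimplex q) : stdsimplex q.+1 :=
  exist _ (face_vec i (val x)) (face_vec_simplex i x).

(* Singular chains with integral coefficients, as functions on all maps from
   the simplex; only continuous maps occur in the chains considered below. *)
Definition chain (X : Type) (q : nat) := (stdsimplex q -> X) -> int.

Section Chains.
Context (X : topologicalType).

Definition simplicial q (c : chain X q) : Prop :=
  forall s, c s != 0 -> continuous s.
Definition finite_chain q (c : chain X q) : Prop :=
  simplicial c /\ finite_set [set s | c s != 0].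
Definition locally_finite_chain q (c : chain X q) : Prop :=
  simplicial c /\ forall A : set X, compact A ->
    finite_set [set s | c s != 0 /\ exists x, A (s x)].

Definition sing_boundaryS q (c : chain X q.+1) : chain X q := fun t =>
  \sum_(i < q.+2) (-1) ^+ i *
    \sum_(s \in [set s : stdsimplex q.+1 -> X | s \o face i = t]) c s.
Definition sing_boundary q : chain X q -> chain X q.-1 :=
  if q is q'.+1 then @sing_boundaryS q' else fun=> fun=> 0.

Definition off q (A : set X) (c : chain X q) : Prop :=
  forall s, c s != 0 -> forall x, ~ A (s x).

(* Cycles and homologous chains in X relative to the complement of A. *)
Definition relcycle q (A : set X) (c : chain X q) : Prop :=
  finite_chain c /\ off A (sing_boundary c).
Definition relhom q (A : set X) (c c' : chain X q) : Prop :=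
  exists (b : chain X q.+1) (e : chain X q),
    [/\ finite_chain b, finite_chain e, off A e &
        forall s, c s - c' s = sing_boundaryS b s + e s].

(* An orientation of a q-dimensional manifold: a locally consistent choice of
   generators of the local homology groups H_q(X, X - x). *)
Definition orientation q (o : X -> chain X q) : Prop :=
  (forall x, relcycle [set x] (o x) /\
     forall c, relcycle [set x] c ->
       exists k : int, relhom [set x] c (fun s => k * o x s)) /\
  (forall x, exists U : set X, exists c : chain X q,
     [/\ open U, U x, relcycle U c &
         forall y, U y -> relhom [set y] c (o y)]).

Definition localize q (c : chain X q) (x : X) : chain X q :=
  fun s => if `[< exists u, s u = x >] then c s else 0.

End Chains.

(* Push-forward along a map given by its graph on simplices. *)
Definition pushchain (X Y : topologicalType) q
    (r : (stdsimplex q -> X) -> (stdsimplex q -> Y) -> Prop) (c : chain X q)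
    : chain Y q :=
  fun t => \sum_(s \in [set s : stdsimplex q -> X | r s t]) c s.

Definition capchain (X : topologicalType) (K : pzRingType) q
    (c : chain X q) (f : (stdsimplex q -> X) -> K) : K :=
  \sum_(s \in [set: stdsimplex q -> X]) (c s)%:~R * f s.

End Simplices.
Arguments stdsimplex R q : clear implicits.

Section Representations.
Context (R : realType) (p : nat) (N : field_data R) (C : coef_data p N).
Local Notation S := (Sinf N).
Local Notation E := (EF C).
Context (m : nat).

(* G(E) is the product over Sinf = Hom(F, E) of copies of GL_m(E). *)
Definition Gmx := S -> 'M[E]_m.
Definition GE : set Gmx := [set g | forall s, g s \in unitmx].

Inductive regular_fun : (Gmx -> E) -> Prop :=
| reg_cst a : regular_fun (fun=> a)
| reg_entry s i j : regular_fun (fun g => g s i j)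
| reg_detV s : regular_fun (fun g => (\det (g s))^-1)
| regD f h : regular_fun f -> regular_fun h -> regular_fun (fun g => f g + h g)
| regM f h : regular_fun f -> regular_fun h -> regular_fun (fun g => f g * h g).

Context (V : vectType E) (rho : Gmx -> 'End(V)).

Definition algebraic_rep : Prop :=
  [/\ rho (fun=> 1%:M) = \1%VF,
      forall g h, GE g -> GE h ->
        rho (fun s => g s *m h s) = (rho g \o rho h)%VF &
      forall (v : V) (l : 'Hom(V, E^o)),
        exists2 f, regular_fun f & forall g, GE g -> l (rho g v) = f g].

Definition irreducible_rep : Prop :=
  {:V}%VS != 0%VS /\
  forall W : {vspace V}, (forall g, GE g -> (rho g @: W <= W)%VS) ->
    W = 0%VS \/ W = {:V}%VS.

Definition torus_acts (lam : S -> 'I_m -> int) (v : V) : Prop :=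
  forall t : S -> 'rV[E]_m, (forall s i, t s 0 i != 0) ->
    rho (fun s => diag_mx (t s)) v = (\prod_s \prod_i t s 0 i ^ lam s i) *: v.

Definition unipotentN : set Gmx :=
  [set g | forall s (i j : 'I_m), (j <= i)%N -> g s i j = (i == j)%:R].

Definition has_highest_weight (lam : S -> 'I_m -> int) : Prop :=
  exists v, [/\ v != 0, torus_acts lam v &
                forall g, unipotentN g -> rho g v = v].

Definition dominant (lam : S -> 'I_m -> int) : Prop :=
  forall s (i j : 'I_m), (i <= j)%N -> lam s j <= lam s i.

Definition dual_weight (lam : S -> 'I_m -> int) : S -> 'I_m -> int :=
  fun s i => - lam s (rev_ord i).

Definition lowest_weight_vector (lam : S -> 'I_m -> int) (v : V) : Prop :=
  v != 0 /\ torus_acts (fun s i => - dual_weight lam s i) v.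

(* An isomorphism of V with the twist of its dual by (N o det)^w. *)
Definition pure_rep (w : int) : Prop :=
  exists f : 'Hom(V, 'Hom(V, E^o)),
    [/\ lker f = 0%VS, limg f = {: 'Hom(V, E^o)}%VS &
        forall g, GE g -> forall u v,
          f (rho g v) u =
          (\prod_s \det (g s)) ^ w *: f v (rho (fun s => invmx (g s)) u)].

(* The image of the tensor product of the integers of F and E in the product
   over Hom(F, E) of copies of E. *)
Inductive OFOE : (S -> E) -> Prop :=
| OFOE_tens x a : OF x -> OE a -> OFOE (fun s => emb C s x * a)
| OFOE_add f h : OFOE f -> OFOE h -> OFOE (fun s => f s + h s).

Definition nilO : set Gmx :=
  [set X | forall i j : 'I_m, OFOE (fun s => X s i j) /\
     ((j <= i)%N -> forall s, X s i j = 0)].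

(* X v = u for the derived action, X strictly upper triangular: u is the
   coefficient of T in the polynomial rho(1 + T X) v. *)
Definition lie_acts (X : Gmx) (v u : V) : Prop :=
  exists (k : nat) (c : nat -> V), c 1%N = u /\
    forall T : E, rho (fun s => 1%:M + T *: X s) v
                  = \sum_(i < k.+2) T ^+ i *: c i.

(* The module generated by v0 under the enveloping algebra over O of the
   strictly upper triangular matrices. *)
Inductive lattice (v0 : V) : V -> Prop :=
| lat_gen : lattice v0 v0
| lat_add u v : lattice v0 u -> lattice v0 v -> lattice v0 (u + v)
| lat_scale a v : OE a -> lattice v0 v -> lattice v0 (a *: v)
| lat_lie X v u : nilO X -> lattice v0 v -> lie_acts X v u -> lattice v0 u.

End Representations.

Record datum (R : realType) (p n : nat) (N : field_data R) (C : coef_data p N)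
  := Datum {
  wt : Sinf N -> 'I_(n + n) -> int;
  purity : int;
  repV : vectType (EF C);
  rho : Gmx C (n + n) -> 'End(repV);
  lowv : repV;
  unif : forall v : place N, Fv N v;
  modulus : place N -> nat;
  Kp : forall v : place N, set 'M[Fv N v]_(n + n)
}.

Section Datum.
Context (R : realType) (p n : nat) (N : field_data R) (C : coef_data p N).
Context (D : datum n C).
Local Notation S := (Sinf N).
Local Notation E := (EF C).
Local Notation V := (repV D).

Definition Crit (j : int) : Prop :=
  forall s (i : 'I_(n + n)),
    ((i < n)%N -> j <= wt D s i) /\ ((n <= i)%N -> wt D s i <= j).

(* The action of the product over v | p of the GL_2n(F_v). *)
Definition actp (g : finmx N (n + n)) : V -> V :=
  rho D (fun s => map_mx (ext C s) (g (plc C s))).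

Definition tp (beta : place N -> nat) : finmx N (n + n) := fun v =>
  if overp p v then block_mx ((unif D v ^+ beta v)%:M) 0 0 1%:M else 1%:M.

Definition mucheck (beta : place N -> nat) : E :=
  \prod_s ext C s (unif D (plc C s)) ^
    ((beta (plc C s))%:Z * \sum_(i < n) dual_weight (wt D) s (lshift n i)).

Definition bullet_t (beta : place N -> nat) (v : V) : V :=
  mucheck beta *: actp (tp beta) v.

Definition antidiag (K : pzRingType) : 'M[K]_n :=
  \matrix_(i, j) (i == rev_ord j)%:R.

Definition xi : finmx N (n + n) := fun v =>
  if overp p v then block_mx 1%:M (antidiag _) 0 (antidiag _) else 1%:M.

(* (xi t_p^beta) acting through the extended action; xi lies in J_p. *)
Definition bullet_xit (beta : place N -> nat) (v : V) : V :=
  actp xi (bullet_t beta v).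

Definition Jv (v : place N) : set ('M[Fv N v]_(n + n)) :=
  [set g | GLO v g /\ forall i j, ordge (cval (Fv N v)) 1 (dlsubmx g i j)].

Definition TMv (v : place N) : set ('M[Fv N v]_(n + n)) :=
  [set g | [/\ GLO v g, dlsubmx g = 0, is_diag_mx (ulsubmx g) &
               is_diag_mx (drsubmx g)]].

Definition Kfin : set (finmx N (n + n)) :=
  [set g | forall v, if overp p v then Kp D (g v)
                     else Kprin v (modulus D v) (g v)].

Definition Kfin_max : set (finmx N (n + n)) :=
  [set g | forall v, if overp p v then GLO v (g v)
                     else Kprin v (modulus D v) (g v)].

Definition Kinf : set (infmx N (n + n)) :=
  [set g | forall s, exists (z : R) (k : 'M[R]_(n + n)),
     [/\ z != 0, k *m k^T = 1%:M & g s = z *: k]].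
Definition Kinf0 : set (infmx N (n + n)) :=
  connected_component Kinf (oneinf N (n + n)).

Record standing : Prop := Standing {
  st_dominant : dominant (wt D);
  st_algebraic : algebraic_rep (rho D);
  st_irreducible : irreducible_rep (rho D);
  st_weight : has_highest_weight (rho D) (wt D);
  st_pure : pure_rep (rho D) (purity D);
  st_lowest : lowest_weight_vector (rho D) (wt D) (lowv D);
  st_unif : forall v, overp p v -> unif D v != 0 /\ cval (Fv N v) (unif D v) = 1;
  st_modulus : is_modulus (modulus D);
  st_modulus_p : forall v, overp p v -> modulus D v = 0%N;
  st_K1 : forall v, overp p v -> Kp D (1%:M : 'M[Fv N v]_(n + n));
  st_KM : forall v (g h : 'M[Fv N v]_(n + n)), overp p v ->
    Kp D g -> Kp D h -> Kp D (g *m h);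
  st_KV : forall v (g : 'M[Fv N v]_(n + n)), overp p v ->
    Kp D g -> Kp D (invmx g);
  st_Kopen : forall v, overp p v -> exists a, Kprin v a `<=` Kp D (v := v);
  st_KTM : forall v, overp p v -> TMv (v := v) `<=` Kp D (v := v);
  st_KJ : forall v, overp p v -> Kp D (v := v) `<=` Jv (v := v);
  st_neat : forall g (c : 'M[N]_(n + n)), GLA g -> c \in unitmx ->
    (exists k, [/\ Kfin_max k.1, Kinf0 k.2 &
                   mulad (ratad c) g = mulad g k]) <->
    [/\ is_scalar_mx c, Kfin_max (ratad c).1 & Kinf0 (ratad c).2]
}.

Definition dcosetG (g : adm N (n + n)) : set (adm N (n + n)) :=
  [set x | exists (c : 'M[N]_(n + n)) k, [/\ c \in unitmx, Kfin k.1, Kinf0 k.2 &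
     x = mulad (mulad (ratad c) g) k]].
Definition SG : topologicalType := qspace (@GLA _ N (n + n)) dcosetG.

Definition Gsimplex (q : nat) := stdsimplex R q -> adm N (n + n).
Definition is_Gsimplex q (s : Gsimplex q) : Prop :=
  continuous s /\ forall x, GLA (s x).

(* Compactly supported singular cochains of S^G_K with values in the sheaf
   attached to a subset L of V. A section of the sheaf pulled back along a
   simplex of S^G_K is given by its (constant) values on the lifts of the
   simplex to G(A), with s (c g k) = k_p^-1 s(g); cochains are thus functions
   on simplices of G(A), extended by 0. *)
Definition Gcochain (q : nat) := Gsimplex q -> V.

Record is_cochain (L : set V) q (c : Gcochain q) : Prop := IsCochain {
  coch_val : forall s, L (c s);
  coch_zero : forall s, ~ is_Gsimplex s -> c s = 0;
  coch_equiv : forall (s k : Gsimplex q) (g : 'M[N]_(n + n)), is_Gsimplex s ->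
    g \in unitmx -> continuous k -> (forall x, Kfin (k x).1 /\ Kinf0 (k x).2) ->
    forall x, actp (k x).1 (c (fun y => mulad (mulad (ratad g) (s y)) (k y)))
              = c s;
  coch_supp : exists2 A : set SG, compact A & forall s, is_Gsimplex s ->
    (forall x a, A a -> ~ fiber a (s x)) -> c s = 0
}.

Definition coboundary q (c : Gcochain q) : Gcochain q.+1 := fun s =>
  \sum_(i < q.+2) (-1) ^+ i *: c (s \o face i).

Definition cocycle (L : set V) q (c : Gcochain q) : Prop :=
  is_cochain L c /\ forall s, is_Gsimplex s -> coboundary c s = 0.

Definition null_class (L : set V) q : Gcochain q -> Prop :=
  if q is q'.+1 return Gcochain q -> Prop then
    fun c => exists2 b : Gcochain q', is_cochain L b &
      forall s, is_Gsimplex s -> c s = coboundary b s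
  else fun c => forall s, c s = 0.

Definition cohomologous (L : set V) q (c c' : Gcochain q) : Prop :=
  null_class L (fun s => c s - c' s).

Definition lcosetfin (A : set (finmx N (n + n))) (k : finmx N (n + n))
    : set (finmx N (n + n)) := [set mulfin k u | u in A].

(* K \cap s K s^-1 for s = t_p^beta. *)
Definition Kinter (beta : place N -> nat) : set (finmx N (n + n)) :=
  [set k | Kfin k /\ exists2 u, Kfin u &
           mulfin k (tp beta) = mulfin (tp beta) u].

(* The map to level s K s^-1 \cap K induced by (g, v) |-> (g s^-1, s . v). *)
Definition translate (beta : place N -> nat) q (c : Gcochain q) : Gcochain q :=
  fun s => bullet_t beta (c (fun x => mulad (s x) (finad (tp beta)))).

Definition level_trace (A : set (finmx N (n + n))) q (c : Gcochain q)
    : Gcochain q :=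
  fun s => \sum_(B \in [set lcosetfin A k | k in Kfin])
    let k := xget (onefin N (n + n)) [set k | Kfin k /\ lcosetfin A k = B] in
    actp k (c (fun x => mulad (s x) (finad k))).

Definition hecke (beta : place N -> nat) q (c : Gcochain q) : Gcochain q :=
  level_trace (Kinter beta) (translate beta c).

Definition only (v : place N) : place N -> nat := fun u => (u == v).
Definition Uv (v : place N) q : Gcochain q -> Gcochain q := @hecke (only v) q.

Definition VO : set V := lattice (rho D) (lowv D).

(* Submodules of H_c^q(S^G_K, V_O), given as sets of cocycles stable under
   adding coboundaries, on which all U_v with v | p are invertible. *)
Record invertible_submodule q (M : set (Gcochain q)) : Prop := InvSub {
  inv_cocycle : M `<=` cocycle VO (q := q);
  inv_null : forall c, cocycle VO c -> null_class VO c -> M c;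
  inv_add : forall c c', M c -> M c' -> M (fun s => c s + c' s);
  inv_scale : forall a c, OE a -> M c -> M (fun s => a *: c s);
  inv_stable : forall v c, overp p v -> M c -> M (Uv v c);
  inv_inj : forall v c, overp p v -> M c ->
    null_class VO (Uv v c) -> null_class VO c;
  inv_surj : forall v c, overp p v -> M c ->
    exists2 c', M c' & cohomologous VO (Uv v c') c
}.

Definition Q_ordinary q (M : set (Gcochain q)) : Prop :=
  invertible_submodule M /\ forall M', invertible_submodule M' -> M' `<=` M.

Definition hecke_inv q (M : set (Gcochain q)) (beta : place N -> nat)
    (c : Gcochain q) : Gcochain q :=
  xget (fun=> 0) [set c' | M c' /\ cohomologous VO (hecke beta c') c].

(* E contains all eigenvalues of the U_v on cohomology with coefficients in V,
   and they lie in O: if P is irreducible over E and P(U_v) is not injective,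
   then P is linear with root in O. *)
Definition large_enough (q : nat) : Prop :=
  forall v, overp p v -> forall (P : {poly E}) (c : Gcochain q),
    irreducible_poly P -> cocycle setT c -> ~ null_class setT c ->
    null_class setT (fun s => \sum_(i < size P) P`_i *: iter i (@Uv v q) c s) ->
    exists2 a, OE a & P %= 'X - a%:P.

Definition Hfin : Type := (finmx N n * finmx N n)%type.
Definition Hinf := (infmx N n * infmx N n)%type.
Definition HA := (adm N n * adm N n)%type.

Definition mkH (f : Hfin) (h : Hinf) : HA := ((f.1, h.1), (f.2, h.2)).
Definition iotafin (f : Hfin) : finmx N (n + n) :=
  fun v => block_mx (f.1 v) 0 0 (f.2 v).
Definition iotainf (h : Hinf) : infmx N (n + n) :=
  fun s => block_mx (h.1 s) 0 0 (h.2 s).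
Definition iotaad (h : HA) : adm N (n + n) :=
  (iotafin (h.1.1, h.2.1), iotainf (h.1.2, h.2.2)).

Definition HAgrp : set HA := [set h | GLA h.1 /\ GLA h.2].
Definition HR : set Hinf := [set h | GLinf h.1 /\ GLinf h.2].
Definition oneHinf : Hinf := (oneinf N n, oneinf N n).
Definition HR0 : set Hinf := connected_component HR oneHinf.
Definition Linf : set Hinf := [set h | HR h /\ Kinf (iotainf h)].
Definition Linf0 : set Hinf := connected_component Linf oneHinf.

(* L_beta = H \cap K \cap (xi t^beta) K (xi t^beta)^-1; away from p both xi
   and t^beta are trivial. *)
Definition Lfin (beta : place N -> nat) : set Hfin :=
  [set l | Kfin (iotafin l) /\ exists2 k, Kfin k &
     mulfin (iotafin l) (mulfin xi (tp beta)) = mulfin (mulfin xi (tp beta)) k].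

Definition dcosetH (beta : place N -> nat) (h : HA) : set HA :=
  [set x | exists (c1 c2 : 'M[N]_n) l k,
     [/\ c1 \in unitmx /\ c2 \in unitmx, Lfin beta l, Linf0 k &
         x = (mulad (mulad (ratad c1) h.1) (l.1, k.1),
              mulad (mulad (ratad c2) h.2) (l.2, k.2))]].
Definition SH (beta : place N -> nat) : topologicalType :=
  qspace HAgrp (dcosetH beta).

Definition cosetY (h : Hinf) : set Hinf :=
  [set x | exists2 k, Linf0 k & x = (mulinf h.1 k.1, mulinf h.2 k.2)].
Definition YH : topologicalType := qspace HR0 cosetY.

Definition cycle_dim : nat := (#|S| * (n ^ 2 + n - 1))%N.

(* A locally finite cycle representing the fundamental class, in Borel-Moore
   homology, of the component of delta in H(A_f), for the orientation carried
   over from o by h |-> [delta h]. *)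
Record fundamental_cycle (o : YH -> chain R YH cycle_dim)
    (beta : place N -> nat) (delta : Hfin)
    (Theta : chain R (SH beta) cycle_dim) : Prop := FundamentalCycle {
  fund_fin : locally_finite_chain Theta;
  fund_supp : forall s, Theta s != 0 ->
    forall x, exists2 h, HR0 h & fiber (s x) (mkH delta h);
  fund_cycle : forall s, sing_boundary Theta s = 0;
  fund_loc : forall (y : YH) (z : SH beta) h, HR0 h ->
    fiber y h -> fiber z (mkH delta h) ->
    relhom [set z] (localize Theta z)
      (pushchain (fun s t => forall x, exists2 h', HR0 h' &
                    fiber (s x) h' /\ fiber (t x) (mkH delta h')) (o y))
}.

Definition Hsimplex (q : nat) := stdsimplex R q -> HA.

Definition iota_beta (beta : place N -> nat) (h : HA) : adm N (n + n) :=
  mulad (iotaad h) (finad (mulfin xi (tp beta))).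

Definition iota_proper (beta : place N -> nat) : Prop :=
  forall A : set SG, compact A ->
    compact [set z : SH beta | exists h, fiber z h /\
               exists2 a, A a & fiber a (iota_beta beta h)].

(* The map of spaces induced by iota_beta is proper, hence acts on compactly
   supported cochains; the default value 0 is never used. *)
Definition pull_iota (beta : place N -> nat) q (c : Gcochain q)
    : Hsimplex q -> V :=
  fun s => if `[< iota_proper beta >] then c (iota_beta beta \o s) else 0.

Definition tau_map (beta : place N -> nat) q (c : Hsimplex q -> V)
    : Hsimplex q -> V :=
  fun s => bullet_xit beta (c s).

Definition kappa_form (j : int) (kappa : 'Hom(V, E^o)) : Prop :=
  (forall h1 h2 : S -> 'M[E]_n,
     (forall s, h1 s \in unitmx) -> (forall s, h2 s \in unitmx) ->
     forall v, kappa (rho D (fun s => block_mx (h1 s) 0 0 (h2 s)) v) =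
       (\prod_s (\det (h1 s) ^ j * \det (h2 s) ^ (purity D - j))) *: kappa v) /\
  kappa (actp xi (lowv D)) = 1.

Definition kappa_map (kappa : 'Hom(V, E^o)) q (c : Hsimplex q -> V)
    : Hsimplex q -> E :=
  fun s => kappa (c s).

(* A section f of the sheaf with f (c delta l h) = l_p^-1 a corresponds to
   the constant section a, so a is the value of f on the lifts of a simplex of
   the component of delta to delta H(R)^0. *)
Definition triv_map (beta : place N -> nat) (delta : Hfin) q
    (c : Hsimplex q -> E) : (stdsimplex R q -> SH beta) -> E :=
  fun s => c (fun x => mkH delta (xget (fun=> oneHinf)
    [set h : stdsimplex R q -> Hinf | continuous h /\
       forall x, HR0 (h x) /\ fiber (s x) (mkH delta (h x))] x)).

(* The cyclotomic character at det(delta_1)^j det(delta_2)^(w - j). *)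
Definition eps_delta (j : int) (delta : Hfin) : E :=
  eps_cyclo C (finid (fun v =>
    \det (delta.1 v) ^ j * \det (delta.2 v) ^ (purity D - j))).

Definition evaluation (j : int) (kappa : 'Hom(V, E^o)) (beta : place N -> nat)
    (delta : Hfin) (Theta : chain R (SH beta) cycle_dim)
    (c : Gcochain cycle_dim) : E :=
  eps_delta j delta *
  capchain Theta
    (triv_map delta (kappa_map kappa (tau_map beta (pull_iota beta c)))).

Definition diag1 (x : fidele N) : finmx N n := fun v =>
  \matrix_(i, j) (if i == j then (if i == 0%N :> nat then x v else 1) else 0).
Definition deltaxy (x y : fidele N) : Hfin :=
  (diag1 (fun v => x v * y v), diag1 y).

(* A system of finite ideles representing the elements of the (finite) narrow
   ray class group of modulus a. *)
Record ray_reps (a : place N -> nat) := RayReps {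
  rsize : nat;
  rrep : 'I_rsize -> fidele N;
  rrep_fidele : forall i, is_fidele (rrep i);
  rrep_class : forall y, is_idele y ->
    exists! i, class_of a y (finid (rrep i))
}.

Definition pbetam (beta : place N -> nat) : place N -> nat :=
  fun v => (beta v + modulus D v)%N.

Record finite_order_character (eta0 : idele N -> E) : Prop := FiniteOrderChar {
  char_mul : forall x y, is_idele x -> is_idele y ->
    eta0 (mulid x y) = eta0 x * eta0 y;
  char_rat : forall x, x != 0 -> eta0 (ratid x) = 1;
  char_int : forall x, is_idele x -> OE (eta0 x);
  char_order : exists2 k, (0 < k)%N & forall x, is_idele x -> eta0 x ^+ k = 1;
  char_modulus : forall u, congr_ideles (modulus D) u -> eta0 (finid u) = 1
}.

Definition level : Type :=
  {beta : place N -> nat | forall v, (0 < beta v)%N = overp p v}.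

Definition evaluation_eta (j : int) (kappa : 'Hom(V, E^o))
    (Theta : forall (beta : level) (delta : Hfin),
       chain R (SH (sval beta)) cycle_dim)
    (eta0 : idele N -> E) (ry : ray_reps (modulus D))
    (rx : forall beta : level, ray_reps (pbetam (sval beta)))
    (c : Gcochain cycle_dim) (beta : level) (cx : Clp (sval beta)) : E :=
  \sum_(i < rsize ry)
  \sum_(k < rsize (rx beta) | `[< sval cx (finid (rrep k)) >])
    (let delta := deltaxy (rrep k) (rrep i) in
     eta0 (finid (rrep i)) * evaluation j kappa delta (Theta beta delta) c).

Definition class_family : Type := forall beta : level, Clp (sval beta) -> E.

Definition level_le (beta beta' : level) : Prop :=
  forall v, (sval beta v <= sval beta' v)%N.

(* The elements of O[[Cl^+_F(p^oo)]]. *)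
Definition iwasawa (M : class_family) : Prop :=
  (forall beta c, OE (M beta c)) /\
  (forall beta beta' c, level_le beta beta' ->
     M beta c = \sum_(d \in above_class (sval beta') c) M beta' d).

(* The element [y] of Cl^+_F(p^oo), on which all ideles map. *)
Definition point_mass y (hy : is_idele y) : class_family :=
  fun beta c => (c == proj_class (sval beta) hy)%:R.
Arguments point_mass {y} hy beta c.

Definition padic_small (k : nat) (a : E) : Prop :=
  exists2 b, OE b & a = p%:R ^+ k * b.

(* T is the automorphism sending [y] to eps(y)[y], and T' its inverse: T is
   determined by being continuous and O-linear. *)
Record is_eps_cyc (T T' : class_family -> class_family) : Prop := IsEpsCyc {
  cyc_stable : forall M, iwasawa M -> iwasawa (T M);
  cyc_stableV : forall M, iwasawa M -> iwasawa (T' M);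
  cycK : forall M, iwasawa M -> T' (T M) = M;
  cycKV : forall M, iwasawa M -> T (T' M) = M;
  cyc_add : forall M M', iwasawa M -> iwasawa M' ->
    T (fun beta c => M beta c + M' beta c) =
    fun beta c => T M beta c + T M' beta c;
  cyc_scale : forall a M, OE a -> iwasawa M ->
    T (fun beta c => a * M beta c) = fun beta c => a * T M beta c;
  cyc_continuous : forall beta k, exists beta0 k0, forall M, iwasawa M ->
    (forall c, padic_small k0 (M beta0 c)) ->
    forall c, padic_small k (T M beta c);
  cyc_dirac : forall y (hy : is_idele y),
    T (point_mass hy) = fun beta c => eps_cyclo C y * point_mass hy beta c
}.

(* T^j for integral j, where T' is inverse to T. *)
Definition iterz (T T' : class_family -> class_family) (j : int)
    (M : class_family) : class_family :=
  match j with Posz k => iter k T M | Negz k => iter k.+1 T' M end.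

(* mu is the element (E_beta (U_{p^beta}^-1 phi))_beta of the limit. *)
Definition is_measure (M : set (Gcochain cycle_dim)) (j : int)
    (kappa : 'Hom(V, E^o))
    (Theta : forall (beta : level) (delta : Hfin),
       chain R (SH (sval beta)) cycle_dim)
    (eta0 : idele N -> E) (ry : ray_reps (modulus D))
    (rx : forall beta : level, ray_reps (pbetam (sval beta)))
    (phi : Gcochain cycle_dim) (mu : class_family) : Prop :=
  iwasawa mu /\
  forall beta cx, mu beta cx =
    evaluation_eta j kappa Theta eta0 ry rx
      (hecke_inv M (sval beta) phi) cx.

End Datum.

(* Main.v *)
Require Import Defs.
From HB Require Import structures.
From mathcomp Require Import all_boot all_order all_algebra all_field.
From mathcomp Require Import all_classical all_reals all_analysis.
From mathcomp Require Import ring lra zify.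

Set Implicit Arguments.
Unset Strict Implicit.
Unset Printing Implicit Defensive.

Import Order.TTheory GRing.Theory Num.Theory.
Import numFieldNormedType.Exports.

Local Open Scope classical_set_scope.
Local Open Scope ring_scope.

(** The measures for j and j + 1 are compared modulo p^k for every k. This
    suffices, since no nonzero element of O is divisible by all powers of p
    (padic_separated).

    Modulo p^k, continuity reduces the twist T to the point masses at
    representatives of the classes of a sufficiently deep level beta (T_approx).
    So the value of T mu_j on a class is, modulo p^k, a sum over the smaller
    classes of level beta of the values of mu_j there, each multiplied by the
    value of the cyclotomic character eps at any idele of the class, which is
    well defined modulo p^k (eps_congr). What remains is a congruence between
    two evaluations of one cochain (evaluation_congruence). The factors
    eps_delta in these differ by eps(x) for delta = delta(x, y), which accounts
    for the twist, and the functionals kappa_j and kappa_(j+1), composed with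
    the action of xi t_p^beta, agree modulo p^k on the lattice
    (kappa_congruence).

    For the latter, the lattice is spanned by the vectors X_1 ... X_r v0, where
    v0 is the lowest weight vector and the X_i are nilpotent upper triangular
    and integral. The operator t_p^beta fixes v0 and multiplies the upper right
    blocks of the X_i by elements divisible by p^k. Any X can be written as
    xi^-1 Y xi + Z with Y = (Y_1, Y_2) in the Lie algebra of H and Z lower
    triangular (decomposition). Here Z can be moved past the other factors to
    v0, on which it acts by a scalar, and Y comes out of kappa_j as
    j tr Y_1 + (w - j) tr Y_2. Hence j enters only through tr (Y_1 - Y_2), and
    Y_1 - Y_2 is the upper right block of X times the antidiagonal matrix. It
    follows that replacing j by j + 1 does not matter modulo p^k. The action of
    the Lie algebra is obtained by differentiating the given representation of
    the group along rational curves; that lower triangular matrices act on v0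
    through the torus is deduced from the highest weight theory of the
    representation (lowest_killed).

    The cap product with a locally finite cycle is a sum over infinitely many
    simplices, and congruences can be summed only if almost all terms vanish.
    The cochains are compactly supported and the maps iota_beta are proper, so
    they vanish on the simplices away from a compact set. But a simplex of the
    cycle enters through a continuous lift to H(R)^0, so it has to be shown
    that there is one (simplex_lift). The space at hand is the quotient of
    H(R)^0 by an arithmetic group on the left and by L_oo^0 on the right. On the
    right, the Cholesky decomposition is a section (normal_form). On the left,
    an element moving a point h0 little is central (injectivity_radius): its
    conjugation action has coefficients in a bounded part of a fractional ideal
    of F, which is finite (finite_bounded), so that a small move fixes the
    class of h0, and the level is neat. Given this, lifts are extended along
    the contraction of a simplex to a vertex (approximate_lift).

    The properties of eps that enter are all read off from the twist. Point
    masses depend on the classes of an idele only, so eps is trivial on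
    principal ideles (eps_rat). This is the product formula for F, on which the
    finiteness of bounded parts of fractional ideals rests; it also requires
    that a nonzero element of F be a unit at almost all places
    (finite_places_ord).

    Finally, the critical integers form an interval, so that the independence
    of j follows by iterating the comparison of consecutive ones. *)
(** * Valuations and integral elements *)

Section ValuationTheory.
Context (k : fieldType) (v : dval k).

Lemma ord_1 : v 1 = 0.
Proof.
have := ordM v (oner_neq0 k) (oner_neq0 k); rewrite mulr1 => h.
by apply: (addrI (v 1)); rewrite addr0 -h.
Qed.

Lemma ordV x : x != 0 -> v x^-1 = - v x.
Proof.
move=> x0; have xV0 : x^-1 != 0 by rewrite invr_eq0.
by apply: (addrI (v x)); rewrite -ordM // divff // subrr ord_1.
Qed.

Lemma ordX x m : x != 0 -> v (x ^+ m) = v x *+ m.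
Proof.
move=> x0; elim: m => [|m IH]; first by rewrite expr0 ord_1 mulr0n.
by rewrite exprS ordM ?expf_neq0 // IH mulrS.
Qed.

Lemma ordN x : v (- x) = v x.
Proof.
have [->|x0] := eqVneq x 0; first by rewrite oppr0.
have m1 : (-1 : k) != 0 by rewrite oppr_eq0 oner_neq0.
have h : v (-1) + v (-1) = 0 by rewrite -ordM // mulrNN mulr1 ord_1.
by rewrite -mulN1r ordM // (_ : v (-1) = 0) ?add0r //; lia.
Qed.

Lemma ordge0 a : ordge v a 0.
Proof. by rewrite /ordge eqxx. Qed.

Lemma ordgeE a x : x != 0 -> ordge v a x = (a <= v x).
Proof. by rewrite /ordge => /negPf ->. Qed.

Lemma ordge_le a b x : a <= b -> ordge v b x -> ordge v a x.
Proof.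
move=> ab; rewrite /ordge => /orP[->//|h].
by rewrite (le_trans ab h) orbT.
Qed.

Lemma ordge_refl x : ordge v (v x) x.
Proof. by rewrite /ordge lexx orbT. Qed.

Lemma ordge1 : ordge v 0 1.
Proof. by rewrite ordgeE ?oner_neq0 // ord_1. Qed.

Lemma ordgeN a x : ordge v a (- x) = ordge v a x.
Proof. by rewrite /ordge ordN oppr_eq0. Qed.

Lemma ordgeD a x y : ordge v a x -> ordge v a y -> ordge v a (x + y).
Proof.
have [->|x0] := eqVneq x 0; first by rewrite add0r.
have [->|y0] := eqVneq y 0; first by rewrite addr0.
have [->|s0] := eqVneq (x + y) 0; first by move=> *; exact: ordge0.
rewrite !ordgeE // => hx hy; apply: le_trans (ordD _ x0 y0 s0).
by rewrite le_min hx hy.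
Qed.

Lemma ordgeM a b x y : ordge v a x -> ordge v b y -> ordge v (a + b) (x * y).
Proof.
have [->|x0] := eqVneq x 0; first by rewrite mul0r => *; exact: ordge0.
have [->|y0] := eqVneq y 0; first by rewrite mulr0 => *; exact: ordge0.
by rewrite !ordgeE ?mulf_neq0 // ordM // => hx hy; exact: lerD.
Qed.

Lemma ordge_sum a (I : Type) (r : seq I) (P : pred I) F :
  (forall i, P i -> ordge v a (F i)) -> ordge v a (\sum_(i <- r | P i) F i).
Proof.
by move=> h; elim/big_ind: _ => //; [exact: ordge0 | exact: ordgeD].
Qed.

Lemma ordge0M x y : ordge v 0 x -> ordge v 0 y -> ordge v 0 (x * y).
Proof. exact: (@ordgeM 0 0). Qed.

Lemma ordge_nat m : ordge v 0 m%:R.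
Proof.
elim: m => [|m IH]; first exact: ordge0.
by rewrite -addn1 natrD; apply: ordgeD => //; exact: ordge1.
Qed.

Lemma ordge_int m : ordge v 0 m%:~R.
Proof. by case: m => m; rewrite ?NegzE ?mulrNz ?ordgeN; exact: ordge_nat. Qed.

(** A valuation ring is integrally closed: in an equation of integral
    dependence of an element of negative valuation, the leading term alone
    would have the least valuation. *)
Lemma ordge_integral (P : {poly k}) a : P \is monic -> root P a ->
  (forall i, ordge v 0 P`_i) -> ordge v 0 a.
Proof.
move=> Pm Pr Pi; have [//|a0] := eqVneq a 0 => [->|]; first exact: ordge0.
case: (leP 0 (v a)) => [va|va]; first by rewrite ordgeE.
exfalso; have sP : (0 < size P)%N by rewrite lt0n size_poly_eq0 monic_neq0.
set m := (size P).-1.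
have Pmm : P`_m = 1 by move/monicP: Pm.
have h : a ^+ m = - \sum_(i < m) P`_i * a ^+ i.
  have := rootP Pr; rewrite horner_coef -(prednK sP) big_ord_recr /= -/m Pmm.
  by rewrite mul1r => /eqP; rewrite addrC addr_eq0 => /eqP.
have am : a ^+ m != 0 by rewrite expf_neq0.
have : ordge v (v (a ^+ m) + 1) (a ^+ m).
  rewrite {2}h ordgeN; apply: ordge_sum => i _.
  apply: (@ordge_le _ (0 + v (a ^+ i))).
    rewrite add0r !ordX //.
    have : v a *+ m = v a *+ i + v a *+ (m - i) by rewrite -mulrnDr subnKC // ltnW.
    have -> : (m - i = (m - i).-1.+1)%N by rewrite prednK // subn_gt0.
    rewrite mulrS => ->.
    have : v a *+ (m - i).-1 <= 0 by rewrite mulrn_wle0 // ltW.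
    by move: va; lia.
  by apply: ordgeM; [exact: Pi | exact: ordge_refl].
by rewrite ordgeE // => ?; lia.
Qed.

(** The valuation ring, as a ring in its own right, so that the closure
    properties of integral elements apply to it. *)
Definition vint : {pred k} := fun x => ordge v 0 x.

Lemma vint_subring : subring_closed vint.
Proof.
split=> [|x y|x y]; rewrite ?inE /in_mem /= /vint; first exact: ordge1.
  by move=> hx hy; apply: ordgeD; rewrite ?ordgeN.
exact: ordge0M.
Qed.

HB.instance Definition _ := GRing.isSubringClosed.Build k vint vint_subring.

Record vring := VRing { vr_val :> k; vr_int : vr_val \in vint }.
HB.instance Definition _ := [isSub for vr_val].
HB.instance Definition _ := [Choice of vring by <:].
HB.instance Definition _ := [SubChoice_isSubComNzRing of vring by <:].

End ValuationTheory.

Section IntegersOver.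
Context (K : fieldType) (v : dval K) (L : fieldExtType K).

Definition vring_in : vring v -> L := fun x => (vr_val x)%:A.

Fact vring_in_zmod : zmod_morphism vring_in.
Proof. by move=> x y; rewrite /vring_in /= -scalerBl. Qed.

Fact vring_in_monoid : monoid_morphism vring_in.
Proof.
split=> [|x y]; rewrite /vring_in /=; first by rewrite scale1r.
exact: (rmorphM (in_alg L) (vr_val x) (vr_val y)).
Qed.

HB.instance Definition _ := GRing.isZmodMorphism.Build _ _ vring_in vring_in_zmod.
HB.instance Definition _ :=
  GRing.isMonoidMorphism.Build _ _ vring_in vring_in_monoid.

Lemma integers_overE x : integers_over v x <-> integralOver vring_in x.
Proof.
split=> [[P [Pm Px Pi]]|[q qm qx]].
- apply: (@integral_root_monic _ _ _ _ P) => //.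
  apply/integral_poly => i; have [a a0 ->] := Pi i.
  have av : a \in vint v by [].
  rewrite (_ : a%:A = vring_in (VRing av)) //; exact: integral_id.
- exists (map_poly vring_in q); split=> //; first exact: monic_map.
  move=> i; exists (vr_val q`_i); first exact: (vr_int q`_i).
  by rewrite coef_map.
Qed.

Lemma intover_id a : ordge v 0 a -> integers_over v (a%:A : L).
Proof.
move=> a0; apply/integers_overE; have av : a \in vint v by [].
rewrite (_ : a%:A = vring_in (VRing av)) //; exact: integral_id.
Qed.

Lemma intover0 : integers_over v (0 : L).
Proof. by apply/integers_overE; exact: mxpoly.integral0. Qed.

Lemma intover1 : integers_over v (1 : L).
Proof. by apply/integers_overE; exact: integral1. Qed.

Lemma intoverD (x y : L) :
  integers_over v x -> integers_over v y -> integers_over v (x + y).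
Proof.
by move=> /integers_overE hx /integers_overE hy; apply/integers_overE;
  exact: integral_add.
Qed.

Lemma intoverM (x y : L) :
  integers_over v x -> integers_over v y -> integers_over v (x * y).
Proof.
by move=> /integers_overE hx /integers_overE hy; apply/integers_overE;
  exact: integral_mul.
Qed.

Lemma intoverN (x : L) : integers_over v x -> integers_over v (- x).
Proof.
by move=> /integers_overE hx; apply/integers_overE; exact: integral_opp.
Qed.

Lemma intover_base a : integers_over v (a%:A : L) -> ordge v 0 a.
Proof.
move=> [P [Pm Pr Pi]].
pose c i := xget 0 [set b | ordge v 0 b /\ P`_i = b%:A].
have cP i : ordge v 0 (c i) /\ P`_i = (c i)%:A.
  have [b b0 Pb] := Pi i.
  by have := @xgetPex _ 0 [set b | ordge v 0 b /\ P`_i = b%:A]; apply; exists b.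
pose Q := \poly_(i < size P) c i.
have QP : map_poly (in_alg L) Q = P.
  apply/polyP => i; rewrite coef_map coef_poly; case: ltnP => [_|sPi] /=.
    by rewrite (cP i).2.
  by rewrite scale0r nth_default.
apply: (@ordge_integral _ _ Q).
- by rewrite -(map_monic (in_alg L)) QP.
- by rewrite -(fmorph_root (in_alg L)) QP.
- move=> i; rewrite coef_poly; case: ifP => _; [exact: (cP i).1 | exact: ordge0].
Qed.

(** Multiply the minimal equation of 1/x by a power of x = q^M b: for M large
    this writes 1 as q times an integral element, so that 1/q would be
    integral. *)
Lemma intover_separated (q : K) (x : L) : q != 0 -> 0 < v q ->
  (forall k, exists2 b, integers_over v b & x = (q ^+ k)%:A * b) -> x = 0.
Proof.
move=> q0 vq hx; apply/eqP; apply: contraT => x0; exfalso.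
set P := minPoly 1%AS x^-1.
have Pm : P \is monic by exact: monic_minPoly.
pose c i := xget 0 [set b | P`_i = b%:A].
have cP i : P`_i = (c i)%:A.
  have /polyOverP/(_ i)/vlineP [b Pb] : P \is a polyOver 1%VS by exact: minPolyOver.
  by have := @xgetPex _ 0 [set b | P`_i = b%:A]; apply; exists b.
have sP : (0 < size P)%N by rewrite lt0n size_poly_eq0 monic_neq0.
set m := (size P).-1.
have Pmm : P`_m = 1 by move/monicP: Pm.
pose M := (1 + \sum_(i < m) `|v (c i)|)%N.
have [b bO xb] := hx M.
have key : 1 = - \sum_(i < m) (c i * q ^+ (M * (m - i)))%:A * b ^+ (m - i).
  have /rootP := root_minPoly 1%AS x^-1; rewrite -/P horner_coef -(prednK sP).
  rewrite big_ord_recr /= -/m Pmm mul1r => /eqP; rewrite addrC addr_eq0 => /eqP h.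
  have e1 : x ^+ m * x^-1 ^+ m = 1 by rewrite -exprMn divff // expr1n.
  rewrite -[LHS]e1 h mulrN mulr_sumr; congr (- _); apply: eq_bigr => i _.
  have -> : x ^+ m = (in_alg L (q ^+ M) * b) ^+ (m - i) * x ^+ i.
    by rewrite -[in_alg L _ * b]xb -exprD subnK // ltnW.
  have e2 : x ^+ i * x^-1 ^+ i = 1 by rewrite -exprMn divff // expr1n.
  have -> : (c i * q ^+ (M * (m - i)))%:A
      = in_alg L (c i) * in_alg L (q ^+ M) ^+ (m - i) :> L.
    by rewrite exprM -rmorphXn -rmorphM.
  rewrite (cP i) -[(c i)%:A]/(in_alg L (c i)) exprMn -[RHS]mulr1 -[in RHS]e2.
  by rewrite mulrACA -(mulrA _ _ (b ^+ _)) [in RHS](mulrC (in_alg L (c i))).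
have : integers_over v (in_alg L q^-1).
  have := congr1 ( *%R (in_alg L q^-1)) key; rewrite mulr1 => ->.
  rewrite mulrN mulr_sumr; apply: intoverN.
  elim/big_ind: _ => [||i _]; [exact: intover0 | exact: intoverD |].
  rewrite mulrA; apply: intoverM.
    rewrite -[X in _ * X]/(in_alg L _) -rmorphM /=; apply: intover_id.
    have [->|ci0] := eqVneq (c i) 0; first by rewrite mul0r mulr0; exact: ordge0.
    rewrite ordgeE ?mulf_neq0 ?invr_eq0 ?expf_neq0 // !ordM ?mulf_neq0 ?invr_eq0 ?expf_neq0 //.
    rewrite ordV // ordX //.
    have : (`|v (c i)| < M)%N by rewrite /M (bigD1 i) //= add1n ltnS leq_addr.
    have : (0 < m - i)%N by rewrite subn_gt0.
    rewrite -mulr_natr; move: (m - i)%N => e; move: (v (c i)) (v q) vq => a w w0.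
    move=> e0 aM; have fM : (M <= M * e)%N by rewrite leq_pmulr.
    move: (M * e)%N fM (leq_trans aM fM) => f _ af; rewrite natz.
    clear -w0 af; nia.
  by elim: (m - i)%N => [|e IH]; rewrite ?expr0 ?exprS; [exact: intover1 | exact: intoverM].
move/intover_base; rewrite ordgeE ?invr_eq0 // ordV //; lia.
Qed.

End IntegersOver.

Section CoefficientField.
Context (R : realType) (p : nat) (N : field_data R) (C : coef_data p N).
Local Notation E := (EF C).

Definition rat_to_E : {rmorphism rat -> E} := in_alg E \o cinj (Qp C).

Lemma ratr_E q : ratr q = rat_to_E q.
Proof. by rewrite -[q in RHS]divq_num_den fmorph_div !rmorph_int. Qed.

Lemma natE_eq0 m : (m%:R == 0 :> E) = (m == 0%N).
Proof. by rewrite -(rmorph_nat rat_to_E) fmorph_eq0 pnatr_eq0. Qed.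

Lemma OE0 : OE (0 : E). Proof. exact: intover0. Qed.
Lemma OE1 : OE (1 : E). Proof. exact: intover1. Qed.
Lemma OED (x y : E) : OE x -> OE y -> OE (x + y). Proof. exact: intoverD. Qed.
Lemma OEM (x y : E) : OE x -> OE y -> OE (x * y). Proof. exact: intoverM. Qed.
Lemma OEN (x : E) : OE x -> OE (- x). Proof. exact: intoverN. Qed.
Lemma OEB (x y : E) : OE x -> OE y -> OE (x - y).
Proof. by move=> hx hy; apply: OED => //; exact: OEN. Qed.

Lemma OE_sum I (r : seq I) (P : pred I) (F : I -> E) :
  (forall i, P i -> OE (F i)) -> OE (\sum_(i <- r | P i) F i).
Proof. by move=> h; elim/big_ind: _ => //; [exact: OE0 | exact: OED]. Qed.

Lemma OE_int m : OE (m%:~R : E).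
Proof.
have nat_int k : OE (k%:R : E).
  elim: k => [|k IH]; first exact: OE0.
  by rewrite -addn1 natrD; apply: OED => //; exact: OE1.
by case: m => m; rewrite ?NegzE ?mulrNz; [|apply: OEN]; exact: nat_int.
Qed.

Lemma OE_X (x : E) k : OE x -> OE (x ^+ k).
Proof.
move=> hx; elim: k => [|k IH]; first exact: OE1.
by rewrite exprS; exact: OEM.
Qed.

Lemma p_neq0 : (p%:R : E) != 0.
Proof.
rewrite natE_eq0; apply/eqP => p0; have := vp_p C.
by have /eqP := congr1 (fun m => m%:R : rat) p0; move/eqP => ->; rewrite Defs.ord0 ltxx.
Qed.

Lemma padic_OE k (a : E) : padic_small k a -> OE a.
Proof. by case=> b bO ->; apply: OEM => //; apply/OE_X/(OE_int p). Qed.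

Lemma padic_zero k : padic_small k (0 : E).
Proof. by exists 0; [exact: OE0 | rewrite mulr0]. Qed.

Lemma padicD k (a b : E) :
  padic_small k a -> padic_small k b -> padic_small k (a + b).
Proof.
by move=> [x xO ->] [y yO ->]; exists (x + y); rewrite ?mulrDr //; exact: OED.
Qed.

Lemma padicN k (a : E) : padic_small k a -> padic_small k (- a).
Proof. by move=> [x xO ->]; exists (- x); rewrite ?mulrN //; exact: OEN. Qed.

Lemma padicMl k (a b : E) : OE a -> padic_small k b -> padic_small k (a * b).
Proof. by move=> aO [x xO ->]; exists (a * x); [exact: OEM | rewrite mulrCA]. Qed.

Lemma padicMr k (a b : E) : padic_small k a -> OE b -> padic_small k (a * b).
Proof. by move=> *; rewrite mulrC; exact: padicMl. Qed.

Lemma padic_sum k I (r : seq I) (P : pred I) (F : I -> E) :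
  (forall i, P i -> padic_small k (F i)) ->
  padic_small k (\sum_(i <- r | P i) F i).
Proof.
by move=> h; elim/big_ind: _ => //; [exact: padic_zero | exact: padicD].
Qed.

Lemma cval_p : 0 < cval (Qp C) p%:R.
Proof.
by rewrite -(rmorph_nat (cinj (Qp C))) cinjE; exact: vp_p.
Qed.

Lemma Qp_p_neq0 : (p%:R : Qp C) != 0.
Proof.
by apply/eqP => p0; have := p_neq0; rewrite -(rmorph_nat (in_alg E)) p0 rmorph0 eqxx.
Qed.

Lemma padic_separated (a : E) : (forall k, padic_small k a) -> a = 0.
Proof.
move=> h; apply: (@intover_separated _ (cval (Qp C)) _ p%:R) => [||k].
- exact: Qp_p_neq0.
- exact: cval_p.
have [b bO ->] := h k; exists b => //.
by rewrite -[_%:A]/(in_alg E _) rmorphXn rmorph_nat.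
Qed.

Lemma invp_not_OE : ~ OE (p%:R^-1 : E).
Proof.
rewrite (_ : p%:R^-1 = (p%:R^-1)%:A :> E); last first.
  by rewrite -[RHS]/(in_alg E _) fmorphV rmorph_nat.
move/intover_base; rewrite ordgeE ?invr_eq0 ?Qp_p_neq0 // ordV ?Qp_p_neq0 //.
by rewrite oppr_ge0 leNgt cval_p.
Qed.

Lemma cvalN v x : cval (Fv N v) (cinj (Fv N v) x) = v x.
Proof. exact: cinjE. Qed.

Lemma cval_nat v m : cval (Fv N v) m%:R = v m%:R.
Proof. by rewrite -(rmorph_nat (cinj (Fv N v))) cvalN. Qed.

Lemma plc_overp s : overp p (plc C s).
Proof.
rewrite /overp ltNge; apply/negP => vp.
apply: invp_not_OE; have := @ext_int _ _ _ C s p%:R^-1.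
rewrite fmorphV rmorph_nat; apply.
have [->|p0] := eqVneq (p%:R : Fv N (plc C s)) 0; first by rewrite invr0; exact: ordge0.
by rewrite ordgeE ?invr_eq0 // ordV // cval_nat oppr_ge0.
Qed.

Lemma Fv_p_neq0 s : (p%:R : Fv N (plc C s)) != 0.
Proof.
by apply/eqP => p0; have := plc_overp s; rewrite /overp -cval_nat p0 Defs.ord0.
Qed.

Lemma ext_small s k x :
  ordge (cval (Fv N (plc C s))) ((plc C s p%:R) *+ k) x ->
  padic_small k (ext C s x).
Proof.
move=> h; exists (ext C s (p%:R ^- k * x)).
  apply: ext_int; rewrite -[0](addNr (plc C s p%:R *+ k)); apply: ordgeM => //.
  rewrite ordgeE ?invr_eq0 ?expf_neq0 ?Fv_p_neq0 //.
  by rewrite ordV ?expf_neq0 ?Fv_p_neq0 // ordX ?Fv_p_neq0 // cval_nat.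
rewrite rmorphM fmorphV rmorphXn rmorph_nat mulrA divff ?mul1r //.
by rewrite expf_neq0 // p_neq0.
Qed.

End CoefficientField.
(** * First order expansions of rational functions and matrix groups *)

Section Germs.
Context (E : fieldType) (charE : [pchar E] =i pred0).

(** The polynomials P and Q exhibit f as a rational function P / Q, regular at
    0, whose Taylor expansion there begins with a + b t. *)
Definition germ (f : E -> E) (a b : E) : Prop :=
  exists P Q : {poly E}, [/\ Q`_0 != 0, P`_0 = a * Q`_0,
    P`_1 = a * Q`_1 + b * Q`_0 & forall t, Q.[t] != 0 -> f t * Q.[t] = P.[t]].

Definition generic (A : E -> Prop) : Prop :=
  exists2 D : {poly E}, D`_0 != 0 & forall t, D.[t] != 0 -> A t.

Lemma coef1M (P Q : {poly E}) : (P * Q)`_1 = P`_0 * Q`_1 + P`_1 * Q`_0.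
Proof. by rewrite coefM !big_ord_recl big_ord0 addr0. Qed.

(** In characteristic zero a nonzero polynomial cannot vanish at the natural
    numbers below its size. *)
Lemma poly_eq_generic (P Q : {poly E}) : generic (fun t => P.[t] = Q.[t]) -> P = Q.
Proof.
move=> [D D0 h]; apply/eqP; rewrite -subr_eq0; apply: contraT => d0.
have D1 : D != 0 by apply: contra_neq D0 => ->; rewrite coef0.
have PD : (P - Q) * D != 0 by rewrite mulf_neq0.
pose r := [seq i%:R : E | i <- iota 0 (size ((P - Q) * D))].
have ur : uniq r.
  rewrite map_inj_uniq ?iota_uniq // => i j /eqP.
  wlog ij : i j / (i <= j)%N => [H|].
    by case/orP: (leq_total i j) => ij h'; [|apply/esym]; apply: H => //; rewrite eq_sym.
  by rewrite eq_sym -subr_eq0 -natrB // (pcharf0P E).1 // subn_eq0 => ji; lia.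
have ar : all (root ((P - Q) * D)) r.
  apply/allP => t _; rewrite rootM; have [Dt|Dt] := eqVneq D.[t] 0.
    by rewrite /root Dt eqxx orbT.
  by rewrite /root !hornerE h // subrr eqxx.
by have := max_poly_roots PD ar ur; rewrite size_map size_iota ltnn.
Qed.

Lemma genericI A B : generic A -> generic B -> generic (fun t => A t /\ B t).
Proof.
move=> [D D0 hA] [D' D'0 hB]; exists (D * D'); first by rewrite coef0M mulf_neq0.
by move=> t; rewrite hornerM mulf_eq0 negb_or => /andP[/hA ? /hB].
Qed.

Lemma generic_all (I : finType) (A : I -> E -> Prop) :
  (forall i, generic (A i)) -> generic (fun t => forall i, A i t).
Proof.
move=> h; suff: forall r : seq I, generic (fun t => forall i, i \in r -> A i t).
  by move=> /(_ (enum I)) [D D0 hD]; exists D => // t Dt i; apply: hD; rewrite ?mem_enum.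
elim=> [|i r [D D0 IH]]; first by exists 1 => //; rewrite coef1 oner_neq0.
have [D' D'0 h'] := genericI (h i) (ex_intro2 _ _ D D0 IH).
exists D' => // t /h'[hi hr] k; rewrite inE => /predU1P[-> //|]; exact: hr.
Qed.

Lemma generic_sub (A B : E -> Prop) : (forall t, A t -> B t) -> generic A -> generic B.
Proof. by move=> AB [D D0 h]; exists D => // t /h /AB. Qed.

Lemma germ_cst a : germ (fun=> a) a 0.
Proof.
exists a%:P, 1; rewrite !coefE oner_neq0 /= mulr1 !(mulr0, mul0r, addr0).
by split=> // t _; rewrite !hornerE.
Qed.

Lemma germ_id : germ id 0 1.
Proof.
exists 'X, 1; rewrite !coefE oner_neq0 /= !(mul0r, mulr0, mulr1, add0r).
by split=> // t _; rewrite !hornerE.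
Qed.

Lemma germD f g a b c d :
  germ f a b -> germ g c d -> germ (fun t => f t + g t) (a + c) (b + d).
Proof.
move=> [P [Q [Q0 P0 P1 h]]] [P' [Q' [Q'0 P'0 P'1 h']]].
exists (P * Q' + P' * Q), (Q * Q'); split.
- by rewrite coef0M mulf_neq0.
- by rewrite coefD !coef0M P0 P'0; ring.
- by rewrite coefD !coef1M !coef0M P0 P'0 P1 P'1; ring.
- move=> t; rewrite hornerM mulf_eq0 negb_or => /andP[/h e /h' e'].
  by rewrite hornerD !hornerM -e -e'; ring.
Qed.

Lemma germM f g a b c d : germ f a b -> germ g c d ->
  germ (fun t => f t * g t) (a * c) (a * d + b * c).
Proof.
move=> [P [Q [Q0 P0 P1 h]]] [P' [Q' [Q'0 P'0 P'1 h']]].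
exists (P * P'), (Q * Q'); split.
- by rewrite coef0M mulf_neq0.
- by rewrite !coef0M P0 P'0; ring.
- by rewrite !coef1M !coef0M P0 P'0 P1 P'1; ring.
- move=> t; rewrite hornerM mulf_eq0 negb_or => /andP[/h e /h' e'].
  by rewrite !hornerM -e -e'; ring.
Qed.

Lemma germV f a b : a != 0 -> germ f a b -> germ (fun t => (f t)^-1) a^-1 (- b / a ^+ 2).
Proof.
move=> a0 [P [Q [Q0 P0 P1 h]]]; exists (Q * Q), (P * Q); split.
- by rewrite coef0M P0 !mulf_neq0.
- by rewrite !coef0M P0; field.
- by rewrite !coef1M !coef0M P0 P1; field.
- move=> t; rewrite hornerM mulf_eq0 negb_or => /andP[Pt Qt].
  have := h _ Qt => e; rewrite hornerM -e; field.
  by move: Pt; rewrite -e mulf_eq0 negb_or => /andP[].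
Qed.

Lemma germ_eq f g a b : generic (fun t => f t = g t) -> germ f a b -> germ g a b.
Proof.
move=> [D D0 fg] [P [Q [Q0 P0 P1 h]]]; exists (P * D), (Q * D); split.
- by rewrite coef0M mulf_neq0.
- by rewrite !coef0M P0 mulrA.
- by rewrite !coef1M !coef0M P0 P1; ring.
- move=> t; rewrite hornerM mulf_eq0 negb_or => /andP[Qt Dt].
  by rewrite -fg // hornerM -(h _ Qt) mulrA.
Qed.

Lemma germ_ext f g a b : f =1 g -> germ f a b -> germ g a b.
Proof. by move=> /funext ->. Qed.

Lemma germ_uniq f a b a' b' : germ f a b -> germ f a' b' -> a = a' /\ b = b'.
Proof.
move=> [P [Q [Q0 P0 P1 h]]] [P' [Q' [Q'0 P'0 P'1 h']]].
have e : P * Q' = P' * Q.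
  apply: poly_eq_generic; exists (Q * Q'); first by rewrite coef0M mulf_neq0.
  move=> t; rewrite hornerM mulf_eq0 negb_or => /andP[/h e /h' e'].
  by rewrite !hornerM -e' -e; ring.
have := congr1 (fun P : {poly E} => P`_0) e; rewrite !coef0M P0 P'0 => e0.
have aa : a = a'.
  apply: (mulIf Q0); apply: (mulIf Q'0); rewrite e0; ring.
split=> //; have := congr1 (fun P : {poly E} => P`_1) e; rewrite !coef1M P0 P'0 P1 P'1 -aa => e1.
apply: (mulIf Q0); apply: (mulIf Q'0); apply: (addrI (a * Q`_0 * Q'`_1 + a * Q`_1 * Q'`_0)).
by transitivity (a * Q`_0 * Q'`_1 + (a * Q`_1 + b * Q`_0) * Q'`_0); [ring | rewrite e1; ring].
Qed.

Lemma germ_neq0 f a b : a != 0 -> germ f a b -> generic (fun t => f t != 0).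
Proof.
move=> a0 [P [Q [Q0 P0 P1 h]]]; exists (P * Q); first by rewrite coef0M P0 !mulf_neq0.
move=> t; rewrite hornerM mulf_eq0 negb_or => /andP[Pt /h].
by apply: contra_eq_neq => ->; rewrite mul0r eq_sym.
Qed.

Lemma germ_sum (I : finType) (f : I -> E -> E) (a b : I -> E) :
  (forall i, germ (f i) (a i) (b i)) ->
  germ (fun t => \sum_i f i t) (\sum_i a i) (\sum_i b i).
Proof.
move=> h; elim: (index_enum I) => [|i r IH].
  rewrite !big_nil; apply: germ_ext (germ_cst 0) => t; by rewrite big_nil.
rewrite !big_cons; apply: germ_ext (germD (h i) IH) => t; by rewrite big_cons.
Qed.

Lemma germZ c f a b : germ f a b -> germ (fun t => c * f t) (c * a) (c * b).
Proof.
by move=> h; have := germM (germ_cst c) h; rewrite mul0r addr0.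
Qed.

Lemma germ_poly (P : {poly E}) : germ (fun t => P.[t]) P`_0 P`_1.
Proof.
by exists P, 1; rewrite !coefE oner_neq0 mulr1 mulr0 add0r mulr1; split=> // t _; rewrite hornerE mulr1.
Qed.

Lemma germX1 f b k : germ f 1 b -> germ (fun t => f t ^+ k) 1 (k%:R * b).
Proof.
move=> h; elim: k => [|k IH].
  rewrite mul0r; apply: germ_ext (germ_cst 1) => t; by rewrite expr0.
have := germM h IH; rewrite !mul1r mulr1 => h'.
rewrite (_ : _ * b = k%:R * b + b); last by rewrite -addn1 natrD; ring.
by apply: germ_ext h' => t; rewrite exprS.
Qed.

Lemma germXz1 f b (z : int) : germ f 1 b -> germ (fun t => f t ^ z) 1 (z%:~R * b).
Proof.
case: z => k h; first exact: germX1.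
have := germV (oner_neq0 E) (germX1 k.+1 h).
rewrite invr1 expr1n divr1 NegzE mulrNz mulNr => h'.
exact: h'.
Qed.

Lemma germ_prod1 (I : finType) (f : I -> E -> E) (b : I -> E) :
  (forall i, germ (f i) 1 (b i)) ->
  germ (fun t => \prod_i f i t) 1 (\sum_i b i).
Proof.
move=> h; elim: (index_enum I) => [|i r IH].
  rewrite !big_nil; apply: germ_ext (germ_cst 1) => t; by rewrite big_nil.
rewrite !big_cons; have := germM (h i) IH; rewrite !mul1r mulr1 addrC => h'.
by apply: germ_ext h' => t; rewrite big_cons.
Qed.

Section Curves.
Context (S : finType) (m : nat).
Local Notation G := (S -> 'M[E]_m).

Definition one_g : G := fun=> 1%:M.

Definition mcurve (g : E -> G) (Y X : G) : Prop :=
  forall s i j, germ (fun t => g t s i j) (Y s i j) (X s i j).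

Definition lin_form (d : G -> E) : Prop :=
  forall a (X Y : G), d (fun s => a *: X s + Y s) = a * d X + d Y.

(** The functions with a differential at the identity. *)
Definition diff1 (f : G -> E) : Prop :=
  exists2 d : G -> E, lin_form d &
    forall g X, mcurve g one_g X -> germ (fun t => f (g t)) (f one_g) (d X).

Lemma diff1_cst a : diff1 (fun=> a).
Proof.
exists (fun=> 0); first by move=> b X Y; rewrite mulr0 addr0.
by move=> g X _; exact: germ_cst.
Qed.

Lemma diff1_entry s i j : diff1 (fun g => g s i j).
Proof.
exists (fun X => X s i j); first by move=> a X Y; rewrite !mxE.
by move=> g X; apply.
Qed.

Lemma diff1D f h : diff1 f -> diff1 h -> diff1 (fun g => f g + h g).
Proof.
move=> [d dl df] [e el eh]; exists (fun X => d X + e X).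
  by move=> a X Y; rewrite dl el; ring.
by move=> g X gX; apply: germD; [exact: df | exact: eh].
Qed.

Lemma diff1M f h : diff1 f -> diff1 h -> diff1 (fun g => f g * h g).
Proof.
move=> [d dl df] [e el eh]; exists (fun X => f one_g * e X + d X * h one_g).
  by move=> a X Y; rewrite dl el; ring.
by move=> g X gX; apply: germM; [exact: df | exact: eh].
Qed.

Lemma diff1V f : f one_g != 0 -> diff1 f -> diff1 (fun g => (f g)^-1).
Proof.
move=> f0 [d dl df]; exists (fun X => - d X / f one_g ^+ 2).
  by move=> a X Y; rewrite dl; ring.
by move=> g X gX; apply: germV => //; exact: df.
Qed.

Lemma diff1_sum (I : finType) (F : I -> G -> E) :
  (forall i, diff1 (F i)) -> diff1 (fun g => \sum_i F i g).
Proof.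
move=> h; elim: (index_enum I) => [|i r IH].
  by rewrite (_ : (fun _ => _) = fun=> 0); [exact: diff1_cst | apply/funext => g; rewrite big_nil].
rewrite (_ : (fun _ => _) = fun g => F i g + \sum_(j <- r) F j g).
  exact: diff1D.
by apply/funext => g; rewrite big_cons.
Qed.

Lemma diff1_prod (I : finType) (F : I -> G -> E) :
  (forall i, diff1 (F i)) -> diff1 (fun g => \prod_i F i g).
Proof.
move=> h; elim: (index_enum I) => [|i r IH].
  by rewrite (_ : (fun _ => _) = fun=> 1); [exact: diff1_cst | apply/funext => g; rewrite big_nil].
rewrite (_ : (fun _ => _) = fun g => F i g * \prod_(j <- r) F j g).
  exact: diff1M.
by apply/funext => g; rewrite big_cons.
Qed.

Lemma diff1_detF k (F : G -> 'M[E]_k) :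
  (forall i j, diff1 (fun g => F g i j)) -> diff1 (fun g => \det (F g)).
Proof.
move=> h; apply: diff1_sum => sg; apply: diff1M; first exact: diff1_cst.
by apply: diff1_prod.
Qed.

Lemma diff1_det s : diff1 (fun g => \det (g s)).
Proof. by apply: diff1_detF => i j; exact: diff1_entry. Qed.

Lemma diff1_cofactor s i j : diff1 (fun g => cofactor (g s) i j).
Proof.
apply: diff1M; first exact: diff1_cst.
apply: diff1_detF => a b.
rewrite (_ : (fun _ => _) = fun g : G => g s (lift i a) (lift j b)); last first.
  by apply/funext => g; rewrite !mxE.
exact: diff1_entry.
Qed.

Lemma det_one s : \det (one_g s) = 1 :> E. Proof. exact: det1. Qed.

Lemma curve_unit g X : mcurve g one_g X ->
  generic (fun t => forall s, g t s \in unitmx).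
Proof.
move=> gX; apply: generic_all => s; have [d _ dd] := diff1_det s.
have := dd _ _ gX; rewrite det_one => /(germ_neq0 (oner_neq0 _)).
by apply: generic_sub => t; rewrite unitmxE unitfE.
Qed.

Lemma mcurve_line X : mcurve (fun t s => 1%:M + t *: X s) one_g X.
Proof.
move=> s i j; have := germD (germ_cst (one_g s i j)) (germZ (X s i j) germ_id).
rewrite mulr0 mulr1 addr0 add0r; apply: germ_ext => t.
by rewrite !mxE mulrC.
Qed.

Lemma mcurve_mul g h X0 Y0 X Y : mcurve g X0 X -> mcurve h Y0 Y ->
  mcurve (fun t s => g t s *m h t s) (fun s => X0 s *m Y0 s)
         (fun s => X0 s *m Y s + X s *m Y0 s).
Proof.
move=> gX hY s i j; rewrite !mxE -big_split /=.
apply: germ_ext (germ_sum (fun k => germM (gX s i k) (hY s k j))) => t.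
by rewrite mxE.
Qed.

Lemma mcurve_cst X : mcurve (fun=> X) X (fun=> 0).
Proof. by move=> s i j; rewrite mxE; exact: germ_cst. Qed.

Lemma mcurve_eq g h X0 X : generic (fun t => g t = h t) ->
  mcurve g X0 X -> mcurve h X0 X.
Proof.
by move=> gh gX s i j; apply: germ_eq (gX s i j); apply: generic_sub gh => t ->.
Qed.

Lemma mcurve_uniq g X0 X Y0 Y : mcurve g X0 X -> mcurve g Y0 Y -> X0 = Y0 /\ X = Y.
Proof.
move=> h h'; split; apply/funext => s; apply/matrixP => i j.
  by have [-> _] := germ_uniq (h s i j) (h' s i j).
by have [_ ->] := germ_uniq (h s i j) (h' s i j).
Qed.

(** The inverse has some expansion, because its entries are quotients of
    cofactors by the determinant; the product with g determines it. *)
Lemma mcurve_inv g X : mcurve g one_g X ->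
  mcurve (fun t s => invmx (g t s)) one_g (fun s => - X s).
Proof.
move=> gX.
have inv_diff s i j : diff1 (fun g : G => (\det (g s))^-1 * cofactor (g s) j i).
  apply: diff1M; last exact: diff1_cofactor.
  by apply: diff1V; [rewrite det_one oner_neq0 | exact: diff1_det].
have [Y hY] : exists Y, mcurve (fun t s => invmx (g t s)) one_g Y.
  have /choice [Y hY] : forall q : S * 'I_m * 'I_m, exists b,
      germ (fun t => invmx (g t q.1.1) q.1.2 q.2) (one_g q.1.1 q.1.2 q.2) b.
    move=> [[s i] j] /=; have [d _ hd] := inv_diff s i j.
    exists (d X); have := hd _ _ gX.
    have -> : (\det (one_g s))^-1 * cofactor (one_g s) j i = one_g s i j.
      have := congr1 (fun A : 'M[E]_m => A i j) (@invmx1 E m).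
      by rewrite /invmx unitmx1 !mxE.
    apply: germ_eq; apply: generic_sub (curve_unit gX) => t u.
    by rewrite /invmx u !mxE.
  exists (fun s => \matrix_(i, j) Y (s, i, j)) => s i j; rewrite mxE.
  exact: (hY (s, i, j)).
have := mcurve_mul gX hY; set Z1 := fun t s => _; set Z0 := fun s => _; set Z := fun s => _ => gh.
have : mcurve (fun=> one_g) Z0 Z.
  apply: mcurve_eq gh; apply: generic_sub (curve_unit gX) => t u.
  by apply/funext => s; rewrite /Z1 mulmxV.
move=> /(mcurve_uniq (mcurve_cst one_g))[_ e].
suff <- : Y = (fun s => - X s) by [].
apply/funext => s; have := congr1 (fun F => F s) e; rewrite /Z /= /one_g mul1mx mulmx1.
by move/esym/eqP; rewrite addr_eq0 => /eqP.
Qed.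

End Curves.
End Germs.

(** * The derived representation *)

Section RepDiff.
Context (R : realType) (p : nat) (N : field_data R) (C : coef_data p N).
Local Notation S := (Sinf N).
Local Notation E := (EF C).

Lemma charE : [pchar E] =i pred0.
Proof. by apply/pcharf0P => i; exact: natE_eq0. Qed.

Lemma regular_diff1 m (f : Gmx C m -> E) : regular_fun f -> diff1 f.
Proof.
elim=> [a|s i j|s|f1 h1 _ IH1 _ IH2|f1 h1 _ IH1 _ IH2].
- exact: diff1_cst.
- exact: diff1_entry.
- by apply: diff1V; [rewrite det_one oner_neq0 | exact: diff1_det].
- exact: diff1D.
- exact: diff1M.
Qed.

Context (m : nat) (V : vectType E) (rho : Gmx C m -> 'End(V)).
Hypothesis rho_alg : algebraic_rep rho.
Local Notation G := (Gmx C m).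
Local Notation one := (@one_g E S m).

Lemma rho1 v : rho one v = v.
Proof. by have [h _ _] := rho_alg; rewrite [rho _]h id_lfunE. Qed.

Lemma rhoM (g h : G) v : GE g -> GE h -> rho (fun s => g s *m h s) v = rho g (rho h v).
Proof. by have [_ e _] := rho_alg => hg hh; rewrite e // comp_lfunE. Qed.

Definition vcoord (i : 'I_(\dim {:V})) : 'Hom(V, E^o) :=
  linfun (coord (vbasis {:V}) i : V -> E^o).

Definition vb (i : 'I_(\dim {:V})) : V := (vbasis {:V})`_i.

Lemma vcoord_expand v : v = \sum_i vcoord i v *: vb i.
Proof.
rewrite {1}[v](coord_vbasis (memvf v)).
by apply: eq_bigr => i _; rewrite lfunE.
Qed.

Lemma hom_expand (l : 'Hom(V, E^o)) (c : 'I_(\dim {:V}) -> E) :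
  \sum_i (l (vb i) : E) * c i = l (\sum_i c i *: vb i).
Proof. by rewrite linear_sum; apply: eq_bigr => i _; rewrite linearZ mulrC. Qed.

Lemma lfunP_E (l : 'Hom(V, E^o)) a u v : l (a *: u + v) = a * l u + l v :> E.
Proof. by rewrite linearP. Qed.

Lemma lfunZ_E (l : 'Hom(V, E^o)) a u : l (a *: u) = a * l u :> E.
Proof. by rewrite linearZ. Qed.

Lemma vsep u v : (forall l : 'Hom(V, E^o), l u = l v) -> u = v.
Proof.
by move=> h; rewrite [u]vcoord_expand [v]vcoord_expand; apply: eq_bigr => i _; rewrite h.
Qed.

(** u is the derivative of rho at the identity in the direction X, applied to
    v. *)
Definition is_drho (X : G) (v u : V) : Prop :=
  forall (l : 'Hom(V, E^o)) g, mcurve g one X ->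
    germ (fun t => l (rho (g t) v)) (l v) (l u).

Lemma is_drho_uniq X v u u' : is_drho X v u -> is_drho X v u' -> u = u'.
Proof.
move=> h h'; apply: vsep => l.
by have [_ ->] := germ_uniq charE (h l _ (mcurve_line X)) (h' l _ (mcurve_line X)).
Qed.

(** Regularity of the matrix coefficients makes them differentiable, with a
    linear differential; it is collected coordinate by coordinate. *)
Lemma is_drho_exists v : exists d : G -> V,
  (forall X, is_drho X v (d X)) /\
  forall a (X Y : G), d (fun s => a *: X s + Y s) = a *: d X + d Y.
Proof.
have [_ _ reg] := rho_alg.
have coefP (l : 'Hom(V, E^o)) : exists2 d : G -> E, lin_form d &
    forall g X, mcurve g one X -> germ (fun t => l (rho (g t) v)) (l v) (d X).
  have [f rf hf] := reg v l; have [d dl hd] := regular_diff1 rf.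
  exists d => // g X gX; have := hd _ _ gX.
  have -> : f one = l v by rewrite -hf ?rho1 // => s; exact: unitmx1.
  apply: germ_eq; apply: generic_sub (curve_unit gX) => t u.
  by rewrite -hf.
have /choice [d hd] : forall i, exists d : G -> E, lin_form d /\
    forall g X, mcurve g one X ->
      germ (fun t => vcoord i (rho (g t) v)) (vcoord i v) (d X).
  by move=> i; have [d ? ?] := coefP (vcoord i); exists d.
exists (fun X => \sum_i d i X *: vb i); split=> [X l g gX|a X Y].
  have : germ (fun t => \sum_i (l (vb i) : E) * vcoord i (rho (g t) v))
      (\sum_i (l (vb i) : E) * vcoord i v) (\sum_i (l (vb i) : E) * d i X).
    by apply: germ_sum => i; apply: germZ; exact: (hd i).2.
  rewrite !hom_expand -vcoord_expand; apply: germ_ext => t.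
  by rewrite hom_expand -vcoord_expand.
rewrite scaler_sumr -big_split; apply: eq_bigr => i _ /=.
by rewrite (hd i).1 scalerDl scalerA.
Qed.

Definition drho (X : G) (v : V) : V := xget 0 [set u | is_drho X v u].

Lemma drhoP X v : is_drho X v (drho X v).
Proof.
have [d [hd _]] := is_drho_exists v.
by apply: (@xgetPex _ 0 [set u | is_drho X v u]); exists (d X); exact: hd.
Qed.

Lemma drho_eq X v u : is_drho X v u -> drho X v = u.
Proof. by move=> h; exact: (is_drho_uniq (@drhoP X v) h). Qed.

Lemma drho_linX a X Y v : drho (fun s => a *: X s + Y s) v = a *: drho X v + drho Y v.
Proof.
have [d [hd dl]] := is_drho_exists v.
by rewrite (drho_eq (hd _)) dl (drho_eq (hd X)) (drho_eq (hd Y)).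
Qed.

Lemma drho_linv X a u v : drho X (a *: u + v) = a *: drho X u + drho X v.
Proof.
apply: drho_eq => l g gX; rewrite !lfunP_E.
have := germD (germZ a (@drhoP X u l _ gX)) (@drhoP X v l _ gX).
by apply: germ_ext => t; rewrite linearP lfunP_E.
Qed.

Lemma drho_v0 X : drho X 0 = 0.
Proof.
have := drho_linv X 1 0 0; rewrite !scale1r addr0 => /eqP.
by rewrite -subr_eq0 opprD addrA subrr sub0r oppr_eq0 => /eqP.
Qed.

Lemma drho_X0 v : drho (fun=> 0) v = 0.
Proof.
have := drho_linX 1 (fun=> 0) (fun=> 0) v; rewrite !scale1r.
rewrite (_ : (fun=> 0 + 0) = (fun=> 0) :> G); last first.
  by apply/funext => s; rewrite addr0.
by move/eqP; rewrite -subr_eq0 opprD addrA subrr sub0r oppr_eq0 => /eqP.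
Qed.

Lemma drhoZv X a v : drho X (a *: v) = a *: drho X v.
Proof. by have := drho_linv X a v 0; rewrite drho_v0 !addr0. Qed.

Lemma drhoDv X u v : drho X (u + v) = drho X u + drho X v.
Proof. by have := drho_linv X 1 u v; rewrite !scale1r. Qed.

Lemma drhoZX X a v : drho (fun s => a *: X s) v = a *: drho X v.
Proof.
have := drho_linX a X (fun=> 0) v; rewrite drho_X0 addr0 => <-.
by congr drho; apply/funext => s; rewrite addr0.
Qed.

Lemma drhoDX X Y v : drho (fun s => X s + Y s) v = drho X v + drho Y v.
Proof.
have := drho_linX 1 X Y v; rewrite scale1r => <-.
by congr drho; apply/funext => s; rewrite scale1r.
Qed.

Lemma drho_sumX (I : finType) (F : I -> G) v :
  drho (fun s => \sum_i F i s) v = \sum_i drho (F i) v.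
Proof.
elim: (index_enum I) => [|i r IH].
  rewrite big_nil -[RHS](drho_X0 v); congr drho; by apply/funext => s; rewrite big_nil.
rewrite big_cons -IH -drhoDX; congr drho; by apply/funext => s; rewrite big_cons.
Qed.

Lemma drho_sumv (I : finType) X (F : I -> V) :
  drho X (\sum_i F i) = \sum_i drho X (F i).
Proof.
elim: (index_enum I) => [|i r IH]; first by rewrite !big_nil drho_v0.
by rewrite !big_cons drhoDv IH.
Qed.

(** The polynomial expansion of rho (1 + t X) v by which Lie algebra elements
    act on the lattice has the derivative as its linear term. *)
Lemma lie_acts_drho X v u : lie_acts rho X v u -> drho X v = u.
Proof.
move=> [k [c [c1 hc]]].
have key (l : 'Hom(V, E^o)) : l (drho X v) = l u.
  have := @drhoP X v l _ (mcurve_line X).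
  pose P : {poly E} := \poly_(i < k.+2) (l (c i) : E).
  have P1 : P`_1 = l u by rewrite coef_poly c1.
  have : germ (fun t => l (rho (fun s => 1%:M + t *: X s) v)) P`_0 P`_1.
    apply: germ_ext (germ_poly P) => t; rewrite hc linear_sum horner_poly.
    by apply: eq_bigr => i _; rewrite linearZ mulrC.
  by rewrite P1 => h /(germ_uniq charE h)[].
exact: vsep.
Qed.

Lemma conj_unit_line (g X : G) t : GE g ->
  (fun s => 1%:M + t *: (g s *m X s *m invmx (g s))) =
  (fun s => g s *m (1%:M + t *: X s) *m invmx (g s)).
Proof.
move=> gE; apply/funext => s; rewrite mulmxDr mulmxDl mulmx1 mulmxV //.
by rewrite -scalemxAr -scalemxAl.
Qed.

Lemma GE_mul (g h : G) : GE g -> GE h -> GE (fun s => g s *m h s).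
Proof. by move=> gE hE s; rewrite unitmx_mul gE hE. Qed.

Lemma GE_inv (g : G) : GE g -> GE (fun s => invmx (g s)).
Proof. by move=> gE s; rewrite unitmx_inv. Qed.

Lemma rhoVK (g : G) v : GE g -> rho (fun s => invmx (g s)) (rho g v) = v.
Proof.
move=> gE; rewrite -rhoM //; last exact: GE_inv.
rewrite -[RHS]rho1; congr (rho _ _); by apply/funext => s; rewrite mulVmx.
Qed.

Lemma drho_Ad (g X : G) v : GE g ->
  rho g (drho X v) = drho (fun s => g s *m X s *m invmx (g s)) (rho g v).
Proof.
move=> gE; apply: vsep => l.
have h1 := @drhoP X v (l \o rho g)%VF _ (mcurve_line X).
have h2 := @drhoP (fun s => g s *m X s *m invmx (g s)) (rho g v) l _ (mcurve_line _).
rewrite !comp_lfunE in h1.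
have h3 : germ (fun t => l (rho (fun s => 1%:M + t *: (g s *m X s *m invmx (g s))) (rho g v)))
    (l (rho g v)) (l (rho g (drho X v))).
  apply: germ_eq h1; apply: generic_sub (curve_unit (mcurve_line X)) => t u.
  have u' : GE (fun s => 1%:M + t *: X s) by exact: u.
  have gXE : GE (fun s => g s *m (1%:M + t *: X s)) by exact: GE_mul.
  have gXVE := GE_mul gXE (GE_inv gE).
  rewrite comp_lfunE conj_unit_line // -!rhoM //; congr (l (rho _ v)); apply/funext => s.
  by rewrite -mulmxA mulVmx // mulmx1.
by have [_ ->] := germ_uniq charE h2 h3.
Qed.

Definition unit_mx (q : S * 'I_m * 'I_m) : G :=
  fun s => if s == q.1.1 then delta_mx q.1.2 q.2 else 0.

Lemma Gmx_expand (X : G) : X = fun s => \sum_q X q.1.1 q.1.2 q.2 *: unit_mx q s.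
Proof.
apply/funext => s; rewrite {1}[X s]matrix_sum_delta pair_big /=.
rewrite (eq_bigr (fun q => X q.1.1 q.1.2 q.2 *: unit_mx q s));  last by [].
rewrite -(pair_bigA _ (fun sr c => X sr.1 sr.2 c *: unit_mx (sr, c) s)) /=.
rewrite -(pair_bigA _ (fun s' r => \sum_c X s' r c *: unit_mx (s', r, c) s)) /=.
rewrite (bigD1 s) //= [X in _ + X]big1 ?addr0 => [|s' ss'].
  by rewrite pair_big /=; apply: eq_bigr => q _; rewrite /unit_mx /= eqxx.
rewrite big1 // => r _; rewrite big1 // => c _; rewrite /unit_mx /=.
by rewrite eq_sym (negPf ss') scaler0.
Qed.

(** In coordinates drho is bilinear, so the Leibniz rule applies. *)
Lemma germ_drho (Z : E -> G) (w : E -> V) Y Y' (v v' : V) (l : 'Hom(V, E^o)) :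
  mcurve Z Y Y' -> (forall l : 'Hom(V, E^o), germ (fun t => l (w t)) (l v) (l v')) ->
  germ (fun t => l (drho (Z t) (w t))) (l (drho Y v)) (l (drho Y v' + drho Y' v)).
Proof.
move=> hZ hw.
pose b (q : S * 'I_m * 'I_m) i : E := l (drho (unit_mx q) (vb i)).
have lE X u : l (drho X u)
    = \sum_q \sum_i X q.1.1 q.1.2 q.2 * vcoord i u * b q i :> E.
  rewrite {1}[X]Gmx_expand drho_sumX linear_sum; apply: eq_bigr => q _ /=.
  rewrite {1}[u]vcoord_expand drho_sumv linear_sum; apply: eq_bigr => i _ /=.
  by rewrite drhoZX drhoZv !lfunZ_E mulrA.
have : germ (fun t => \sum_q \sum_i Z t q.1.1 q.1.2 q.2 * vcoord i (w t) * b q i)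
    (\sum_q \sum_i Y q.1.1 q.1.2 q.2 * vcoord i v * b q i)
    (\sum_q \sum_i (Y q.1.1 q.1.2 q.2 * vcoord i v' * b q i
                    + Y' q.1.1 q.1.2 q.2 * vcoord i v * b q i)).
  apply: germ_sum => q; apply: germ_sum => i.
  have := germM (germM (hZ q.1.1 q.1.2 q.2) (hw (vcoord i))) (germ_cst (b q i)).
  by rewrite mulr0 add0r mulrDl.
under [X in germ _ _ X]eq_bigr do rewrite big_split.
rewrite big_split /= -!lE linearD /=.
by apply: germ_ext => t; rewrite lE.
Qed.

(** Differentiating the equivariance of the derived representation under
    conjugation by 1 + t X. *)
Lemma drho_bracket (X Y : G) v :
  drho X (drho Y v) =
  drho Y (drho X v) + drho (fun s => X s *m Y s - Y s *m X s) v.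
Proof.
apply: vsep => l.
have hX := mcurve_line X.
have h1 := @drhoP X (drho Y v) l _ hX.
have hZ := mcurve_mul (mcurve_mul hX (mcurve_cst Y)) (mcurve_inv charE hX).
have h2 := germ_drho l hZ (fun l => @drhoP X v l _ hX).
have gen : generic (fun t => l (drho
    (fun s => (1%:M + t *: X s) *m Y s *m invmx (1%:M + t *: X s))
    (rho (fun s => 1%:M + t *: X s) v)) =
    l (rho (fun s => 1%:M + t *: X s) (drho Y v))).
  by apply: generic_sub (curve_unit hX) => t u; rewrite drho_Ad.
have [_ <-] := germ_uniq charE (germ_eq gen h2) h1.
congr (l (drho _ _ + drho _ _)); apply/funext => s.
  by rewrite mulmx1 mul1mx.
by rewrite mulmx0 add0r mulmx1 mul1mx mulmxN addrC.
Qed.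

End RepDiff.

(** * Weights *)

Section BigCell.
Context (E : fieldType).

Definition lower_unip m (L : 'M[E]_m) : Prop :=
  forall i j : 'I_m, (i <= j)%N -> L i j = (i == j)%:R.
Definition upper_unip m (U : 'M[E]_m) : Prop :=
  forall i j : 'I_m, (j <= i)%N -> U i j = (i == j)%:R.

Definition in_big_cell m (M : 'M[E]_m) : Prop :=
  exists (L : 'M[E]_m) (d : 'rV[E]_m) (U : 'M[E]_m), [/\ lower_unip L, upper_unip U,
    forall i, d 0 i != 0 & M = L *m diag_mx d *m U].

(** At order zero the matrix is the identity, so its first entry is
    generically invertible, and the Schur complement is of the same kind. *)
Lemma big_cell_generic m (M : E -> 'M[E]_m) :
  (forall i j, exists b, germ (fun t => M t i j) (i == j)%:R b) ->
  generic (fun t => in_big_cell (M t)).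
Proof.
elim: m M => [M gM|m IH].
  exists 1; first by rewrite coef1 oner_neq0.
  move=> t _; exists 1%:M, (0 : 'rV[E]_0), 1%:M.
  by split=> [[]|[]|[]|] //; apply/matrixP => -[].
rewrite -[m.+1]/(1 + m)%N => M gM; pose l0 : 'I_(1 + m) := lshift m (0 : 'I_1).
pose a t := M t l0 l0.
pose u t : 'rV[E]_m := ursubmx (M t : 'M[E]_(1 + m)).
pose c t : 'cV[E]_m := dlsubmx (M t : 'M[E]_(1 + m)).
pose Sc t : 'M[E]_m := drsubmx (M t : 'M[E]_(1 + m)) - (a t)^-1 *: (c t *m u t).
have [b0 ga] := gM l0 l0.
have ga' : germ a 1 b0 by move: ga; rewrite eqxx.
have gS i j : exists b, germ (fun t => Sc t i j) (i == j)%:R b.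
  have [b1 g1] := gM (rshift 1 i) (rshift 1 j).
  have [b2 g2] := gM (rshift 1 i) l0.
  have [b3 g3] := gM l0 (rshift 1 j).
  have gaV := germV (oner_neq0 E) ga'.
  have := germD g1 (germZ (-1) (germM gaV (germM g2 g3))).
  rewrite (inj_eq (@rshift_inj _ _)) eq_rlshift eq_lrshift !mul0r !mulr0 addr0.
  set b := (X in germ _ _ X) => h; exists b.
  apply: germ_ext h => t; rewrite !mxE big_ord1 !mxE /a.
  rewrite mulN1r; congr (_ - _ * (_ * _)); congr (M t _ _); exact/val_inj.
have [D D0 hD] := genericI (germ_neq0 (oner_neq0 E) ga') (IH Sc gS).
exists D => // t /hD[a0 [L [d [U [hL hU d0 SE]]]]].
exists (block_mx 1%:M 0 ((a t)^-1 *: c t) L : 'M[E]_(1 + m)).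
exists (row_mx (a t)%:M d : 'rV[E]_(1 + m)).
exists (block_mx 1%:M ((a t)^-1 *: u t) 0 U : 'M[E]_(1 + m)).
split.
- move=> i j; case: (split_ordP (i : 'I_(1 + m))) => i' ->;
    case: (split_ordP (j : 'I_(1 + m))) => j' -> /= ij.
  + by rewrite block_mxEul mxE (inj_eq (@lshift_inj _ _)).
  + by rewrite block_mxEur mxE eq_lrshift.
  + by move: ij; rewrite (ord1 j') /= add1n.
  + by rewrite block_mxEdr hL ?(inj_eq (@rshift_inj _ _)).
- move=> i j; case: (split_ordP (i : 'I_(1 + m))) => i' ->;
    case: (split_ordP (j : 'I_(1 + m))) => j' -> /= ij.
  + by rewrite block_mxEul mxE (inj_eq (@lshift_inj _ _)).
  + by move: ij; rewrite (ord1 i') /= add1n.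
  + by rewrite block_mxEdl mxE eq_rlshift.
  + by rewrite block_mxEdr hU ?(inj_eq (@rshift_inj _ _)).
- move=> i; case: (split_ordP (i : 'I_(1 + m))) => i' ->.
  + by rewrite row_mxEl (ord1 i') mxE eqxx mulr1n.
  + by rewrite row_mxEr.
- rewrite diag_mx_row (_ : diag_mx (a t)%:M = (a t)%:M); last first.
    by apply/matrixP => i j; rewrite !mxE (ord1 i) (ord1 j) !eqxx.
  rewrite !mulmx_block !(mul0mx, mulmx0, mul1mx, mulmx1, addr0, add0r) -SE.
  rewrite -!scalemxAl !mul_mx_scalar mul_scalar_mx -!scalemxAl.
  rewrite !scalerA mulVf // divff // !scale1r.
  rewrite -scalemxAr /Sc addrC subrK.
  rewrite -[LHS](@submxK _ 1 m 1 m); congr (block_mx _ _ _ _).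
  apply/matrixP => i j; rewrite !mxE (ord1 i) (ord1 j) eqxx mulr1n /a.
  by congr (M t _ _); exact/val_inj.
Qed.

End BigCell.

Section Weights.
Context (R : realType) (p : nat) (N : field_data R) (C : coef_data p N).
Local Notation S := (Sinf N).
Local Notation E := (EF C).
Context (m : nat).
Local Notation G := (Gmx C m).

(** The inverse determinants are constant along such a curve. *)
Lemma regular_poly (Q : S -> 'M[{poly E}]_m) (f : G -> E) :
  (forall t s, \det (map_mx (horner_eval t) (Q s)) = 1) -> regular_fun f ->
  exists P : {poly E}, forall t, f (fun s => map_mx (horner_eval t) (Q s)) = P.[t].
Proof.
move=> dQ; elim=> [a|s i j|s|f1 h1 _ [P1 IH1] _ [P2 IH2]|f1 h1 _ [P1 IH1] _ [P2 IH2]].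
- by exists a%:P => t; rewrite hornerC.
- by exists (Q s i j) => t; rewrite mxE.
- by exists 1 => t; rewrite dQ invr1 hornerE.
- by exists (P1 + P2) => t; rewrite hornerD IH1 IH2.
- by exists (P1 * P2) => t; rewrite hornerM IH1 IH2.
Qed.

Definition line (X : G) (t : E) : G := fun s => 1%:M + t *: X s.

Lemma det_line (X : G) s : exists D : {poly E}, forall t, \det (line X t s) = D.[t].
Proof.
exists (\det (1%:M + 'X *: map_mx polyC (X s))) => t.
rewrite -[RHS]/(horner_eval t _) -det_map_mx; congr (\det _).
apply/matrixP => i j; rewrite /line !mxE /= /horner_eval hornerD hornerM hornerX hornerC.
by case: eqP => _; rewrite /= ?mulr1n ?mulr0n ?hornerC.
Qed.

(** A power of the determinants clears the denominators. *)
Lemma regular_line (X : G) (f : G -> E) : regular_fun f ->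
  exists (P : {poly E}) k, forall t, GE (line X t) ->
    f (line X t) * (\prod_s \det (line X t s)) ^+ k = P.[t].
Proof.
have /choice [D hD] := det_line X.
have prodE t : \prod_s \det (line X t s) = (\prod_s D s).[t].
  by rewrite horner_prod; apply: eq_bigr => s _.
elim=> [a|s i j|s|f1 h1 _ [P1 [k1 IH1]] _ [P2 [k2 IH2]]
       |f1 h1 _ [P1 [k1 IH1]] _ [P2 [k2 IH2]]].
- by exists a%:P, 0%N => t _; rewrite expr0 mulr1 hornerC.
- exists ((i == j)%:R%:P + 'X * (X s i j)%:P), 0%N => t _.
  by rewrite expr0 mulr1 !mxE !hornerE.
- exists (\prod_(s' | s' != s) D s'), 1%N => t u.
  rewrite expr1 (bigD1 s) //= mulKf; last by have := u s; rewrite unitmxE unitfE.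
  by rewrite horner_prod; apply: eq_bigr.
- exists (P1 * (\prod_s D s) ^+ k2 + P2 * (\prod_s D s) ^+ k1), (k1 + k2)%N => t u.
  rewrite hornerD !hornerM !horner_exp -prodE -(IH1 _ u) -(IH2 _ u) exprD; ring.
- exists (P1 * P2), (k1 + k2)%N => t u.
  by rewrite hornerM -(IH1 _ u) -(IH2 _ u) exprD; ring.
Qed.

Context (V : vectType E) (rho : G -> 'End(V)).
Hypotheses (rho_alg : algebraic_rep rho) (rho_irr : irreducible_rep rho).

(** Take a subspace of largest dimension on which P holds. *)
Lemma subspace_of_pred (P : V -> Prop) : P 0 ->
  (forall a u v, P u -> P v -> P (a *: u + v)) ->
  exists W : {vspace V}, forall v, v \in W <-> P v.
Proof.
move=> P0 Plin.
pose pr k := `[< exists W : {vspace V}, \dim W = k /\ forall v, v \in W -> P v >].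
have ex : exists k, pr k.
  by exists 0%N; apply/asboolP; exists 0%VS; rewrite dimv0; split=> // v /[!memv0]/eqP->.
have bd k : pr k -> (k <= \dim {:V})%N.
  by move=> /asboolP[W [<- _]]; rewrite dimvS ?subvf.
case: (ex_maxnP ex bd) => k /asboolP[W [dW WP]] kmax.
exists W => v; split=> [/WP //|Pv].
apply: contraT => vW; have : (\dim (W + <[v]>) <= k)%N.
  apply: kmax; apply/asboolP; exists (W + <[v]>)%VS; split=> // u.
  move=> /memv_addP[w /WP Pw [x /vlineP[a ->] ->]].
  by rewrite addrC; exact: Plin.
rewrite -dW => h; have /eqP eW : W == (W + <[v]>)%VS by rewrite eqEdim addvSl.
by case/negP: vW; rewrite eW (subvP (addvSr W <[v]>%VS)) ?memv_line.
Qed.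

Context (lam : S -> 'I_m -> int) (vp : V).
Hypotheses (vp0 : vp != 0) (vpt : torus_acts rho lam vp)
  (vpN : forall g, unipotentN g -> rho g vp = vp).

(** The vectors all of whose translates are killed by phi form a stable
    subspace, which contains the highest weight vector. *)
Lemma hw_generates (phi : 'End(V)) :
  (forall g, GE g -> phi (rho g vp) = 0) -> forall v, phi v = 0.
Proof.
move=> h; pose P v := forall g, GE g -> phi (rho g v) = 0.
have [|a u v Pu Pv g gE|W WP] := @subspace_of_pred P.
- by move=> g gE; rewrite !linear0.
- by rewrite !(linearD, linearZ) /= Pu // Pv // scaler0 addr0.
have [_ irr] := rho_irr; case: (irr W).
- move=> g gE; apply/subvP => _ /memv_imgP[v /WP Pv ->]; apply/WP => g' g'E.
  by rewrite -rhoM //; apply: Pv; exact: GE_mul.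
- move=> W0; have /WP : P vp by [].
  by rewrite W0 memv0 (negPf vp0).
- move=> WV v; have /WP/(_ (@one_g E S m)) : v \in W by rewrite WV memvf.
  by rewrite rho1 // => -> // s; exact: unitmx1.
Qed.

(** The big cell is dense, and its Borel part acts on a highest weight vector
    through scalars. *)
Lemma lower_unip_generates (phi : 'End(V)) :
  (forall L : G, (forall s, lower_unip (L s)) -> phi (rho L vp) = 0) ->
  forall v, phi v = 0.
Proof.
move=> h; apply: hw_generates => g gE; apply: vsep => l; rewrite linear0.
have [_ _ reg] := rho_alg; have [f rf hf] := reg vp (l \o phi)%VF.
pose X : G := fun s => g s - 1%:M.
have [P [k hP]] := regular_line X rf.
have P0 : P = 0.
  apply: (poly_eq_generic (charE C)).
  have hcell : generic (fun t => forall s, in_big_cell (line X t s)).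
    apply: generic_all => s; apply: big_cell_generic => i j.
    exists (X s i j); have := mcurve_line X s i j.
    by rewrite /one_g mxE.
  apply: generic_sub (genericI hcell (curve_unit (mcurve_line X))) => t [hc hu].
  rewrite horner0 -hP // -hf //.
  have /choice [L] : forall s, exists L : 'M[E]_m, exists (d : 'rV[E]_m) (U : 'M[E]_m),
      [/\ lower_unip L, upper_unip U, forall i, d 0 i != 0 &
          line X t s = L *m diag_mx d *m U] by move=> s; exact: hc.
  move=> /choice[d] /choice[U] hLdU.
  have lineE : line X t = fun s => L s *m (diag_mx (d s) *m U s).
    by apply/funext => s; have [_ _ _ ->] := hLdU s; rewrite mulmxA.
  have uLDU s : [/\ L s \in unitmx, diag_mx (d s) \in unitmx & U s \in unitmx].
    have := hu s; rewrite -[1%:M + _]/(line X t s) lineE !unitmx_mul.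
    by case/and3P.
  have LE : GE (L : G) by move=> s; have [] := uLDU s.
  have dE : GE ((fun s => diag_mx (d s)) : G) by move=> s; have [] := uLDU s.
  have UE : GE (U : G) by move=> s; have [] := uLDU s.
  have dUE := GE_mul dE UE.
  have UN : unipotentN (U : G).
    by move=> s i j ij; have [_ hU _ _] := hLdU s; exact: hU.
  have d0 s i : d s 0 i != 0 by have [] := hLdU s.
  rewrite lineE !(rhoM rho_alg) // vpN // vpt //.
  rewrite comp_lfunE linearZ linearZ /= h; last by move=> s; have [] := hLdU s.
  by rewrite scaler0 linear0 mul0r.
have lineg : line X 1 = g.
  by apply/funext => s; rewrite /line scale1r addrC subrK.
have := hP 1; rewrite lineg P0 horner0 -hf // comp_lfunE => /(_ gE)/eqP.
rewrite mulf_eq0 expf_eq0 => /orP[/eqP //|/andP[_ /prodf_eq0[s _ d0]]].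
by have := gE s; rewrite unitmxE unitfE d0.
Qed.

Definition height (nu : S -> 'I_m -> int) : int :=
  \sum_s \sum_(i < m) (m - i)%:Z * nu s i.

(** Conjugation by this torus element multiplies the entry (i, j) by
    tau^(i - j), hence contracts lower unipotent matrices to the identity as
    tau tends to 0. *)
Definition cochar (tau : E) : S -> 'rV[E]_m := fun _ => \row_i tau ^- (m - i).

Lemma cochar_weight nu v tau : tau != 0 -> torus_acts rho nu v ->
  rho (fun s => diag_mx (cochar tau s)) v = tau ^ (- height nu) *: v.
Proof.
move=> t0 hv; rewrite hv; last by move=> s i; rewrite mxE invr_eq0 expf_neq0.
congr (_ *: _); rewrite /height -sumrN.
have big_exp (I : finType) (F : I -> int) : tau ^ (\sum_i F i) = \prod_i tau ^ F i.
  elim: (index_enum I) => [|i r IH]; first by rewrite !big_nil expr0z.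
  by rewrite !big_cons expfzDr // IH.
rewrite big_exp; apply: eq_bigr => s _; rewrite -sumrN big_exp.
by apply: eq_bigr => i _; rewrite mxE -mulNr -exprz_exp exprnN.
Qed.

Lemma det_lower_unip (L : 'M[E]_m) : lower_unip L -> \det L = 1.
Proof.
move=> hL; rewrite det_trig.
  by rewrite big1 // => i _; rewrite hL // eqxx.
apply/is_trig_mxP => i j ij; rewrite hL ?(ltnW ij) //.
by case: eqP => // eij; rewrite eij ltnn in ij.
Qed.

(** In other words, all weights have height at most that of lam. For the
    translates of vp by lower unipotent matrices this holds because the torus
    contracts these matrices; and such translates span. *)
Lemma height_bound (l : 'Hom(V, E^o)) v : exists P : {poly E}, forall tau, tau != 0 ->
  l (rho (fun s => diag_mx (cochar tau s)) v) = tau ^ (- height lam) * P.[tau] :> E.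
Proof.
pose bounded v := forall l : 'Hom(V, E^o), exists P : {poly E}, forall tau, tau != 0 ->
  l (rho (fun s => diag_mx (cochar tau s)) v) = tau ^ (- height lam) * P.[tau] :> E.
have [|a u w Pu Pw l'|W WP] := @subspace_of_pred bounded.
- by move=> l'; exists 0 => tau _; rewrite !linear0 horner0 mulr0.
- have [P hP] := Pu l'; have [Q hQ] := Pw l'.
  exists (a *: P + Q) => tau t0; rewrite linearP lfunP_E hP // hQ // hornerD hornerZ.
  by rewrite mulrDr mulrCA.
suff vW : v \in W by exact: (WP v).1.
suff /eqP : (\1 - projv W)%VF v = 0.
  rewrite add_lfunE opp_lfunE id_lfunE subr_eq0 => /eqP ->; exact: memv_proj.
apply: lower_unip_generates => L hL.
rewrite add_lfunE opp_lfunE id_lfunE projv_id ?subrr //; apply/WP => {l v} l.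
have [_ _ reg] := rho_alg; have [f rf hf] := reg vp l.
pose Q s : 'M[{poly E}]_m :=
  \matrix_(i, j) (if (j <= i)%N then (L s i j)%:P * 'X^(i - j) else 0).
pose Lt tau : G := fun s => map_mx (horner_eval tau) (Q s).
have LtE tau s i j : Lt tau s i j = if (j <= i)%N then L s i j * tau ^+ (i - j) else 0.
  rewrite !mxE /horner_eval; case: ifP => _; last by rewrite horner0.
  by rewrite hornerM hornerC hornerXn.
have Ltu tau s : lower_unip (Lt tau s).
  move=> i j; rewrite LtE leq_eqVlt => /predU1P[/val_inj ->|ij].
    by rewrite leqnn subnn mulr1 hL.
  by rewrite leqNgt ij /=; case: eqP => // eij; rewrite eij ltnn in ij.
have [P hP] := @regular_poly Q f (fun t s => det_lower_unip (Ltu t s)) rf.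
exists P => tau t0; rewrite -hP -[fun s => map_mx _ (Q s)]/(Lt tau) -hf; last first.
  by move=> s; rewrite unitmxE det_lower_unip ?unitr1.
have LE : GE L by move=> s; rewrite unitmxE det_lower_unip ?unitr1.
have LtEu : GE (Lt tau) by move=> s; rewrite unitmxE det_lower_unip ?unitr1.
have dE : GE ((fun s => diag_mx (cochar tau s)) : G).
  move=> s; rewrite unitmxE unitfE det_diag; apply/prodf_neq0 => i _.
  by rewrite mxE invr_eq0 expf_neq0.
have e : tau ^ (- height lam) *: rho (Lt tau) vp
    = rho (Lt tau) (rho (fun s => diag_mx (cochar tau s)) vp).
  by rewrite (cochar_weight t0 vpt) linearZ.
rewrite -lfunZ_E e -!(rhoM rho_alg) //.
congr (l (rho _ vp)); apply/funext => s; apply/matrixP => i j.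
rewrite mul_diag_mx mul_mx_diag mxE [RHS]mxE LtE !mxE.
have [ji|ij] := leqP j i; last first.
  by rewrite mul0r hL ?(ltnW ij) //; case: eqP => [eij|]; [rewrite eij ltnn in ij | rewrite mulr0].
have -> : (m - j = (i - j) + (m - i))%N by move: (ltn_ord i); lia.
by rewrite exprD invfM -mulrA mulVKf ?expf_neq0 // mulrC.
Qed.

(** On a vector of weight nu the function of height_bound is a multiple of tau
    ^ (- height nu), whose pole at 0 would be of too large an order. *)
Lemma weight_top nu u : torus_acts rho nu u -> height lam < height nu -> u = 0.
Proof.
move=> hu lt; apply: vsep => l; rewrite linear0.
have [P hP] := height_bound l u.
have [k hk] : exists k : nat, height nu - height lam = k.+1%:Z.
  by exists `|height nu - height lam|.-1%N; lia.
have e : 'X * (l u : E)%:P = 'X^(k.+2) * P.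
  apply: (poly_eq_generic (charE C)); exists 1; first by rewrite coef1 oner_neq0.
  move=> t _; rewrite [LHS]hornerM hornerX hornerC [RHS]hornerM hornerXn.
  have [->|t0] := eqVneq t 0; first by rewrite mul0r expr0n mul0r.
  have := hP t t0; rewrite (cochar_weight t0 hu) lfunZ_E => h.
  rewrite exprS -mulrA; congr (_ * _); apply: (mulfI (expfz_neq0 (- height nu) t0)).
  rewrite h mulrA; congr (_ * _).
  by rewrite -[t ^+ k.+1]/(t ^ k.+1) -hk -expfzDr //; congr (t ^ _); lia.
have := congr1 (fun q : {poly E} => q`_1) e.
by rewrite coefXM coefC /= coefXnM.
Qed.

Context (v0 : V).
Hypothesis v0t : torus_acts rho (fun s i => lam s (rev_ord i)) v0.

Definition longest : 'M[E]_m := \matrix_(i, j) (i == rev_ord j)%:R.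

Lemma longestK : longest *m longest = 1%:M.
Proof.
apply/matrixP => i j; rewrite !mxE (bigD1 (rev_ord i)) //= !mxE rev_ordK eqxx mul1r.
rewrite big1 ?addr0 => [|k ki]; first by rewrite (inj_eq rev_ord_inj).
by rewrite /longest !mxE -(inj_eq rev_ord_inj) rev_ordK eq_sym (negPf ki) mul0r.
Qed.

Lemma longest_unit : longest \in unitmx.
Proof. by have := mulmx1_unit longestK => -[]. Qed.

Lemma longest_conj (t : 'rV[E]_m) :
  diag_mx t *m longest = longest *m diag_mx (\row_i t 0 (rev_ord i)).
Proof.
apply/matrixP => i j; rewrite mul_diag_mx mul_mx_diag !mxE.
by case: eqP => [->|_]; rewrite ?mulr1 ?mul1r ?mulr0 ?mul0r.
Qed.

(** The lowest weight is the highest one reversed: were the image of v0 under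
    a negative root vector nonzero, the longest Weyl element would carry it to
    a vector of weight higher than the highest one. *)
Lemma lowest_killed s0 (i0 j0 : 'I_m) : (j0 < i0)%N ->
  drho rho (unit_mx C (s0, i0, j0)) v0 = 0.
Proof.
move=> ji; set u := drho _ _ _.
pose alpha s (i : 'I_m) : int := (s == s0)%:R * ((i == i0)%:R - (i == j0)%:R).
have prod_alpha (t : S -> 'rV[E]_m) : (forall s i, t s 0 i != 0) ->
    \prod_s \prod_i t s 0 i ^ alpha s i = t s0 0 i0 / t s0 0 j0.
  move=> t0; rewrite (bigD1 s0) //= [X in _ * X]big1 ?mulr1; last first.
    by move=> s /negPf ss; rewrite big1 // => i _; rewrite /alpha ss mul0r expr0z.
  have ij : i0 != j0 by apply: contraTneq ji => ->; rewrite ltnn.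
  rewrite (bigD1 i0) //= (bigD1 j0) 1?eq_sym //= big1 ?mulr1; last first.
    move=> i /andP[/negPf ii /negPf ij']; by rewrite /alpha ii ij' subrr mulr0 expr0z.
  rewrite /alpha !eqxx (negPf ij) eq_sym (negPf ij) subr0 sub0r !mul1r.
  by rewrite expr1z exprN1.
pose nu s i : int := lam s (rev_ord i) + alpha s i.
have hu : torus_acts rho nu u.
  move=> t t0; have tE : GE ((fun s => diag_mx (t s)) : G).
    by move=> s; rewrite unitmxE unitfE det_diag; apply/prodf_neq0.
  rewrite /u (drho_Ad rho_alg) // v0t // (drhoZv rho_alg) /nu.
  have -> : \prod_s \prod_i t s 0 i ^ (lam s (rev_ord i) + alpha s i) =
      (\prod_s \prod_i t s 0 i ^ lam s (rev_ord i)) * (t s0 0 i0 / t s0 0 j0).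
    rewrite -prod_alpha // -big_split; apply: eq_bigr => s _.
    by rewrite -big_split; apply: eq_bigr => i _; rewrite expfzDr.
  rewrite -[RHS]scalerA -[in RHS](drhoZX rho_alg); congr (_ *: drho _ _ _).
  apply/funext => s; rewrite /unit_mx /=.
  have [->|_] := eqVneq s s0; last by rewrite mulmx0 mul0mx scaler0.
  apply: (canLR (mulmxK (tE s0))); apply/matrixP => i j.
  rewrite mul_diag_mx mul_mx_diag !mxE.
  case: eqP => [->|_]; case: eqP => [->|_] /=; rewrite ?(mulr0, mul0r, mulr1) //.
  by rewrite divfK.
pose w : G := fun=> longest.
have wE : GE w by move=> s; exact: longest_unit.
have hw : torus_acts rho (fun s i => nu s (rev_ord i)) (rho w u).
  move=> t t0; have tE : GE ((fun s => diag_mx (t s)) : G).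
    by move=> s; rewrite unitmxE unitfE det_diag; apply/prodf_neq0.
  pose t' s : 'rV[E]_m := \row_i t s 0 (rev_ord i).
  have t'0 s i : t' s 0 i != 0 by rewrite mxE.
  have t'E : GE ((fun s => diag_mx (t' s)) : G).
    by move=> s; rewrite unitmxE unitfE det_diag; apply/prodf_neq0.
  rewrite -(rhoM rho_alg) //.
  rewrite (_ : (fun s => _) = fun s => w s *m diag_mx (t' s)); last first.
    by apply/funext => s; rewrite longest_conj.
  rewrite (rhoM rho_alg) // hu // linearZ; congr (_ *: _); apply: eq_bigr => s _.
  rewrite (reindex_inj rev_ord_inj) /=; apply: eq_bigr => i _.
  by rewrite mxE rev_ordK.
have u0 : rho w u = 0.
  apply: weight_top hw _; rewrite /height.
  have -> : \sum_s \sum_(i < m) (m - i)%:Z * nu s (rev_ord i) =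
      \sum_s (\sum_(i < m) (m - i)%:Z * lam s i) + (i0%:Z - j0%:Z).
    have -> : i0%:Z - j0%:Z = \sum_s \sum_(i < m) (m - i)%:Z * alpha s (rev_ord i).
      rewrite (bigD1 s0) //= [X in _ = _ + X]big1 ?addr0; last first.
        by move=> s /negPf ss; rewrite big1 // => i _; rewrite /alpha ss mul0r mulr0.
      rewrite (reindex_inj rev_ord_inj) /=.
      have ij : i0 != j0 by apply: contraTneq ji => ->; rewrite ltnn.
      rewrite (bigD1 i0) //= (bigD1 j0) 1?eq_sym //= big1 ?addr0; last first.
        move=> i /andP[/negPf ii /negPf ij']; by rewrite /alpha rev_ordK ii ij' subrr !mulr0.
      rewrite /alpha !rev_ordK !eqxx (negPf ij) eq_sym (negPf ij).
      by move: (ltn_ord i0) (ltn_ord j0); lia.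
    rewrite -big_split; apply: eq_bigr => s _; rewrite -big_split.
    by apply: eq_bigr => i _; rewrite /nu rev_ordK mulrDr.
  by rewrite ltrDl; lia.
by rewrite -[u](rhoVK rho_alg _ wE) u0 linear0.
Qed.

(** Differentiate the action of the torus along one diagonal entry. *)
Lemma lowest_torus s0 (i0 : 'I_m) :
  drho rho (unit_mx C (s0, i0, i0)) v0 = (lam s0 (rev_ord i0))%:~R *: v0.
Proof.
apply: vsep => l.
have h1 := @drhoP _ _ _ _ _ _ _ rho_alg (unit_mx C (s0, i0, i0)) v0 l _ (mcurve_line _).
have g1 : germ (fun t => (1 + t : E) ^ lam s0 (rev_ord i0)) 1 ((lam s0 (rev_ord i0))%:~R * 1).
  by apply: germXz1; have := germD (germ_cst (1 : E)) (@germ_id E); rewrite addr0 add0r.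
have h2 := germM g1 (germ_cst (l v0 : E)).
rewrite mul1r mulr0 add0r mulr1 in h2.
rewrite lfunZ_E.
suff gen : generic (fun t => (1 + t) ^ lam s0 (rev_ord i0) * l v0 =
    l (rho (fun s => 1%:M + t *: unit_mx C (s0, i0, i0) s) v0)).
  by have [] := germ_uniq (charE C) h1 (germ_eq gen h2).
exists (1 + 'X); first by rewrite !coefE addr0 oner_neq0.
move=> t; rewrite !hornerE => t0.
pose d s : 'rV[E]_m := \row_i (if (s == s0) && (i == i0) then 1 + t else 1).
have d0 s i : d s 0 i != 0 by rewrite mxE; case: ifP => // _; exact: oner_neq0.
have -> : (fun s => 1%:M + t *: unit_mx C (s0, i0, i0) s) = (fun s => diag_mx (d s)) :> G.
  apply/funext => s; apply/matrixP => i j; rewrite /unit_mx /= !mxE.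
  have [ss|ss] := eqVneq s s0; rewrite !mxE /=; last by rewrite mulr0 addr0.
  have [->|ii] := eqVneq i i0; last by rewrite mulr0 addr0.
  by rewrite [j == i0]eq_sym; case: eqP => _; rewrite ?mulr1 ?mulr0 ?addr0.
rewrite v0t // lfunZ_E; congr (_ * _).
rewrite (bigD1 s0) //= [X in _ = _ * X]big1 ?mulr1; last first.
  by move=> s /negPf ss; rewrite big1 // => i _; rewrite mxE ss exp1rz.
rewrite (bigD1 i0) //= [X in _ = _ * X]big1 ?mulr1; last first.
  by move=> i /negPf ss; rewrite mxE ss andbF exp1rz.
by rewrite mxE !eqxx.
Qed.

End Weights.

(** * The two evaluations agree modulo powers of p *)

Section DetGerm.
Context (E : fieldType).

Lemma germ_det m (M : E -> 'M[E]_m) (B : 'M[E]_m) :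
  (forall i j, germ (fun t => M t i j) (i == j)%:R (B i j)) ->
  germ (fun t => \det (M t)) 1 (\tr B).
Proof.
elim: m M B => [|m IH].
  move=> M B _; rewrite /mxtrace big_ord0; apply: germ_ext (germ_cst 1) => t.
  by rewrite det_mx00.
rewrite -[m.+1]/(1 + m)%N => M B gM; pose l0 : 'I_(1 + m) := lshift m (0 : 'I_1).
pose a t := M t l0 l0.
pose Sc t : 'M[E]_m := drsubmx (M t) - (a t)^-1 *: (dlsubmx (M t) *m ursubmx (M t)).
have ga : germ a 1 (B l0 l0) by have := gM l0 l0; rewrite eqxx.
have gS i j : germ (fun t => Sc t i j) (i == j)%:R (drsubmx B i j).
  have h := germD (gM (rshift 1 i) (rshift 1 j)) (germZ (-1) (germM
    (germV (oner_neq0 E) ga) (germM (gM (rshift 1 i) l0) (gM l0 (rshift 1 j))))).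
  move: h; rewrite (inj_eq (@rshift_inj _ _)) eq_rlshift eq_lrshift.
  rewrite !(mul0r, mulr0, addr0) !mxE; apply: germ_ext => t; rewrite !mxE big_ord1 !mxE /a.
  rewrite mulN1r; congr (_ - _ * (_ * _)); congr (M t _ _); exact/val_inj.
have -> : \tr B = B l0 l0 + \tr (drsubmx B).
  rewrite /mxtrace big_split_ord /= big_ord1; congr (_ + _).
  by apply: eq_bigr => i _; rewrite !mxE.
have := germM ga (IH Sc _ gS); rewrite !mul1r mulr1 addrC; apply: germ_eq; apply: generic_sub (germ_neq0 (oner_neq0 E) ga) => t a0.
have -> : M t = block_mx 1%:M 0 ((a t)^-1 *: dlsubmx (M t)) 1%:M *m
    block_mx (a t)%:M (ursubmx (M t)) 0 (Sc t).
  rewrite mulmx_block !(mul0mx, mulmx0, mul1mx, mulmx1, addr0, add0r).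
  rewrite mul_mx_scalar scalerA divff // scale1r -scalemxAl /Sc addrC subrK.
  rewrite -[LHS](@submxK _ 1 m 1 m); congr (block_mx _ _ _ _).
  apply/matrixP => i j; rewrite !mxE (ord1 i) (ord1 j) eqxx mulr1n /a.
  by congr (M t _ _); exact/val_inj.
by rewrite det_mulmx det_lblock det_ublock !det1 !mul1r det_scalar expr1.
Qed.

End DetGerm.

Section KappaCongruence.
Context (R : realType) (p n : nat) (N : field_data R) (C : coef_data p N).
Context (D : datum n C) (hD : standing D).
Local Notation S := (Sinf N).
Local Notation E := (EF C).
Local Notation V := (repV D).
Local Notation G := (Gmx C (n + n)).
Local Notation v0 := (lowv D).
Local Notation w := (antidiag n E).
Let rho_alg := st_algebraic hD.

Lemma antidiagK (K : pzRingType) : antidiag n K *m antidiag n K = 1%:M.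
Proof.
apply/matrixP => i j; rewrite !mxE (bigD1 (rev_ord i)) //= !mxE rev_ordK eqxx mul1r.
rewrite big1 ?addr0 => [|k ki]; first by rewrite (inj_eq rev_ord_inj).
by rewrite !mxE -(inj_eq rev_ord_inj) rev_ordK eq_sym (negPf ki) mul0r.
Qed.

Lemma lowest_vector_torus : torus_acts (rho D) (fun s i => wt D s (rev_ord i)) v0.
Proof.
have [_ h] := st_lowest hD; move=> t t0; rewrite h //; congr (_ *: _).
by apply: eq_bigr => s _; apply: eq_bigr => i _; rewrite /dual_weight opprK.
Qed.

(** Off-diagonal entries kill the lowest weight vector and diagonal entries
    act by its weight. *)
Lemma drho_lower (Z : G) : (forall s (i j : 'I_(n + n)), (i < j)%N -> Z s i j = 0) ->
  drho (rho D) Z v0 = (\sum_s \sum_i (wt D s (rev_ord i))%:~R * Z s i i) *: v0.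
Proof.
move=> hZ; have [vp [vp0 vpt vpN]] := st_weight hD.
rewrite {1}[Z]Gmx_expand (drho_sumX rho_alg).
rewrite (eq_bigr (fun q => if q.1.2 == q.2 then
    ((wt D q.1.1 (rev_ord q.1.2))%:~R * Z q.1.1 q.1.2 q.2) *: v0 else 0)); last first.
  move=> [[s i] j] _ /=; rewrite (drhoZX rho_alg).
  have [<-|ij] := eqVneq i j.
    rewrite (lowest_torus rho_alg lowest_vector_torus).
    by rewrite scalerA mulrC.
  have [lt|gt|/val_inj/eqP] := ltngtP i j; last by rewrite (negPf ij).
    by rewrite hZ ?scale0r.
  by rewrite (lowest_killed rho_alg (st_irreducible hD) vp0 vpt vpN lowest_vector_torus) ?scaler0.
rewrite -(pair_bigA _ (fun sr c => if sr.2 == c then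
  ((wt D sr.1 (rev_ord sr.2))%:~R * Z sr.1 sr.2 c) *: v0 else 0)) /=.
rewrite -(pair_bigA _ (fun s r => \sum_c if r == c then
  ((wt D s (rev_ord r))%:~R * Z s r c) *: v0 else 0)) /=.
rewrite scaler_suml; apply: eq_bigr => s _; rewrite scaler_suml; apply: eq_bigr => i _.
by rewrite (bigD1 i) //= eqxx big1 ?addr0 // => c; rewrite eq_sym => /negPf ->.
Qed.

(** The Lie algebra of the matrices whose upper right block vanishes
    modulo p^k; its brackets stay in it. *)
Definition parab k (X : G) : Prop :=
  (forall s i j, OE (X s i j)) /\
  forall s i j, padic_small k (ursubmx (X s) i j).

Lemma parab_mul k (X Y : G) : parab k X -> parab k Y -> parab k (fun s => X s *m Y s).
Proof.
move=> [XO Xk] [YO Yk]; split=> s i j.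
  by rewrite mxE; apply: OE_sum => l _; exact: OEM.
rewrite !mxE big_split_ord /=; apply: padicD; apply: padic_sum => l _.
  by apply: padicMl => //; have := Yk s l j; rewrite !mxE.
by apply: padicMr => //; have := Xk s i l; rewrite !mxE.
Qed.

Lemma parabB k (X Y : G) : parab k X -> parab k Y -> parab k (fun s => X s - Y s).
Proof.
move=> [XO Xk] [YO Yk]; split=> s i j; rewrite !mxE; first exact: OEB.
by apply: padicD; [|apply: padicN]; [have := Xk s i j | have := Yk s i j]; rewrite !mxE.
Qed.

(** Filtered by the number of factors, on which the comparison of the two
    functionals proceeds by induction. *)
Inductive wspan k : nat -> V -> Prop :=
| wspan_gen r : wspan k r v0
| wspan_add r u v : wspan k r u -> wspan k r v -> wspan k r (u + v)
| wspan_scale r a v : OE a -> wspan k r v -> wspan k r (a *: v)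
| wspan_step r X v : parab k X -> wspan k r v -> wspan k r.+1 (drho (rho D) X v).

Lemma wspan_le k r r' v : (r <= r')%N -> wspan k r v -> wspan k r' v.
Proof.
move=> h ws; elim: ws r' h => {r v} [r r' _|r u v _ IH1 _ IH2 r' h|r a v aO _ IH r' h|r X v hX _ IH [//|r'] h].
- exact: wspan_gen.
- by apply: wspan_add; [exact: IH1 | exact: IH2].
- by apply: wspan_scale => //; exact: IH.
- by apply: wspan_step => //; exact: IH.
Qed.

(** Lower triangular matrices can be commuted through to the lowest weight
    vector, which they rescale; no new factor appears on the way. *)
Lemma wspan_lower k r (Z : G) v :
  (forall s (i j : 'I_(n + n)), (i < j)%N -> Z s i j = 0) ->
  (forall s i j, OE (Z s i j)) -> wspan k r v -> wspan k r (drho (rho D) Z v).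
Proof.
move=> hZ ZO.
have Zp : parab k Z.
  split=> // s i j; rewrite !mxE hZ; first exact: padic_zero.
  by rewrite /= ltn_addr.
elim=> {r v} [r|r u v _ IH1 _ IH2|r a v aO _ IH|r X v hX wv IH].
- rewrite drho_lower //; apply: wspan_scale (wspan_gen _ _).
  by apply: OE_sum => s _; apply: OE_sum => i _; apply: OEM => //; exact: OE_int.
- by rewrite (drhoDv rho_alg); exact: wspan_add.
- by rewrite (drhoZv rho_alg); exact: wspan_scale.
- rewrite (drho_bracket rho_alg); apply: wspan_add; first exact: wspan_step.
  by apply: wspan_step => //; apply: parabB; exact: parab_mul.
Qed.

Definition xiE : G := fun=> block_mx 1%:M w 0 w.
Definition xiVE : G := fun=> block_mx 1%:M (- 1%:M) 0 w.

Lemma map_antidiag (K K' : fieldType) (f : {rmorphism K -> K'}) :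
  map_mx f (antidiag n K) = antidiag n K'.
Proof. by apply/matrixP => i j; rewrite !mxE rmorph_nat. Qed.

Lemma actp_xi v : actp (@xi R p n N) v = rho D xiE v.
Proof.
rewrite /actp; congr (rho D _ v); apply/funext => s; rewrite /xi plc_overp.
by rewrite map_block_mx map_mx1 map_mx0 map_antidiag.
Qed.

Lemma xiEK s : xiE s *m xiVE s = 1%:M.
Proof.
rewrite mulmx_block !(mul0mx, mulmx0, mul1mx, mulmx1, addr0, add0r) antidiagK.
by rewrite addNr -scalar_mx_block.
Qed.

Lemma GE_xi : GE xiE.
Proof. by move=> s; have [] := mulmx1_unit (xiEK s). Qed.

Lemma xi_inv s : invmx (xiE s) = xiVE s.
Proof.
have u := GE_xi s; apply: (can_inj (mulKmx u)); by rewrite mulmxV // xiEK.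
Qed.

Definition diagH (Y1 Y2 : S -> 'M[E]_n) : G := fun s => block_mx (Y1 s) 0 0 (Y2 s).

Section OneKappa.
Context (j : int) (kappa : 'Hom(V, E^o)) (hk : kappa_form j kappa).

Definition trace_form (Y1 Y2 : S -> 'M[E]_n) : E :=
  \sum_s (j%:~R * \tr (Y1 s) + (purity D - j)%:~R * \tr (Y2 s)).

(** The differential of the character det (h1) ^ j det (h2) ^ (w - j) is the
    trace form. *)
Lemma kappa_drho (Y1 Y2 : S -> 'M[E]_n) v :
  kappa (drho (rho D) (diagH Y1 Y2) v) = trace_form Y1 Y2 * kappa v :> E.
Proof.
have h1 := @drhoP _ _ _ _ _ _ _ rho_alg (diagH Y1 Y2) v kappa _ (mcurve_line _).
pose L (Y : S -> 'M[E]_n) t s : 'M[E]_n := 1%:M + t *: Y s.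
have gdet Y s z : germ (fun t => \det (L Y t s) ^ z) 1 (z%:~R * \tr (Y s)).
  apply: germXz1; apply: germ_det => a b; have := mcurve_line Y s a b.
  by rewrite /one_g mxE.
have gchi : germ (fun t => \prod_s (\det (L Y1 t s) ^ j * \det (L Y2 t s) ^ (purity D - j)))
    1 (trace_form Y1 Y2).
  apply: germ_prod1 => s; have := germM (gdet Y1 s j) (gdet Y2 s (purity D - j)).
  by rewrite !mulr1 mul1r [X in germ _ _ X -> _]addrC.
have h2 := germM gchi (germ_cst (kappa v : E)); rewrite mul1r mulr0 add0r in h2.
suff gen : generic (fun t =>
    (\prod_s (\det (L Y1 t s) ^ j * \det (L Y2 t s) ^ (purity D - j))) * kappa v =
    kappa (rho D (fun s => 1%:M + t *: diagH Y1 Y2 s) v)).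
  by have [] := germ_uniq (charE C) h1 (germ_eq gen h2).
apply: generic_sub (genericI (curve_unit (mcurve_line Y1)) (curve_unit (mcurve_line Y2))).
move=> t [u1 u2]; have [hk1 _] := hk.
rewrite (_ : (fun s => _) = (fun s => block_mx (L Y1 t s) 0 0 (L Y2 t s))).
  by rewrite hk1.
apply/funext => s; rewrite /diagH scale_block_mx [1%:M]scalar_mx_block add_block_mx.
by rewrite !scaler0 !addr0.
Qed.

End OneKappa.

(** The decomposition of the Lie algebra as the sum of a conjugate of that of
    H and of the lower triangular Borel subalgebra. It is integral, and the
    upper right block governs the difference of the two components in H. *)
Section Decomposition.
Context (X : G).

Definition low (T : 'M[E]_n) : 'M[E]_n := \matrix_(i, j) if (j <= i)%N then T i j else 0.
Let A s := ulsubmx (X s).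
Let B s := ursubmx (X s).
Let D' s := drsubmx (X s).
Let T s : 'M[E]_n := B s *m w + w *m D' s *m w - A s.
Definition Ypart1 s : 'M[E]_n := A s + low (T s).
Definition Ypart2 s : 'M[E]_n := w *m D' s *m w - (T s - low (T s)).
Definition Zpart : G := fun s =>
  block_mx (- low (T s)) 0 (dlsubmx (X s)) (w *m (T s - low (T s)) *m w).

Lemma Ypart_sub s : Ypart1 s - Ypart2 s = B s *m w.
Proof.
rewrite /Ypart1 /Ypart2 /T; set u := low _; set b := B s *m w; set d := w *m D' s *m w.
by rewrite !opprD !opprK; apply/matrixP => i j; rewrite !mxE; ring.
Qed.

Lemma decomposition :
  X = fun s => xiVE s *m diagH Ypart1 Ypart2 s *m xiE s + Zpart s.
Proof.
apply/funext => s; rewrite /diagH !mulmx_block.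
rewrite !(mul0mx, mulmx0, mul1mx, mulmx1, addr0, add0r, mulNmx) add_block_mx.
rewrite -mulmxBl Ypart_sub -(mulmxA (B s)) antidiagK mulmx1 add0r addr0.
rewrite -{1}[X s]submxK; congr (block_mx _ _ _ _); first by rewrite /Ypart1 addrK.
rewrite -mulmxDl -mulmxDr /Ypart2 subrK !mulmxA antidiagK mul1mx.
by rewrite -mulmxA antidiagK mulmx1.
Qed.

Lemma conj_antidiag (M : 'M[E]_n) i j : (w *m M *m w) i j = M (rev_ord i) (rev_ord j).
Proof.
rewrite mxE (bigD1 (rev_ord j)) //= [X in _ + X = _]big1 => [|k kj].
  rewrite [w _ _]mxE eqxx mulr1 addr0 mxE (bigD1 (rev_ord i)) //= big1 => [|k ki].
    by rewrite [w _ _]mxE rev_ordK eqxx mul1r addr0.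
  by rewrite [w _ _]mxE -(inj_eq rev_ord_inj) rev_ordK eq_sym (negPf ki) mul0r.
by rewrite [w _ _]mxE (negPf kj) mulr0.
Qed.

Lemma Zpart_lower s (i j : 'I_(n + n)) : (i < j)%N -> Zpart s i j = 0.
Proof.
case: (split_ordP i) => i' ->; case: (split_ordP j) => j' -> /= ij.
- by rewrite block_mxEul !mxE leqNgt ij oppr0.
- by rewrite block_mxEur mxE.
- by move: ij (ltn_ord j'); lia.
- rewrite block_mxEdr conj_antidiag !mxE /= ifT ?subrr //.
  by move: ij (ltn_ord j'); lia.
Qed.

Hypothesis XO : forall s i j, OE (X s i j).

Let wO (M : 'M[E]_n) : (forall i j, OE (M i j)) -> forall i j, OE ((M *m w) i j).
Proof.
move=> MO i j; rewrite mxE; apply: OE_sum => k _; apply: OEM => //.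
by rewrite mxE; case: eqP => _; [exact: OE1 | exact: OE0].
Qed.

Let mxDO (M M' : 'M[E]_n) i j : OE (M i j) -> OE (M' i j) -> OE ((M + M') i j).
Proof. by move=> *; rewrite mxE; exact: OED. Qed.

Let mxBO (M M' : 'M[E]_n) i j : OE (M i j) -> OE (M' i j) -> OE ((M - M') i j).
Proof. by move=> *; apply: mxDO => //; rewrite mxE; exact: OEN. Qed.

Let AO s i j : OE (A s i j). Proof. by rewrite !mxE. Qed.
Let BO s i j : OE (B s i j). Proof. by rewrite !mxE. Qed.
Let DO s i j : OE (D' s i j). Proof. by rewrite !mxE. Qed.

Let TO s i j : OE (T s i j).
Proof.
apply: mxBO; last exact: AO.
by apply: mxDO; [exact: wO | rewrite conj_antidiag; exact: DO].
Qed.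

Let lowO s i j : OE (low (T s) i j).
Proof. by rewrite mxE; case: ifP => // _; exact: OE0. Qed.

Lemma Ypart1_int s i j : OE (Ypart1 s i j).
Proof. exact: mxDO. Qed.

Lemma Ypart2_int s i j : OE (Ypart2 s i j).
Proof.
by apply: mxBO; [rewrite conj_antidiag; exact: DO | exact: mxBO].
Qed.

Lemma Zpart_int s i j : OE (Zpart s i j).
Proof.
case: (split_ordP i) => i' ->; case: (split_ordP j) => j' ->.
- by rewrite block_mxEul mxE; exact: OEN.
- by rewrite block_mxEur mxE; exact: OE0.
- by rewrite block_mxEdl !mxE.
- by rewrite block_mxEdr conj_antidiag; exact: mxBO.
Qed.

End Decomposition.

Section TwoKappas.
Context (j : int) (kappa kappa' : 'Hom(V, E^o)).
Hypotheses (hk : kappa_form j kappa) (hk' : kappa_form (j + 1) kappa').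

Definition congruent k v : Prop :=
  [/\ OE (kappa (rho D xiE v) : E), OE (kappa' (rho D xiE v) : E) &
      padic_small k (kappa (rho D xiE v) - kappa' (rho D xiE v) : E)].

(** xi carries the conjugated part of X into the Lie algebra of H, on which
    kappa is equivariant. *)
Lemma kappa_split i (ka : 'Hom(V, E^o)) (hi : kappa_form i ka) (X : G) v :
  ka (rho D xiE (drho (rho D) X v)) =
  trace_form i (Ypart1 X) (Ypart2 X) * ka (rho D xiE v)
  + ka (rho D xiE (drho (rho D) (Zpart X) v)) :> E.
Proof.
rewrite {1}[X]decomposition (drhoDX rho_alg) !linearD /=; congr (_ + _).
rewrite -(kappa_drho hi) (drho_Ad rho_alg) //; last exact: GE_xi.
congr (ka (drho _ _ _)); apply/funext => s; rewrite xi_inv !mulmxA xiEK mul1mx.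
by rewrite -mulmxA xiEK mulmx1.
Qed.

Lemma trace_int (M : S -> 'M[E]_n) s : (forall s i j, OE (M s i j)) -> OE (\tr (M s)).
Proof. by move=> MO; apply: OE_sum. Qed.

Lemma congruent_gen k : congruent k v0.
Proof.
have [_ h] := hk; have [_ h'] := hk'; rewrite /congruent -!actp_xi h h' subrr.
by split; [exact: OE1 | exact: OE1 | exact: padic_zero].
Qed.

Lemma congruent_add k u v : congruent k u -> congruent k v -> congruent k (u + v).
Proof.
move=> [a1 a2 a3] [b1 b2 b3]; rewrite /congruent !linearD /=.
split; [exact: OED | exact: OED | rewrite addrACA; exact: padicD].
Qed.

Lemma congruent_scale k a v : OE a -> congruent k v -> congruent k (a *: v).
Proof.
move=> aO [a1 a2 a3]; rewrite /congruent linearZ !lfunZ_E.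
split; [exact: OEM | exact: OEM | rewrite -mulrBr; exact: padicMl].
Qed.

(** The part of X in H comes out of kappa as its trace form. From j to j + 1
    this form changes by the trace of the difference of the two
    components, that is of B w, where B is the upper right block; hence by
    a multiple of p^k. The other part is lower triangular and keeps the
    vector in the span of products of r factors, to which the induction
    hypothesis applies. *)
Lemma congruent_step k r X v : (forall u, wspan k r u -> congruent k u) ->
  parab k X -> wspan k r v -> congruent k (drho (rho D) X v).
Proof.
move=> IH [XO Xk] wv.
have [a1 a2 a3] := IH _ wv.
have [b1 b2 b3] := IH _ (wspan_lower (@Zpart_lower X) (Zpart_int XO) wv).
rewrite /congruent (kappa_split hk) (kappa_split hk').
have Y1O := Ypart1_int XO; have Y2O := Ypart2_int XO.
have tO i : OE (trace_form i (Ypart1 X) (Ypart2 X)).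
  by apply: OE_sum => s _; apply: OED; apply: OEM;
    [exact: OE_int | exact: trace_int | exact: OE_int | exact: trace_int].
have td : padic_small k (trace_form j (Ypart1 X) (Ypart2 X)
    - trace_form (j + 1) (Ypart1 X) (Ypart2 X)).
  rewrite -sumrB; apply: padic_sum => s _.
  rewrite (_ : _ - _ = - \tr (Ypart1 X s - Ypart2 X s)).
    rewrite Ypart_sub; apply: padicN; apply: padic_sum => i _; rewrite mxE.
    apply: padic_sum => l _; apply: padicMr => //.
    by rewrite mxE; case: eqP => _; [exact: OE1 | exact: OE0].
  rewrite (_ : purity D - (j + 1) = purity D - j - 1); last by ring.
  move: (Ypart1 X s) (Ypart2 X s) (purity D - j) => U W z.
  have -> : \tr (U - W) = \tr U - \tr W by exact: raddfB.
  rewrite [(z - 1)%:~R]intrB [(j + 1)%:~R]intrD.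
  by move: (\tr U) (\tr W) (z%:~R : E) (j%:~R : E) => a b c d; ring.
split; [by apply: OED => //; apply: OEM | by apply: OED => //; apply: OEM |].
set t := trace_form j _ _ in td tO *; set t' := trace_form (j + 1) _ _ in td *.
set x := kappa _ in a1 a3 *; set x' := kappa' _ in a2 a3 *.
set y := kappa _ in b1 b3 *; set y' := kappa' _ in b2 b3 *.
rewrite (_ : _ - _ = (t - t') * x + t' * (x - x') + (y - y')); last by ring.
apply: padicD => //; apply: padicD; first exact: padicMr.
by apply: padicMl => //; exact: tO.
Qed.

Lemma congruentP k r v : wspan k r v -> congruent k v.
Proof.
have aux r' u : wspan k r' u -> (forall r0 u, r' = r0.+1 -> wspan k r0 u -> congruent k u) ->
    congruent k u.
  elim=> [r0 _|r0 u1 v1 _ IH1 _ IH2 h|r0 a v1 aO _ IH h|r0 X v1 hX wv _ h].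
  - exact: congruent_gen.
  - by apply: congruent_add; [exact: IH1 | exact: IH2].
  - by apply: congruent_scale => //; exact: IH.
  - by apply: congruent_step hX wv => u2; exact: h.
elim: r v => [|r IH] v ws; apply: (aux _ _ ws) => // r0 u [<-]; exact: IH.
Qed.

Lemma OF_emb s x : OF x -> OE (emb C s x).
Proof.
move=> [P Pm Px]; exists (map_poly (intr : int -> E) P); split.
- exact: monic_map.
- have := rmorph_root (emb C s) Px; rewrite -map_poly_comp.
  by rewrite (@eq_map_poly _ _ _ (intr : int -> E)) // => z /=; rewrite rmorph_int.
- move=> i; exists (P`_i)%:~R; first exact: ordge_int.
  by rewrite coef_map /= -[RHS]/(in_alg E _) rmorph_int.
Qed.

Lemma OFOE_int (f : S -> E) : OFOE f -> forall s, OE (f s).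
Proof.
elim=> [x a xO aO s|f1 f2 _ IH1 _ IH2 s]; last exact: OED.
by apply: OEM => //; exact: OF_emb.
Qed.

Section Deep.
Context (beta : place N -> nat) (k : nat).
Hypothesis deep : forall v : place N, overp p v -> v p%:R *+ k <= (beta v)%:Z.

Let x s := ext C s (unif D (plc C s) ^+ beta (plc C s)).
Let tE : G := fun s => block_mx (x s)%:M 0 0 1%:M.

Let unif0 s : unif D (plc C s) != 0.
Proof. by have [] := st_unif hD (plc_overp C s). Qed.

Let x_neq0 s : x s != 0.
Proof. by rewrite /x fmorph_eq0 expf_neq0 ?unif0. Qed.

Let x_small s : padic_small k (x s).
Proof.
apply: ext_small; rewrite ordgeE ?expf_neq0 ?unif0 // ordX ?unif0 //.
have [_ ->] := st_unif hD (plc_overp C s).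
by rewrite (le_trans (deep (plc_overp C s))) // natz.
Qed.

Let trow s : 'rV[E]_(n + n) := row_mx (const_mx (x s)) (const_mx 1).

Let tE_diag s : tE s = diag_mx (trow s).
Proof. by rewrite diag_mx_row !diag_const_mx. Qed.

Let trow_neq0 s i : trow s 0 i != 0.
Proof.
by case: (split_ordP i) => i' ->; rewrite ?row_mxEl ?row_mxEr mxE ?x_neq0 ?oner_neq0.
Qed.

Let tE_unit : GE tE.
Proof.
move=> s; rewrite tE_diag unitmxE unitfE det_diag; apply/prodf_neq0 => i _.
exact: trow_neq0.
Qed.

Let actp_t v : actp (tp D beta) v = rho D tE v.
Proof.
rewrite /actp; congr (rho D _ v); apply/funext => s; rewrite /tp plc_overp.
by rewrite map_block_mx map_scalar_mx !map_mx0 map_mx1.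
Qed.

Lemma bullet_lowest : bullet_t beta v0 = v0.
Proof.
rewrite /bullet_t actp_t (_ : tE = fun s => diag_mx (trow s)).
  have [_ h] := st_lowest hD; rewrite h // scalerA.
  rewrite -[RHS]scale1r; congr (_ *: _); rewrite /mucheck -big_split big1 // => s _ /=.
  rewrite big_split_ord /= [X in _ * (_ * X)]big1 ?mulr1; last first.
    by move=> i _; rewrite row_mxEr mxE exp1rz.
  have big_exp (I : finType) (F : I -> int) : x s ^ (\sum_i F i) = \prod_i x s ^ F i.
    elim: (index_enum I) => [|i r IH]; first by rewrite !big_nil expr0z.
    by rewrite !big_cons expfzDr // IH.
  rewrite (eq_bigr (fun i => x s ^ (- dual_weight (wt D) s (lshift n i)))); last first.
    by move=> i _; rewrite row_mxEl mxE.
  rewrite -big_exp.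
  have -> : \sum_(i < n) - dual_weight (wt D) s (lshift n i)
      = - \sum_(i < n) dual_weight (wt D) s (lshift n i) by rewrite -sumrN.
  rewrite -exprz_exp -[_ ^ (beta _)%:Z]/(_ ^+ _) -rmorphXn -/(x s).
  by rewrite -expfzDr // subrr expr0z.
by apply/funext => s; rewrite tE_diag.
Qed.

(** Conjugation by t_p^beta multiplies the upper right blocks by powers of the
    uniformisers, which at this depth are divisible by p^k: it turns the
    nilpotent generators of the lattice into elements of parab. *)
Lemma lattice_wspan (v : V) : VO v -> exists r, wspan k r (bullet_t beta v).
Proof.
elim=> {v} [|u v _ [r hr] _ [r' hr']|a v aO _ [r hr]|X v u hX _ [r hr] hu].
- by exists 0%N; rewrite bullet_lowest; exact: wspan_gen.
- exists (maxn r r'); rewrite /bullet_t actp_t linearD /= scalerDr -!actp_t.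
  apply: wspan_add; [apply: wspan_le hr | apply: wspan_le hr'].
    exact: leq_maxl.
  exact: leq_maxr.
- exists r; rewrite /bullet_t actp_t linearZ /= scalerA mulrC -scalerA -actp_t.
  exact: wspan_scale.
- exists r.+1; rewrite -(lie_acts_drho rho_alg hu) /bullet_t actp_t.
  rewrite (drho_Ad rho_alg) // -(drhoZv rho_alg) -actp_t.
  apply: wspan_step hr.
  have XO s i j' : OE (X s i j') by have [h _] := hX i j'; exact: OFOE_int h s.
  have tXt s : tE s *m X s *m invmx (tE s) =
      block_mx (ulsubmx (X s)) (x s *: ursubmx (X s)) 0 (drsubmx (X s)).
    apply: (canLR (mulmxK (tE_unit s))); rewrite /tE -{1}[X s]submxK.
    have -> : dlsubmx (X s) = 0.
      apply/matrixP => a b; rewrite !mxE; have [_ ->] // := hX (rshift n a) (lshift n b).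
      by rewrite /= (leq_trans (ltnW (ltn_ord b))) // leq_addr.
    rewrite !mulmx_block !(mul0mx, mulmx0, mul1mx, mulmx1, addr0, add0r).
    by rewrite !mul_scalar_mx mul_mx_scalar.
  split=> s a b; rewrite tXt.
    case: (split_ordP a) => a' ->; case: (split_ordP b) => b' ->.
    + by rewrite block_mxEul !mxE.
    + by rewrite block_mxEur !mxE; apply: OEM => //; exact: padic_OE (x_small s).
    + by rewrite block_mxEdl mxE; exact: OE0.
    + by rewrite block_mxEdr !mxE.
  rewrite block_mxKur !mxE; exact: padicMr.
Qed.

(** Both forms take the value 1 at xi v0. By t_p^beta the lattice moves into
    the span of products of elements of parab applied to v0, where the two
    equivariance conditions differ by multiples of p^k. *)
Theorem kappa_congruence (v : V) : VO v ->
  [/\ OE (kappa (bullet_xit beta v) : E), OE (kappa' (bullet_xit beta v) : E) &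
      padic_small k (kappa (bullet_xit beta v) - kappa' (bullet_xit beta v) : E)].
Proof.
move=> /lattice_wspan[r /congruentP]; rewrite /congruent -!actp_xi.
exact.
Qed.

End Deep.
End TwoKappas.
End KappaCongruence.

(** * Ideles, classes and the cyclotomic twist *)

Section ConnectedComponents.
Context (X Y : topologicalType) (A : set X) (B : set Y).

Lemma connected_component_map (f : X -> Y) x y :
  {within A, continuous f} -> (forall z, A z -> B (f z)) ->
  connected_component A x y -> connected_component B (f x) (f y).
Proof.
move=> fc fA [K [Kx KA cK] Ky].
exists (f @` K); last by exists y.
split; first by exists x.
  by move=> _ [z Kz <-]; exact/fA/KA.
apply: connected_continuous_connected => //.
exact: continuous_subspaceW fc.
Qed.

End ConnectedComponents.

(** Left multiplications act on the space by continuous maps, so the component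
    of the unit is stable under multiplication and inversion. *)
Lemma unit_component_group (X : topologicalType) (A : set X) (e : X)
    (mul : X -> X -> X) (inv : X -> X) :
  (forall x, A x -> A (inv x)) -> (forall x y, A x -> A y -> A (mul x y)) ->
  (forall x, mul x e = x) -> (forall x, A x -> mul (inv x) x = e) ->
  (forall x, A x -> {within A, continuous (mul x)}) ->
  (forall x y, connected_component A e x -> connected_component A e y ->
     connected_component A e (mul x y)) /\
  (forall x, connected_component A e x -> connected_component A e (inv x)).
Proof.
move=> invA mulA mule mulVe mulc.
have cA x : connected_component A e x -> A x by exact: connected_component_sub.
split=> [x y ex ey|x ex].
  have Ax := cA _ ex; apply: connected_component_trans ex _.
  rewrite -{1}[x]mule; apply: (@connected_component_map _ _ A A) ey.
    exact: mulc.
  by move=> z; exact: mulA.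
have Ax := cA _ ex.
apply: connected_component_sym.
rewrite -{1}[inv x]mule -{2}(mulVe x) //.
apply: (@connected_component_map _ _ A A) ex.
  by apply: mulc; exact: invA.
by move=> z; apply: mulA; exact: invA.
Qed.

Lemma ptws_cvg (T : Type) (F : set_system T) (S : Type) (U : topologicalType)
    (f : T -> {ptws S -> U}) (g : {ptws S -> U}) : Filter F ->
  (forall s, f x s @[x --> F] --> g s) -> f x @[x --> F] --> g.
Proof.
move=> FF h; apply/cvg_sup => s W [? /= [[W' oW' <-]]] /= Wx /filterS; apply.
by apply: (h s); exact: open_nbhs_nbhs.
Qed.

Lemma ptws_continuous (T : topologicalType) (S : Type) (U : topologicalType)
    (f : T -> {ptws S -> U}) :
  (forall s, continuous (fun x => f x s)) -> continuous f.
Proof. by move=> h x; apply: ptws_cvg => s; exact: (h s x). Qed.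

Lemma ptws_proj_continuous (S : eqType) (U : topologicalType) s :
  continuous (fun f : {ptws S -> U} => f s).
Proof. exact: (@proj_continuous S (fun=> U) s). Qed.

Section IdeleClasses.
Context (R : realType) (N : field_data R).
Local Notation rtop := {ptws Sinf N -> R}.

Lemma real_units_group :
  let A := @real_units R N in
  (forall x y, connected_component A (fun=> 1) x -> connected_component A (fun=> 1) y ->
     connected_component A (fun=> 1) (fun s => x s * y s)) /\
  (forall x, connected_component A (fun=> 1) x ->
     connected_component A (fun=> 1) (fun s => (x s)^-1)).
Proof.
move=> A; apply: (@unit_component_group _ A (fun=> 1) (fun x y s => x s * y s)
    (fun x s => (x s)^-1)).
- by move=> x Ax s; rewrite invr_eq0; exact: Ax.
- by move=> x y Ax Ay s; rewrite mulf_neq0 ?Ax ?Ay.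
- by move=> x; apply/funext => s; rewrite mulr1.
- by move=> x Ax; apply/funext => s; rewrite mulVf //; exact: Ax.
- move=> x Ax; apply: continuous_subspaceT; apply: ptws_continuous => s y.
  apply: (@continuous_comp _ _ _ (fun f : rtop => f s) ( *%R (x s))).
    exact: ptws_proj_continuous.
  exact: mulrl_continuous.
Qed.

Lemma real_units_1 : connected_component (@real_units R N) (fun=> 1) (fun=> 1).
Proof. by apply: connected_component_refl => s; exact: oner_neq0. Qed.

Lemma congr_1 a : congr_ideles a (fun=> 1 : Fv N _).
Proof. by move=> v; rewrite oner_neq0 ord_1 subrr; split=> //; exact: ordge0. Qed.

Lemma congr_mul a u u' : congr_ideles a u -> congr_ideles a u' ->
  congr_ideles a (fun v => u v * u' v : Fv N v).
Proof.
move=> hu hu' v; have [u0 uo ua] := hu v; have [u'0 u'o u'a] := hu' v.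
split; [by rewrite mulf_neq0 | by rewrite ordM // uo u'o|].
rewrite (_ : _ - 1 = u v * (u' v - 1) + (u v - 1)); last first.
  by rewrite mulrBr mulr1 addrA subrK.
apply: ordgeD => //; rewrite -[(a v)%:Z]add0r; apply: ordgeM => //.
by rewrite ordgeE ?uo.
Qed.

Lemma congr_inv a u : congr_ideles a u -> congr_ideles a (fun v => (u v)^-1 : Fv N v).
Proof.
move=> hu v; have [u0 uo ua] := hu v.
split; [by rewrite invr_eq0 | by rewrite ordV // uo oppr0|].
rewrite (_ : _ - 1 = - ((u v)^-1 * (u v - 1))); last first.
  by rewrite mulrBr mulVf // mulr1 opprB.
rewrite ordgeN -[(a v)%:Z]add0r; apply: ordgeM => //.
by rewrite ordgeE ?invr_eq0 // ordV // uo oppr0.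
Qed.

Lemma congr_le (a b : place N -> nat) : (forall v, (a v <= b v)%N) ->
  @congr_ideles _ N b `<=` congr_ideles a.
Proof.
move=> ab u hu v; have [u0 uo ub] := hu v; split=> //.
by apply: ordge_le ub; rewrite lez_nat.
Qed.

Lemma idele_eq (x y : idele N) : (forall v, x.1 v = y.1 v) -> (forall s, x.2 s = y.2 s) ->
  x = y.
Proof.
by case: x y => [x1 x2] [y1 y2] /= h1 h2; congr (_, _);
  [apply: functional_extensionality_dep | apply/funext].
Qed.

Lemma class_refl a (y : idele N) : class_of a y y.
Proof.
exists 1, (fun=> 1), (fun=> 1); split; [exact: oner_neq0|exact: congr_1|exact: real_units_1|].
by apply: idele_eq => i /=; rewrite rmorph1 mul1r mulr1.
Qed.

Lemma class_sym a (y z : idele N) : class_of a y z -> class_of a z y.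
Proof.
move=> [g [u [r [g0 hu hr ->]]]].
exists g^-1, (fun v => (u v)^-1), (fun s => (r s)^-1); split.
- by rewrite invr_eq0.
- exact: congr_inv.
- by have [_ h] := real_units_group; exact: h.
apply: idele_eq => i /=; rewrite fmorphV.
  have [u0 _ _] := hu i; rewrite mulrA mulrA mulVf ?mul1r ?mulfK //.
  by rewrite fmorph_eq0.
have r0 : r i != 0 by have := connected_component_sub hr; apply.
by rewrite mulrA mulrA mulVf ?mul1r ?mulfK // fmorph_eq0.
Qed.

Lemma class_trans a (x y z : idele N) : class_of a x y -> class_of a y z -> class_of a x z.
Proof.
move=> [g [u [r [g0 hu hr ->]]]] [g' [u' [r' [g'0 hu' hr' ->]]]].
exists (g' * g), (fun v => u v * u' v), (fun s => r s * r' s); split.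
- by rewrite mulf_neq0.
- exact: congr_mul.
- by have [h _] := real_units_group; exact: h.
by apply: idele_eq => i /=; rewrite rmorphM !mulrA.
Qed.

Lemma class_eq a (y z : idele N) : class_of a y z -> class_of a z = class_of a y.
Proof.
move=> yz; apply/seteqP; split=> x; first exact: class_trans.
by apply: class_trans; exact: class_sym.
Qed.

Lemma class_le (a b : place N -> nat) (y : idele N) : (forall v, (a v <= b v)%N) ->
  class_of b y `<=` class_of a y.
Proof.
move=> ab z [g [u [r [g0 hu hr e]]]]; exists g, u, r; split=> //.
exact: congr_le hu.
Qed.

Lemma Clp_ex (a : place N -> nat) (c : Clp a) :
  exists y : idele N, is_idele y /\ sval c = class_of a y.
Proof. by case: c => c [y hy e]; exists y. Qed.

Lemma Clp_eq (a : place N -> nat) (c d : Clp a) : sval c = sval d -> c = d.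
Proof.
by case: c d => [c hc] [d hd] /= e; case: _ / e hd => hd; congr exist; exact: Prop_irrelevance.
Qed.

Lemma mem_class (a : place N -> nat) (c : Clp a) y (hy : is_idele y) : sval c y -> c = proj_class a hy.
Proof.
have [z [hz e]] := Clp_ex c; rewrite e => zy; apply: Clp_eq.
by rewrite e -(class_eq zy).
Qed.

Lemma proj_class_eq (a : place N -> nat) y z (hy : is_idele y) (hz : is_idele z) :
  class_of a y z -> proj_class a hy = proj_class a hz.
Proof. by move=> yz; apply: mem_class. Qed.

Lemma above_proj (a b : place N -> nat) (ab : forall v, (a v <= b v)%N) y (hy : is_idele y)
    (c : Clp a) : above_class b c (proj_class b hy) <-> c = proj_class a hy.
Proof.
split=> [h|->]; last by move=> z; exact: class_le.
by apply: mem_class; apply: h; exact: class_refl.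
Qed.

End IdeleClasses.

Section EpsilonTwist.
Context (R : realType) (p : nat) (N : field_data R) (C : coef_data p N).
Local Notation pm hy := (@point_mass R p N C _ hy : class_family C).
Context (T T' : class_family C -> class_family C) (hT : is_eps_cyc T T').
Local Notation E := (EF C).

Lemma level_of_subproof (f : place N -> nat) v :
  (0 < (if overp p v then (f v).+1 else 0))%N = overp p v.
Proof. by case: ifP. Qed.

Definition level_of (f : place N -> nat) : level p N :=
  exist _ (fun v => if overp p v then (f v).+1 else 0%N) (level_of_subproof f).

Lemma level_ofP f (b : level p N) : (forall v, overp p v -> (sval b v <= f v)%N) ->
  level_le b (level_of f).
Proof.
move=> h v /=; case: ifP => [pv|/negbT pv]; first by rewrite ltnW // ltnS h.
by rewrite leqNgt (proj2_sig b v).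
Qed.

Lemma class_family_eq (M M' : class_family C) :
  (forall b c, M b c = M' b c) -> M = M'.
Proof.
by move=> h; apply: functional_extensionality_dep => b; apply/funext => c.
Qed.

Lemma point_mass_iwasawa y (hy : is_idele y) : iwasawa (pm hy).
Proof.
split=> [b c|b b' c bb'].
  by rewrite /point_mass; case: eqP => _; [exact: OE1 | exact: OE0].
rewrite /point_mass; have [->|cn] := eqVneq c (proj_class (sval b) hy); last first.
  rewrite fsbig1 // => d; case: eqP => // -> /above_proj h.
  by rewrite h ?eqxx // in cn.
rewrite -(fsbig_widen [set proj_class (sval b') hy]); first by rewrite fsbig_set1 !eqxx.
  by move=> _ ->; exact/above_proj.
by move=> d [_ /eqP/negPf h] /=; rewrite h.
Qed.

Hypothesis finCl : forall b : level p N, finite_set [set: Clp (sval b)].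

Lemma finite_above (b b' : level p N) (c : Clp (sval b)) :
  finite_set (above_class (sval b') c).
Proof. exact: sub_finite_set (@finCl b'). Qed.

Lemma iwasawaD (M M' : class_family C) : iwasawa M -> iwasawa M' ->
  iwasawa (fun b c => M b c + M' b c).
Proof.
move=> [MO Ms] [M'O M's]; split=> [b c|b b' c bb']; first exact: OED.
by rewrite fsbig_split /= -?Ms -?M's //; exact: finite_above.
Qed.

Lemma iwasawaZ a (M : class_family C) : OE a -> iwasawa M ->
  iwasawa (fun b c => a * M b c).
Proof.
move=> aO [MO Ms]; split=> [b c|b b' c bb']; first exact: OEM.
rewrite (Ms _ _ _ bb'); apply: fsbig_distrr; exact: finite_above.
Qed.

Lemma T_zero : T (fun _ _ => 0) = fun _ _ => 0.
Proof.
have h0 : iwasawa (fun (b : level p N) (c : Clp (sval b)) => 0 : E).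
  split=> [b c|b b' c _]; first exact: OE0.
  by rewrite fsbig1.
have := cyc_scale hT (@OE0 _ _ _ C) h0.
rewrite (_ : (fun _ _ => 0 * 0) = fun _ _ => 0); last first.
  by apply: class_family_eq => b c; rewrite mul0r.
by move=> ->; apply: class_family_eq => b c; rewrite mul0r.
Qed.

Lemma iwasawa_zero : iwasawa (fun (b : level p N) (c : Clp (sval b)) => 0 : E).
Proof. by split=> [b c|b b' c _]; [exact: OE0 | rewrite fsbig1]. Qed.

(** The twist of a point mass is an integral measure. *)
Lemma eps_int (y : idele N) : is_idele y -> OE (eps_cyclo C y).
Proof.
move=> hy; have [h _] := cyc_stable hT (point_mass_iwasawa hy).
have := h (level_of (fun=> 0%N)) (proj_class _ hy).
by rewrite (cyc_dirac hT) /point_mass eqxx mulr1.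
Qed.

(** Otherwise the twist would kill a point mass; but it is invertible. *)
Lemma eps_neq0 (y : idele N) : is_idele y -> eps_cyclo C y != 0.
Proof.
move=> hy; apply/eqP => e0.
have Tpm : T (pm hy) = fun _ _ => 0.
  by rewrite (cyc_dirac hT) e0; apply: class_family_eq => b c; rewrite mul0r.
have := cycK hT (point_mass_iwasawa hy).
rewrite Tpm -T_zero (cycK hT iwasawa_zero).
move=> /(congr1 (fun M => M (level_of (fun=> 0%N)) (proj_class _ hy))).
by rewrite /point_mass eqxx => /eqP; rewrite eq_sym oner_eq0.
Qed.

Lemma point_mass_eq (b : level p N) y y' (hy : is_idele y) (hy' : is_idele y') :
  class_of (sval b) y y' ->
  pm hy b = pm hy' b.
Proof.
by move=> yy'; apply/funext => c; rewrite /point_mass (proj_class_eq hy hy' yy').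
Qed.

(** Ideles with the same classes at all levels have the same point mass, and
    the twist reads the character off the point mass. *)
Lemma eps_class_eq (y y' : idele N) : is_idele y -> is_idele y' ->
  (forall b : level p N, class_of (sval b) y y') -> eps_cyclo C y = eps_cyclo C y'.
Proof.
move=> hy hy' h.
have e : pm hy = pm hy'.
  by apply: functional_extensionality_dep => b; exact: point_mass_eq.
have := congr1 (fun M => @T M (level_of (fun=> 0%N)) (proj_class _ hy)) e.
rewrite !(cyc_dirac hT) -e /point_mass eqxx !mulr1; exact.
Qed.

Lemma T_sub (M M' : class_family C) : iwasawa M -> iwasawa M' ->
  T (fun b c => M b c - M' b c) = fun b c => @T M b c - @T M' b c.
Proof.
move=> hM hM'; have m1 : OE (-1 : E) by apply: OEN; exact: OE1.
have hM'' := iwasawaZ m1 hM'.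
rewrite (_ : (fun b c => M b c - M' b c) = fun b c => M b c + -1 * M' b c); last first.
  by apply: class_family_eq => b c; rewrite mulN1r.
rewrite (cyc_add hT hM hM'') (cyc_scale hT m1 hM').
by apply: class_family_eq => b c; rewrite mulN1r.
Qed.

Lemma iwasawaB (M M' : class_family C) : iwasawa M -> iwasawa M' ->
  iwasawa (fun b c => M b c - M' b c).
Proof.
move=> hM hM'; have m1 : OE (-1 : E) by apply: OEN; exact: OE1.
rewrite (_ : (fun b c => M b c - M' b c) = fun b c => M b c + -1 * M' b c).
  by apply: iwasawaD => //; exact: iwasawaZ.
by apply: class_family_eq => b c; rewrite mulN1r.
Qed.

Lemma level_of0_le (b : level p N) : level_le (level_of (fun=> 0%N)) b.
Proof. by move=> v /=; case: ifP => // pv; rewrite (proj2_sig b v) pv. Qed.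

(** By continuity of the twist, the character is locally constant modulo
    powers of p. *)
Lemma eps_congr k : exists b0 : level p N, forall b, level_le b0 b ->
  forall y y', is_idele y -> is_idele y' -> class_of (sval b) y y' ->
  padic_small k (eps_cyclo C y - eps_cyclo C y').
Proof.
pose b1 := level_of (fun=> 0%N).
have [b0 [k0 h]] := cyc_continuous hT b1 k.
exists b0 => b b0b y y' hy hy' yy'.
have Iy := @point_mass_iwasawa _ hy; have Iy' := @point_mass_iwasawa _ hy'.
have := h _ (iwasawaB Iy Iy') _ (proj_class _ hy).
have e1 := proj_class_eq hy hy' (class_le (level_of0_le b) yy').
have e0 := proj_class_eq hy hy' (class_le b0b yy').
rewrite (T_sub Iy Iy') !(cyc_dirac hT) /point_mass -e1 eqxx !mulr1; apply => c.
by rewrite -e0 subrr; exact: padic_zero.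
Qed.

Lemma T_point_sum (I : Type) (l : seq I) (a : I -> E) (y : I -> idele N)
    (hy : forall i, is_idele (y i)) : (forall i, OE (a i)) ->
  iwasawa (fun b c => \sum_(i <- l) a i * pm (hy i) b c) /\
  T (fun b c => \sum_(i <- l) a i * pm (hy i) b c) =
  fun b c => \sum_(i <- l) a i * (eps_cyclo C (y i) * pm (hy i) b c).
Proof.
move=> aO; elim: l => [|i l [IHi IHT]].
  have e0 (f : forall b : level p N, Clp (sval b) -> I -> E) :
      (fun b c => \sum_(i <- [::]) f b c i) = fun _ _ => 0.
    by apply: class_family_eq => b c; rewrite big_nil.
  by rewrite !e0 T_zero; split=> //; exact: iwasawa_zero.
have e1 (f : forall b : level p N, Clp (sval b) -> I -> E) :
    (fun b c => \sum_(i <- i :: l) f b c i) =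
    fun b c => f b c i + \sum_(i <- l) f b c i.
  by apply: class_family_eq => b c; rewrite big_cons.
have hi := iwasawaZ (aO i) (point_mass_iwasawa (hy i)).
rewrite !e1; split; first exact: iwasawaD.
rewrite (cyc_add hT hi IHi) IHT (cyc_scale hT (aO i) (point_mass_iwasawa _)).
by apply: class_family_eq => b c; rewrite (cyc_dirac hT).
Qed.

(** At level b a measure agrees with a combination of point masses at
    representatives of the classes; by continuity, so do their twists at
    level b1 modulo p^k. *)
Lemma T_approx (b1 : level p N) k : exists b0 : level p N, forall b, level_le b0 b ->
  level_le b1 b -> forall (y : Clp (sval b) -> idele N),
  (forall c, is_idele (y c)) -> (forall c, sval c (y c)) ->
  forall M, iwasawa M -> forall c1,
  padic_small k (@T M b1 c1
    - \sum_(c \in above_class (sval b) c1) M b c * eps_cyclo C (y c)).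
Proof.
have [b0 [k0 h]] := cyc_continuous hT b1 k.
exists b0 => b b0b b1b y hy yc M hM c1.
pose l := finmap.enum_fset (fset_set [set: Clp (sval b)]).
have [hM' TM'] := T_point_sum l hy (hM.1 b).
set M' := fun _ _ => _ in hM' TM'.
have yproj c : c = proj_class (sval b) (hy c) by exact: mem_class.
have Mb c : M b c - M' b c = 0.
  have -> : M' b c = \sum_(i \in [set: Clp (sval b)]) M b i * pm (hy i) b c.
    by rewrite fsbig_finite //; exact: finCl.
  rewrite (fsbigD1 c) //; last exact: finCl.
  rewrite fsbig1 /= ?addr0; first by rewrite /point_mass -yproj eqxx mulr1 subrr.
  move=> d [_ /eqP dc]; rewrite /point_mass -yproj eq_sym (negPf dc) mulr0 //.
have := h _ (iwasawaB hM hM') _ c1.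
rewrite (T_sub hM hM') TM'.
have -> : \sum_(i <- l) M b i * (eps_cyclo C (y i) * pm (hy i) b1 c1) =
    \sum_(c \in above_class (sval b) c1) M b c * eps_cyclo C (y c).
  rewrite /l -fsbig_finite; last exact: finCl.
  rewrite [RHS]fsbig_mkcond; apply: eq_fsbigr => c _.
  rewrite /patch /point_mass.
  have [|/negP cn] := boolP (c \in _).
    rewrite inE {1}(yproj c) => /above_proj ->; last exact: b1b.
    by rewrite eqxx mulr1.
  have [e|] := eqVneq c1 _; last by rewrite !mulr0.
  case: cn; rewrite inE (yproj c); exact/above_proj.
apply => c; rewrite ((iwasawaB hM hM').2 _ _ c b0b) fsbig1 //.
exact: padic_zero.
Qed.

End EpsilonTwist.

(** * Places *)

Lemma int_mulrn (a : int) m : a *+ m = a * m%:Z.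
Proof. by rewrite -mulr_natr natz. Qed.

Section DistinctValuations.
Context (k : fieldType).
Implicit Types v w : dval k.

Lemma ordXz v x (z : int) : x != 0 -> v (x ^ z) = v x * z.
Proof.
move=> x0; case: z => m; first by rewrite -exprnP ordX // -mulr_natr natz.
rewrite -[x ^ Negz m]/((x ^+ m.+1)^-1) ordV ?expf_neq0 // ordX //.
by rewrite NegzE mulrN -mulr_natr natz.
Qed.

Lemma dval_eq v w : (forall x, x != 0 -> v x = w x) -> v = w.
Proof.
move=> h; have e : Defs.ord v = Defs.ord w.
  apply/funext => x; have [->|x0] := eqVneq x 0; last exact: h.
  by rewrite !Defs.ord0.
case: v w e {h} => [f f1 f2 f3 f4] [g g1 g2 g3 g4] /= e.
by subst g; congr DVal; exact: Prop_irrelevance.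
Qed.

(** A discrete valuation ring is a maximal subring of its field, and the
    normalisation determines the valuation from its ring. *)
Lemma dval_incl v w : (forall x, x != 0 -> 0 <= v x -> 0 <= w x) -> v = w.
Proof.
move=> h; have h0 x : x != 0 -> v x = 0 -> w x = 0.
  move=> x0 vx; have := h x x0; have := h x^-1; rewrite invr_eq0 !ordV // vx.
  by move=> /(_ x0 (lexx _)) + /(_ (lexx _)); lia.
have [q q0 vq] := ord_onto v; have [y y0 wy] := ord_onto w.
have wE x : x != 0 -> w x = w q * v x.
  move=> x0; have qz : q ^ (v x) != 0 by rewrite expfz_neq0.
  have : w (x / q ^ (v x)) = 0.
    apply: h0; first by rewrite mulf_neq0 ?invr_eq0.
    by rewrite ordM ?invr_eq0 // ordV // ordXz // vq mul1r subrr.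
  by rewrite ordM ?invr_eq0 // ordV // ordXz // => /eqP; rewrite subr_eq0 => /eqP.
have wq : 0 <= w q by apply: h; rewrite ?vq.
have := wE y y0; rewrite wy => e1; apply: dval_eq => x x0.
have wq1 : w q = 1.
  by move: e1 wq; clear; move: (w q) (v y) => a b; have [|] := leP b 0; nia.
by rewrite (wE x x0) wq1 mul1r.
Qed.

(** Each of the two valuation rings has an element outside the other; take a
    quotient of two such elements. *)
Lemma separate_two v w : v != w -> exists x, [/\ x != 0, v x < 0 & 0 < w x].
Proof.
move=> vw.
have ex (v' w' : dval k) : v' != w' -> exists x, [/\ x != 0, 0 <= v' x & w' x < 0].
  move=> vw'; apply: contrapT => h; case/eqP: vw'; apply: dval_incl => x x0 vx.
  by rewrite leNgt; apply/negP => wx; apply: h; exists x.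
have [a [a0 va wa]] := ex _ _ vw; have [b [b0 wb vb]] := ex _ _ (contra_neq esym vw).
exists (b / a); split; first by rewrite mulf_neq0 ?invr_eq0.
  by rewrite ordM ?invr_eq0 // ordV //; lia.
by rewrite ordM ?invr_eq0 // ordV //; lia.
Qed.

(** Weak approximation, by induction on the number of places. *)
Lemma separate_many v (s : seq (dval k)) : v \notin s ->
  exists x, [/\ x != 0, v x < 0 & forall w, w \in s -> 0 < w x].
Proof.
elim: s => [_|w s IH]; first by
  have [x x0 vx] := ord_onto v; exists x^-1; rewrite invr_eq0 ordV // vx; split.
rewrite inE negb_or => /andP[vw /IH[x [x0 vx sx]]].
have [y [y0 vy wy]] := separate_two vw.
(* large powers of x dominate y at the places already treated *)
have [m hm] : exists m : nat, forall u, u \in s -> 0 < u y + u x *+ m.+1.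
  elim: s sx {IH} => [|u s IH] sx; first by exists 0%N.
  have [|m hm] := IH; first by move=> u' us; apply: sx; rewrite inE us orbT.
  exists (m + `|u y|)%N => u'; rewrite inE => /predU1P[->|us].
    have := sx u; rewrite inE eqxx => /(_ isT); rewrite int_mulrn; nia.
  apply: lt_le_trans (hm _ us) _; rewrite lerD2l !int_mulrn.
  by have := sx u'; rewrite inE us orbT => /(_ isT); nia.
have xm0 : x ^+ m.+1 != 0 by rewrite expf_neq0.
have [wx|wx] := leP 0 (w x).
  exists (x ^+ m.+1 * y); split; first by rewrite mulf_neq0.
    rewrite ordM // ordX //; have : v x *+ m.+1 <= 0 by rewrite mulrn_wle0 // ltW.
    by move: vy; lia.
  move=> u; rewrite inE ordM // ordX // => /predU1P[->|/hm]; last by rewrite addrC.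
  by apply: ltr_wpDl => //; rewrite mulrn_wge0.
(* here x^m / (1 + x^m) is a unit at v and at w *)
have unit_at (u : dval k) : u x < 0 -> 1 + x ^+ m.+1 != 0 /\ u (1 + x ^+ m.+1) = u (x ^+ m.+1).
  move=> ux; have uxm : u (x ^+ m.+1) < 0 by rewrite ordX // mulrn_wlt0.
  have n0 : 1 + x ^+ m.+1 != 0.
    apply/eqP => /eqP; rewrite addr_eq0 => /eqP e.
    by have := ord_1 u; rewrite e ordN; move: uxm; lia.
  split=> //; have h1 := ordD u (oner_neq0 k) xm0 n0.
  have h2 : Num.min (u (1 + x ^+ m.+1)) (u (-1)) <= u (x ^+ m.+1).
    have e : x ^+ m.+1 = (1 + x ^+ m.+1) + -1 by rewrite addrC addKr.
    rewrite {2}e; apply: ordD => //; first by rewrite oppr_eq0 oner_neq0.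
    by rewrite -e.
  by move: h1 h2; rewrite !ge_min ordN ord_1; move: uxm; clear;
    move: (u (1 + _)) (u (_ ^+ _)) => a b; lia.
have [n0 vn] := unit_at v vx; have [_ wn] := unit_at w wx.
exists (y * x ^+ m.+1 / (1 + x ^+ m.+1)); split.
- by rewrite !mulf_neq0 ?invr_eq0.
- by rewrite !ordM ?mulf_neq0 ?invr_eq0 // ordV // vn addrK.
- move=> u; rewrite inE => /predU1P[->|us].
    by rewrite !ordM ?mulf_neq0 ?invr_eq0 // ordV // wn addrK.
  have uxm : 0 < u (x ^+ m.+1) by rewrite ordX // pmulrn_lgt0 // sx.
  have un : u (1 + x ^+ m.+1) = 0.
    have h1 := ordD u (oner_neq0 k) xm0 n0.
    have := @ordD _ u (1 + x ^+ m.+1) (- x ^+ m.+1) n0.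
    rewrite oppr_eq0 addrK => /(_ xm0 (oner_neq0 _)) h2.
    by move: h1 h2; rewrite !ge_min ordN ord_1; move: uxm; clear;
    move: (u (1 + _)) (u (_ ^+ _)) => a b; lia.
  rewrite !ordM ?mulf_neq0 ?invr_eq0 // ordV // un subr0 ordX //.
  exact: hm.
Qed.

End DistinctValuations.

Section PlacesOverPrimes.
Context (L : fieldExtType rat).
Implicit Types v w : dval L.

Lemma ord_nat_ge0 v m : (0 < m)%N -> 0 <= v m%:R.
Proof.
move=> m0; have := ordge_nat v m; rewrite ordgeE //.
by rewrite -(rmorph_nat (in_alg L)) fmorph_eq0 pnatr_eq0 -lt0n.
Qed.

Lemma natL_neq0 m : (0 < m)%N -> (m%:R : L) != 0.
Proof. by move=> m0; rewrite -(rmorph_nat (in_alg L)) fmorph_eq0 pnatr_eq0 -lt0n. Qed.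

Lemma ord_coprime v l m : (0 < l)%N -> (0 < m)%N -> 0 < v l%:R -> coprime l m ->
  v m%:R = 0.
Proof.
move=> l0 m0 vl /(coprimeP _ l0)[[a b] /= e].
apply/eqP; rewrite eq_le ord_nat_ge0 // andbT leNgt; apply/negP => vm.
have : ordge v 1 (1 : L).
  have ba : (b * m < a * l)%N by move: e; lia.
  have -> : (1 : L) = (a * l)%:R - (b * m)%:R by rewrite -natrB ?e // ltnW.
  apply: ordgeD; rewrite ?ordgeN natrM -[1 : int]add0r; apply: ordgeM;
    by rewrite ?ordge_nat // ordgeE ?natL_neq0.
by rewrite ordgeE ?oner_neq0 // ord_1.
Qed.

Lemma rat_split (q : rat) : (q%:A : L) = (numq q)%:~R / (denq q)%:~R.
Proof.
rewrite -[LHS]/(in_alg L q) -{1}[q]divq_num_den fmorph_div !rmorph_int //.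
Qed.

Lemma ord_int v (z : int) : v z%:~R = v (`|z|%N)%:R.
Proof. by case: z => m; rewrite ?NegzE ?mulrNz ?ordN. Qed.

Lemma ord_rat v (q : rat) : q != 0 ->
  v (q%:A : L) = v (`|numq q|%N)%:R - v (`|denq q|%N)%:R.
Proof.
move=> q0; have d0 : ((denq q)%:~R : L) != 0.
  by rewrite -(rmorph_int (in_alg L)) fmorph_eq0 intr_eq0 denq_neq0.
have n0 : ((numq q)%:~R : L) != 0.
  by rewrite -(rmorph_int (in_alg L)) fmorph_eq0 intr_eq0 numq_eq0.
by rewrite rat_split ordM ?invr_eq0 // ordV // !ord_int.
Qed.

(** Both conditions say that l does not divide the denominator of q. *)
Lemma same_rat_integrality l v w (q : rat) : prime l -> 0 < v l%:R -> 0 < w l%:R ->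
  q != 0 -> 0 <= v (q%:A : L) -> 0 <= w (q%:A : L).
Proof.
move=> pl vl wl q0; have l0 := prime_gt0 pl.
have n0 : (0 < `|numq q|)%N by rewrite absz_gt0 numq_eq0.
have d0 : (0 < `|denq q|)%N by rewrite absz_gt0 denq_neq0.
have [ld|ld] := boolP (l %| `|denq q|)%N.
  have ln : coprime l `|numq q|.
    rewrite prime_coprime //; apply/negP => ln.
    have := coprime_num_den q; rewrite /coprime => /eqP g.
    have : (l %| 1)%N by rewrite -g dvdn_gcd ln ld.
    by rewrite dvdn1 => /eqP l1; rewrite l1 in pl.
  rewrite ord_rat // (ord_coprime l0 n0 vl ln) sub0r oppr_ge0 => vd.
  exfalso; have : 0 < v (`|denq q|)%:R.
    have [m e] := dvdnP ld; rewrite e natrM.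
    have m0 : (0 < m)%N by move: d0; rewrite e muln_gt0 => /andP[].
    by rewrite ordM ?natL_neq0 //; have := ord_nat_ge0 v m0; move: vl; lia.
  by move: vd; lia.
move=> _; have ld' : coprime l `|denq q| by rewrite prime_coprime.
by rewrite ord_rat // (ord_coprime l0 d0 wl ld') subr0 ord_nat_ge0.
Qed.

(** For distinct places over l, choose elements that are not integral at one
    of the places and positive at the others. They are linearly
    independent over the rationals: after division by a coefficient that
    is least l-adically, a relation exhibits one of them as integral at
    its own place. So there are at most [F : Q] places. *)
Lemma finite_places_prime l : prime l -> finite_set [set v : dval L | 0 < v l%:R].
Proof.
move=> pl; apply: contrapT => /infinite_set_fset inf.
have [B BA Bd] := inf (\dim {: L}).+1.
pose s : seq (dval L) := finmap.enum_fset B.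
have us : uniq s by exact: finmap.fset_uniq.
have sl v : v \in s -> 0 < v l%:R by move=> vs; apply: BA.
have /choice [x hx] : forall v, exists x, v \in s ->
    [/\ x != 0, v x < 0 & forall w, w \in s -> w != v -> 0 < w x].
  move=> v; have [vs|] := boolP (v \in s); last by exists 0.
  have [|x [x0 vx sx]] := @separate_many _ v (rem v s); first by rewrite mem_rem_uniqF.
  by exists x => _; split=> // w ws wv; apply: sx; rewrite mem_rem_uniq // inE wv.
pose X := [tuple of map x (in_tuple s)].
have : ~~ free X.
  apply/negP => /eqP fX; have : (\dim <<X>> <= \dim {: L})%N by rewrite dimvS ?subvf.
  by rewrite fX size_tuple leqNgt Bd.
move=> /freeP nf; apply: nf => a sa i0; apply/eqP; apply: contraT => ai0; exfalso.
pose pl_ (i : 'I_(size s)) := tnth (in_tuple s) i.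
have plP i : pl_ i \in s by exact: mem_tnth.
have plinj i i' : pl_ i = pl_ i' -> i = i'.
  by rewrite /pl_ !(tnth_nth (pl_ i0)) => /eqP; rewrite nth_uniq // => /eqP /val_inj.
(* divide by a coefficient of least valuation *)
have [i [ai imin]] : exists i, a i != 0 /\ forall i', a i' != 0 ->
    pl_ i0 ((a i)%:A : L) <= pl_ i0 ((a i')%:A : L).
  case: (@arg_minP _ _ _ i0 (fun i => a i != 0) (fun i => pl_ i0 ((a i)%:A : L)) ai0).
  by move=> i ai imin; exists i.
have XE (i' : 'I_(size s)) : X`_i' = x (pl_ i') by rewrite -tnth_nth tnth_map.
have : \sum_(i' < size s) (a i' / a i)%:A * x (pl_ i') = 0.
  have := congr1 ( *:%R (a i)^-1) sa; rewrite scaler0 scaler_sumr; apply: etrans.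
  by apply: eq_bigr => i' _; rewrite XE scalerA -scalerAl mul1r mulrC.
rewrite (bigD1 i) //= divff // scale1r mul1r => /eqP; rewrite addr_eq0 => /eqP e.
have [xi0 vxi _] := hx _ (plP i).
have : ordge (pl_ i) 0 (x (pl_ i)).
  rewrite e ordgeN; apply: ordge_sum => i' ii'.
  have [->|ai'] := eqVneq (a i') 0; first by rewrite mul0r scale0r mul0r; exact: ordge0.
  have [xi'0 _ h] := hx _ (plP i').
  apply: ordge0M.
    have q0 : a i' / a i != 0 by rewrite mulf_neq0 ?invr_eq0.
    rewrite ordgeE ?fmorph_eq0 //; last by rewrite -[_%:A]/(in_alg L _) fmorph_eq0.
    apply: (@same_rat_integrality l (pl_ i0)); rewrite ?sl //.
    rewrite -[_%:A]/(in_alg L _) rmorphM fmorphV ordM ?invr_eq0 ?fmorph_eq0 // ordV ?fmorph_eq0 //.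
    by rewrite subr_ge0; exact: imin.
  rewrite ordgeE // ltW // h //; apply: contra_neq ii' => /plinj -> //.
by rewrite ordgeE //; move: vxi; lia.
Qed.

Lemma finite_places_nat m : (0 < m)%N -> finite_set [set v : dval L | 0 < v m%:R].
Proof.
elim/ltn_ind: m => m IH m0; have [m1|m1] := leqP m 1.
  rewrite (_ : [set _ | _] = set0) // -subset0 => v /=.
  by rewrite (_ : m = 1%N) ?ord_1 //; lia.
have pl := pdiv_prime m1; have [d e] := dvdnP (pdiv_dvd m).
have d0 : (0 < d)%N by move: m0; rewrite {1}e muln_gt0 => /andP[].
have dm : (d < m)%N by rewrite [ltnRHS]e ltn_Pmulr // prime_gt1.
have := IH d dm d0; have := finite_places_prime pl.
move=> f1 f2; apply: (@sub_finite_set _ _ ([set v : dval L | 0 < v (pdiv m)%:R] `|`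
  [set v : dval L | 0 < v d%:R])); last by rewrite finite_setU.
move=> v /=; rewrite {1}e natrM ordM ?natL_neq0 ?(prime_gt0 pl) // => h.
have [?|h'] := ltP 0 (v d%:R); first by right.
by left; move: h h'; lia.
Qed.

(** Away from the denominators of its minimal polynomial, g is integral. *)
Lemma finite_places_neg (g : L) : finite_set [set v : dval L | v g < 0].
Proof.
pose P := minPoly 1%AS g.
have cP i : exists b : rat, P`_i = b%:A.
  have /polyOverP/(_ i)/vlineP [b Pb] : P \is a polyOver 1%VS by exact: minPolyOver.
  by exists b.
have [c cE] := choice cP.
pose m := (\prod_(i < size P) `|denq (c i)|)%N.
have m0 : (0 < m)%N by rewrite prodn_gt0 // => i; rewrite absz_gt0 denq_neq0.
apply: sub_finite_set (finite_places_nat m0) => v /= vg.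
apply: contrapT => /negP; rewrite -leNgt => vm.
have : ordge v 0 g.
  apply: (@ordge_integral _ _ P); [exact: monic_minPoly | exact: root_minPoly |].
  move=> i; have [iP|iP] := ltnP i (size P); last by rewrite nth_default //; exact: ordge0.
  rewrite cE; have [->|ci] := eqVneq (c i) 0; first by rewrite scale0r; exact: ordge0.
  have di : (0 < `|denq (c i)|)%N by rewrite absz_gt0 denq_neq0.
  have ni : (0 < `|numq (c i)|)%N by rewrite absz_gt0 numq_eq0.
  have cA0 : ((c i)%:A : L) != 0 by rewrite -[_%:A]/(in_alg L _) fmorph_eq0.
  rewrite ordgeE // ord_rat // subr_ge0 (le_trans _ (ord_nat_ge0 v ni)) //.
  apply: le_trans vm; rewrite /m (bigD1 (Ordinal iP)) //= natrM.
  set r := (\prod_(_ < _ | _) _)%N.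
  have r0 : (0 < r)%N by rewrite prodn_gt0 // => j; rewrite absz_gt0 denq_neq0.
  by rewrite ordM ?natL_neq0 // lerDl ord_nat_ge0.
have g0 : g != 0 by apply: contraTneq vg => ->; rewrite Defs.ord0.
by rewrite ordgeE //; move: vg; lia.
Qed.

Lemma finite_places_ord (g : L) : finite_set [set v : dval L | v g <> 0].
Proof.
have [->|g0] := eqVneq g 0.
  by rewrite (_ : [set _ | _] = set0) // -subset0 => v /=; rewrite Defs.ord0.
apply: (@sub_finite_set _ _ ([set v : dval L | v g < 0] `|` [set v : dval L | v g^-1 < 0])).
  by move=> v /=; rewrite ordV // oppr_lt0; case: ltgtP => //; [left|right].
by rewrite finite_setU; split; exact: finite_places_neg.
Qed.

End PlacesOverPrimes.

(** * Norms and the product formula *)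

Section Norms.
Context (R : realType) (N : field_data R) (L : fieldType) (phi : {rmorphism rat -> L})
  (f : Sinf N -> {rmorphism N -> L}) (finj : forall s s', f s =1 f s' -> s = s').
Local Notation S := (Sinf N).
Local Notation d := #|S|.

(** Artin: distinct embeddings are linearly independent; the support of a
    relation can be shortened by multiplying its variable. *)
Lemma embeddings_independent (c : S -> L) :
  (forall x, \sum_s c s * f s x = 0) -> forall s, c s = 0.
Proof.
have [k] := ubnP #|[set s | c s != 0]%SET|; elim: k c => // k IH c kc rel s.
apply: contrapT => /eqP cs.
have [t ct ts] : exists2 t, c t != 0 & t != s.
  apply: contrapT => h; have := rel 1; rewrite (bigD1 s) //= rmorph1 mulr1 big1.
    by rewrite addr0; apply/eqP.
  move=> t ts; have [->|ct] := eqVneq (c t) 0; first by rewrite mul0r.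
  by case: h; exists t.
have [y fy] : exists y, f s y != f t y.
  apply: contrapT => h; case/eqP: ts; apply: finj => y; apply: contrapT => /eqP fy.
  by apply: h; exists y; rewrite eq_sym.
have := IH (fun u => c u * (f u y - f t y)) _ _ s.
move=> h; have /eqP : c s * (f s y - f t y) = 0.
  apply: h => [|x].
    rewrite ltnS in kc; apply: leq_trans kc; apply/proper_card/properP; split.
      by apply/fintype.subsetP => u; rewrite !inE; apply: contraNneq => ->; rewrite mul0r.
    by exists t; rewrite !inE // subrr mulr0 eqxx.
  have := rel (y * x); have := rel x => e1 e2.
  transitivity (\sum_u c u * f u (y * x) - f t y * \sum_u c u * f u x).
    rewrite mulr_sumr -sumrB; apply: eq_bigr => u _.
    by rewrite rmorphM mulrBr mulrBl !mulrA [f t y * c u]mulrC.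
  by rewrite e1 e2 mulr0 subr0.
by rewrite mulf_eq0 (negPf cs) subr_eq0 (negPf fy).
Qed.

Let bs (i : 'I_d) : N := (vbasis {: NF N})`_i.
Let co (x : N) (i : 'I_d) : rat := coord (vbasis {: NF N}) (cast_ord (Sinf_card N) i) x.

Lemma coord_basis x : x = \sum_(i < d) co x i *: bs i.
Proof.
rewrite [LHS](coord_vbasis (memvf x)).
rewrite (reindex (cast_ord (Sinf_card N))) //.
exists (cast_ord (esym (Sinf_card N))) => i _; [exact: cast_ordK | exact: cast_ordKV].
Qed.

Definition field_norm (g : N) : rat := \det (\matrix_(i, j) co (g * bs i) j).

Lemma emb_scale s q x : f s (q *: x) = phi q * f s x.
Proof.
rewrite -mulr_algl rmorphM; congr (_ * _).
by rewrite rat_split -[in RHS](divq_num_den q) !fmorph_div !rmorph_int.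
Qed.

(** The matrix of the embeddings of a basis, invertible by the independence of
    embeddings, conjugates multiplication by g to a diagonal matrix. *)
Lemma field_normE g : \prod_s f s g = phi (field_norm g).
Proof.
pose B : 'M[L]_d := \matrix_(i, t) f (enum_val t) (bs i).
pose A : 'M[rat]_d := \matrix_(i, j) co (g * bs i) j.
have MB : map_mx phi A *m B = B *m diag_mx (\row_t f (enum_val t) g).
  apply/matrixP => i t; rewrite mul_mx_diag !mxE -rmorphM [bs i * g]mulrC.
  rewrite (coord_basis (g * bs i)) rmorph_sum; apply: eq_bigr => j _.
  by rewrite !mxE emb_scale.
have dB : \det B != 0.
  rewrite -det_tr; apply/negP => /det0P [v v0 vB]; case/eqP: v0.
  apply/rowP => t; rewrite mxE.
  rewrite -(enum_valK t); apply: (@embeddings_independent (fun s => v 0 (enum_rank s))).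
  move=> x; rewrite (coord_basis x).
  transitivity (\sum_(i < d) phi (co x i) * (v *m B^T) 0 i); last first.
    by rewrite vB big1 // => i _; rewrite mxE mulr0.
  transitivity (\sum_s \sum_(i < d) phi (co x i) * (v 0 (enum_rank s) * f s (bs i))).
    apply: eq_bigr => s _; rewrite rmorph_sum mulr_sumr; apply: eq_bigr => i _.
    by rewrite emb_scale mulrCA.
  rewrite exchange_big; apply: eq_bigr => i _; rewrite -mulr_sumr mxE; congr (_ * _).
  rewrite (reindex _ (onW_bij _ (enum_val_bij S))) /=.
  have -> : \sum_(i0 : 'I_d) v 0 (enum_rank (enum_val i0)) * f (enum_val i0) (bs i) = 
    \sum_(i0 : 'I_d) v 0 i0 * f (enum_val i0) (bs i) by apply: eq_bigr => j _; rewrite enum_valK.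
  by apply: eq_bigr => j _; rewrite !mxE.
have := congr1 determinant MB; rewrite !det_mulmx det_map_mx mulrC => /(mulfI dB) ->.
rewrite det_diag (reindex _ (onW_bij _ (enum_val_bij S))) /=.
by apply: eq_bigr => t _; rewrite mxE.
Qed.

End Norms.

Section ProductFormula.
Context (R : realType) (p : nat) (N : field_data R) (C : coef_data p N).
Context (T T' : class_family C -> class_family C) (hT : is_eps_cyc T T').
Local Notation S := (Sinf N).
Local Notation E := (EF C).

Lemma ratid_idele (g : N) : g != 0 -> is_idele (ratid g).
Proof.
move=> g0; split; last by move=> s; rewrite /= fmorph_eq0.
split=> [v|]; first by rewrite /= fmorph_eq0.
by apply: sub_finite_set (finite_places_ord g) => v /=; rewrite cinjE.
Qed.

Lemma one_idele : is_idele (fun=> 1 : Fv N _, fun=> 1).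
Proof.
split; last by move=> s; exact: oner_neq0.
split=> [v|]; first exact: oner_neq0.
by rewrite (_ : [set _ | _] = set0) // -subset0 => v /=; rewrite ord_1.
Qed.

Lemma idele_norm_finE (y : fidele N) (A : set (place N)) : finite_set A ->
  (forall v, ~ A v -> cval (Fv N v) (y v) = 0) ->
  idele_norm_fin y =
  \prod_(v <- finmap.enum_fset (fset_set A)) ((normv v)%:R : rat) ^ (- cval (Fv N v) (y v)).
Proof.
move=> fA hA; rewrite /idele_norm_fin -(fsbig_widen A) ?fsbig_finite //.
by move=> v [_ /= /hA ->]; rewrite oppr0 expr0z.
Qed.

(** The cardinal of an infinite set counts as 0. So, were the residue field
    infinite, the character would vanish at the idele of a local uniformiser. *)
Lemma normv_gt0 (v : place N) : (0 < normv v)%N.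
Proof.
have [q q0 vq] := ord_onto v.
pose y : idele N := (fun u => if u == v then cinj (Fv N u) q else 1, fun=> 1).
have hy : is_idele y.
  split; last by move=> s; exact: oner_neq0.
  split=> [u|]; first by rewrite /=; case: ifP => _; rewrite ?fmorph_eq0 ?oner_neq0.
  apply: sub_finite_set (finite_set1 v) => u /=.
  by case: eqP => // _; rewrite ord_1.
rewrite lt0n; apply/negP => /eqP n0.
case/eqP: (eps_neq0 hT hy); rewrite /eps_cyclo (idele_norm_finE (finite_set1 v)).
  rewrite -fsbig_finite ?fsbig_set1 /= ?n0 ?eqxx ?cinjE ?vq; last exact: finite_set1.
  by rewrite exprN1 invr0 ratr_E rmorph0 mulr0 mul0r.
by move=> u /= /eqP/negPf ->; rewrite ord_1.
Qed.

(** A principal idele has the class of 1 at all levels. *)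
Lemma eps_rat (g : N) : g != 0 -> eps_cyclo C (ratid g) = 1.
Proof.
move=> g0; rewrite -(eps_class_eq hT one_idele (ratid_idele g0)).
  rewrite /eps_cyclo /normFp big1 => [|s _]; last exact: rmorph1.
  rewrite (idele_norm_finE (finite_set0 _)) => [|v _]; last exact: ord_1.
  rewrite fset_set0 big_nil ratr_E rmorph1 !mul1r big1 // => s _ /=.
  by rewrite ltNge ler01.
move=> b; exists g, (fun=> 1), (fun=> 1); split=> //; [exact: congr_1|exact: real_units_1|].
by apply: idele_eq => i /=; rewrite !mulr1.
Qed.

(** This is the triviality of the character on principal ideles. The products
    over the embeddings into E and into R are images of the same rational
    norm, and the signs in the character make it positive. *)
Lemma product_formula (g : N) (A : set (place N)) : g != 0 -> finite_set A ->
  (forall v, ~ A v -> v g = 0) ->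
  \prod_s `|realemb N s g| =
  \prod_(v <- finmap.enum_fset (fset_set A)) ((normv v)%:R : R) ^ (v g).
Proof.
move=> g0 fA hA.
pose q := \prod_(v <- finmap.enum_fset (fset_set A)) ((normv v)%:R : rat) ^ (- v g).
pose sg := \prod_s (if realemb N s g < 0 then -1 else 1) : rat.
have realE := @field_normE _ N R (ratr : {rmorphism rat -> R}) (realemb N) (@realemb_inj _ N) g.
have embE := @field_normE _ N E (rat_to_E C) (emb C) (@emb_inj _ _ _ C) g.
have qE : idele_norm_fin (ratid g).1 = q.
  rewrite (idele_norm_finE fA) => [|v /hA vg]; last by rewrite /= cinjE.
  by apply: eq_bigr => v _; rewrite /= cinjE.
have key : field_norm g * q * sg = 1.
  apply: (fmorph_inj (rat_to_E C)); rewrite rmorph1 -(eps_rat g0) /eps_cyclo.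
  rewrite !rmorphM -embE qE ratr_E; congr (_ * _ * _).
    by rewrite /normFp; apply: eq_bigr => s _; rewrite /= ext_emb.
  rewrite rmorph_prod; apply: eq_bigr => s _; rewrite [RHS]/=.
  by case: ifP => _; rewrite ?rmorphN ?rmorph1.
have q0 : 0 < q.
  by apply: prodr_gt0 => v _; rewrite exprz_gt0 // ltr0n normv_gt0.
have sg1 : `|sg| = 1.
  by rewrite normr_prod big1 // => s _; case: ifP => _; rewrite ?normrN normr1.
rewrite -normr_prod realE -(@ratr_norm R).
have -> : `|field_norm g| = q^-1.
  have := congr1 Num.norm key; rewrite !normrM sg1 mulr1 normr1 (gtr0_norm q0) => h.
  by rewrite -[LHS](mulfK (lt0r_neq0 q0)) h mul1r.
rewrite fmorphV rmorph_prod -prodfV; apply: eq_bigr => v _.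
by rewrite fmorphXz rmorph_nat invr_expz opprK.
Qed.

(** By the product formula, an element of F whose absolute values are all
    small has large denominators. *)
Lemma bounded_below (a : place N -> nat) : finite_set [set v | a v <> 0%N] ->
  exists2 c : R, 0 < c & forall g : N, g != 0 ->
    (forall v, - (a v)%:Z <= v g) -> c <= \prod_s `|realemb N s g|.
Proof.
move=> fa; exists (\prod_(v <- finmap.enum_fset (fset_set [set v | a v <> 0%N]))
    ((normv v)%:R : R) ^ (- (a v)%:Z)).
  by apply: prodr_gt0 => v _; rewrite exprz_gt0 // ltr0n normv_gt0.
move=> g g0 ag; pose A := [set v | a v <> 0%N] `|` [set v | v g <> 0].
have fA : finite_set A by rewrite finite_setU; split=> //; exact: finite_places_ord.
rewrite (@product_formula g A) => [||//|v /not_orP[_ /contrapT]] //.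
rewrite -!fsbig_finite // (fsbig_widen _ A); [|by left|].
  rewrite !fsbig_finite //; apply: ler_prod => v _.
  rewrite exprz_ge0 ?ler0n //= ler_weXz2l //.
  by rewrite ler1n normv_gt0.
by move=> v [_ /= /contrapT ->]; rewrite oppr0 expr0z.
Qed.

Lemma Sinf_gt0 : (0 < #|S|)%N.
Proof. by rewrite Sinf_card (leq_trans _ (dimvS (subvf 1%VS))) ?dimv1. Qed.

(** Two elements with the same integer parts of their images divided by e
    differ by an element with absolute values too small for bounded_below.
    So these integer parts determine the element, and they are bounded. *)
Lemma finite_bounded (a : place N -> nat) (B : R) : finite_set [set v | a v <> 0%N] ->
  finite_set [set g : N | (forall v, ordge v (- (a v)%:Z) g) /\
                          forall s, `|realemb N s g| <= B].
Proof.
move=> fa; have [c c0 hc] := bounded_below fa.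
pose e : R := Num.min 1 (c / 2).
have e0 : 0 < e by rewrite lt_min ltr01 divr_gt0.
have ec : e < c by rewrite gt_min (_ : c / 2 < c) ?orbT //; lra.
pose M := (Num.truncn ((B + 1) / e)).+1.
set A := [set g | _].
pose key (g : N) : {ffun S -> 'I_(M + M).+1} :=
  [ffun s => inord (absz (Num.floor (realemb N s g / e) + M%:Z))].
have keyi g g' : A g -> A g' -> key g = key g' -> g = g'.
  move=> Ag Ag' kk; have [ag Bg] := Ag; have [ag' Bg'] := Ag'; apply/eqP; rewrite -subr_eq0; apply/negPn/negP => gg'.
  have small s : `|realemb N s (g - g')| <= e.
    have B1 : (B + 1) / e <= M%:R.
      have B0 : 0 <= (B + 1) / e.
        apply: divr_ge0; last exact: ltW.
        by apply: addr_ge0 => //; apply: le_trans (Bg s).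
      by have := truncn_itv B0 => /andP[_ /ltW].
    have fl h : A h -> 0 <= Num.floor (realemb N s h / e) + M%:Z < (M + M).+1%:Z.
      move=> [_ /(_ s)]; rewrite ler_norml => /andP[h1 h2].
      have xle : realemb N s h / e + 1 <= M%:R.
        apply: le_trans B1; rewrite mulrDl lerD ?ler_pM2r ?invr_gt0 // div1r.
        by rewrite invf_ge1 // ge_min lexx.
      have xge : - M%:R <= realemb N s h / e - 1.
        rewrite lerNl opprB; apply: le_trans B1; rewrite addrC mulrDl -mulNr lerD //.
          by rewrite ler_pM2r ?invr_gt0 // lerNl.
        by rewrite div1r invf_ge1 // ge_min lexx.
      have f1 := floor_le (realemb N s h / e).
      have f2 := floorD1_gt (realemb N s h / e).
      have : ((- M%:Z)%:~R : R) < (Num.floor (realemb N s h / e) + 1)%:~R.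
        by rewrite rmorphN /= -pmulrn; lra.
      rewrite ltr_int => l1.
      have : ((Num.floor (realemb N s h / e))%:~R : R) <= (M%:Z)%:~R.
        by rewrite -pmulrn; lra.
      rewrite ler_int => l2; move: l1 l2; clear.
      by move: (Num.floor _) (M) => z m; lia.
    have gen (z z' : int) m : 0 <= z + m%:Z < (m + m).+1%:Z ->
        0 <= z' + m%:Z < (m + m).+1%:Z ->
        inord `|(z + m%:Z)%R| = inord `|(z' + m%:Z)%R| :> 'I_(m + m).+1 -> z = z'.
      by move=> hz hz' /(congr1 val); rewrite /= !inordK; lia.
    have := congr1 (fun k : {ffun S -> 'I_(M + M).+1} => k s) kk.
    rewrite /key !ffunE => /(gen _ _ _ (fl _ Ag) (fl _ Ag')) fE.
    have f1 := floor_le (realemb N s g / e); have f2 := floorD1_gt (realemb N s g / e).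
    have f3 := floor_le (realemb N s g' / e); have f4 := floorD1_gt (realemb N s g' / e).
    rewrite fE in f1 f2; rewrite rmorphB -[X in `|X|](divfK (lt0r_neq0 e0)).
    rewrite normrM (gtr0_norm e0) -[leRHS]mul1r ler_pM2r // mulrBl ler_norml.
    by rewrite !intrD in f2 f4; lra.
  have := hc _ gg'; rewrite leNgt => /(_ _)/negP; apply.
    move=> v; rewrite -ordgeE //; apply: ordgeD; rewrite ?ordgeN //.
  apply: le_lt_trans ec; have [s0 _] : exists s : S, true.
    by have /card_gt0P [s _] := Sinf_gt0; exists s.
  rewrite (bigD1 s0) //= -[leRHS]mulr1 ler_pM // ?prodr_ge0 //.
  by apply: prodr_ile1 => s _; rewrite normr_ge0 (le_trans (small s)) // ge_min lexx.
pose inv (k : {ffun S -> 'I_(M + M).+1}) : N := xget 0 [set g | A g /\ key g = k].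
apply: (@sub_finite_set _ _ (inv @` setT)); last by apply: finite_image; exact: finite_finset.
move=> g Ag; exists (key g) => //; rewrite /inv.
by case: xgetP => [g' _ [Ag' /keyi]|/(_ g)]; [apply | case].
Qed.

End ProductFormula.

(** * Real quadratic forms up to similarity *)

Section Gram.
Context (R : realType) (m : nat).
Implicit Types (x y : 'rV[R]_m) (A B M : 'M[R]_m).

Definition sqn x : R := (x *m x^T) 0 0.

Lemma sqnE x : sqn x = \sum_i x 0 i ^+ 2.
Proof. by rewrite /sqn mxE; apply: eq_bigr => i _; rewrite mxE expr2. Qed.

Lemma sqn_ge0 x : 0 <= sqn x.
Proof. by rewrite sqnE sumr_ge0 // => i _; exact: sqr_ge0. Qed.

Lemma sqn_eq0 x : (sqn x == 0) = (x == 0).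
Proof.
rewrite sqnE psumr_eq0; last by move=> i _; exact: sqr_ge0.
apply/idP/eqP => [/allP h|->]; last by apply/allP => i _; rewrite mxE expr0n /= eqxx.
by apply/rowP => i; have := h i (mem_index_enum _); rewrite sqrf_eq0 mxE => /eqP.
Qed.

Lemma sqn_gt0 x A : A \in unitmx -> x != 0 -> 0 < sqn (x *m A).
Proof.
move=> uA x0; rewrite lt0r sqn_ge0 andbT sqn_eq0; apply: contra_neq x0 => e.
by rewrite -(mulmxK uA x) e mul0mx.
Qed.

Lemma sqn0 : sqn 0 = 0.
Proof. by apply/eqP; rewrite sqn_eq0. Qed.

Lemma sqn_mul x A : sqn (x *m A) = (x *m (A *m A^T) *m x^T) 0 0.
Proof. by rewrite /sqn trmx_mul !mulmxA. Qed.

(** Comparison of the quadratic forms attached to A and B up to a scalar; the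
    constant C measures their distance in the space of similarity classes. *)
Definition nearmx (C : R) A B : Prop :=
  forall x y, sqn (x *m A) * sqn (y *m B) <= C * (sqn (y *m A) * sqn (x *m B)).

Lemma nearmx_refl A : nearmx 1 A A.
Proof. by move=> x y; rewrite mul1r mulrC. Qed.

Lemma nearmx_sym C A B : nearmx C A B -> nearmx C B A.
Proof. by move=> h x y; rewrite mulrC [sqn _ * sqn _]mulrC. Qed.

Lemma nearmx_le C C' A B : C <= C' -> nearmx C A B -> nearmx C' A B.
Proof.
move=> CC h x y; apply: le_trans (h x y) _; apply: ler_wpM2r => //.
by rewrite mulr_ge0 // sqn_ge0.
Qed.

Lemma nearmx_trans C C' A B B' : 0 <= C -> B \in unitmx -> nearmx C A B -> nearmx C' B B' ->
  nearmx (C * C') A B'.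
Proof.
move=> C0 uB h h' x y.
have [->|x0] := eqVneq x 0; first by rewrite !mul0mx sqn0 mul0r !mulr0.
have [->|y0] := eqVneq y 0; first by rewrite !mul0mx sqn0 mulr0 mul0r !mulr0.
have bx := sqn_gt0 uB x0; have by_ := sqn_gt0 uB y0.
have := ler_pM _ _ (h x y) (h' x y); rewrite !mulr_ge0 ?sqn_ge0 // => /(_ isT isT).
move=> H; rewrite -(ler_pM2r (mulr_gt0 bx by_)).
move: H; set a := sqn _; set b := sqn _; set c := sqn _; set d := sqn _.
set e := sqn _; set f := sqn _ => H.
have -> : a * d * (c * b) = a * b * (c * d) by ring.
by have -> : C * C' * (e * f) * (c * b) = C * (e * c) * (C' * (b * f)) by ring.
Qed.

Lemma nearmx_mull C g A B : nearmx C A B -> nearmx C (g *m A) (g *m B).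
Proof. by move=> h x y; rewrite !mulmxA; exact: h. Qed.

Lemma nearmx_mulr A k z : k *m k^T = z%:M -> nearmx 1 A (A *m k).
Proof.
move=> kk x y; rewrite mul1r !mulmxA.
have e u : sqn (u *m k) = z * sqn u.
  by rewrite sqn_mul kk mul_mx_scalar -scalemxAl mxE.
by rewrite !e mulrCA [leRHS]mulrCA [sqn (x *m A) * _]mulrC.
Qed.

Lemma polarization (P : 'M[R]_m) i j : P^T = P -> let ee k : 'rV[R]_m := delta_mx 0 k in
  P i j = (((ee i + ee j) *m P *m (ee i + ee j)^T) 0 0
     - (ee i *m P *m (ee i)^T) 0 0 - (ee j *m P *m (ee j)^T) 0 0) / 2.
Proof.
move=> sP ee.
have e k l : (ee k *m P *m (ee l)^T) 0 0 = P k l.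
  rewrite -rowE mxE (bigD1 l) //= !mxE !eqxx mulr1 big1 ?addr0 // => i' li'.
  by rewrite !mxE (negPf li') andbF mulr0.
have PP : P j i = P i j by rewrite -{1}sP mxE.
have D (a b : 'M[R]_1) i0 j0 : (a + b) i0 j0 = a i0 j0 + b i0 j0 by rewrite mxE.
rewrite linearD /= !mulmxDl !mulmxDr !D.
by rewrite !e PP; field.
Qed.

Lemma quadratic_mx_eq M M' : M^T = M -> M'^T = M' ->
  (forall x, (x *m M *m x^T) 0 0 = (x *m M' *m x^T) 0 0) -> M = M'.
Proof.
move=> sM sM' h; apply/matrixP => i j.
by rewrite (polarization i j sM) (polarization i j sM') !h.
Qed.

Lemma gram_sym A : (A *m A^T)^T = A *m A^T.
Proof. by rewrite trmx_mul trmxK. Qed.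

(** At the constant 1 the inequality, read in both directions, makes the two
    quadratic forms proportional. *)
Lemma nearmx1_simil A B : (0 < m)%N -> A \in unitmx -> B \in unitmx -> nearmx 1 A B ->
  exists2 z, 0 < z & (invmx A *m B) *m (invmx A *m B)^T = z%:M.
Proof.
move=> m0 uA uB h; pose k := invmx A *m B.
have uk : k \in unitmx by rewrite unitmx_mul unitmx_inv uA.
pose e0 : 'rV[R]_m := delta_mx 0 (Ordinal m0).
have s1 : sqn e0 = 1.
  by rewrite /sqn trmx_delta mul_delta_mx mxE !eqxx.
have e00 : e0 != 0 by rewrite -sqn_eq0 s1 oner_neq0.
exists (sqn (e0 *m k)); first exact: sqn_gt0.
apply: quadratic_mx_eq; [exact: gram_sym | exact: tr_scalar_mx |] => x.
rewrite -sqn_mul mul_mx_scalar -scalemxAl mxE -/(sqn x).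
have := h (e0 *m invmx A) (x *m invmx A).
have := h (x *m invmx A) (e0 *m invmx A).
rewrite !mul1r !mulmxKV // s1 !mul1r -!mulmxA -/k => h1 h2.
by apply/eqP; rewrite mulrC eq_le h2 h1.
Qed.

Lemma sum_sqr_le (a : 'I_m -> R) : (\sum_i a i) ^+ 2 <= m%:R * \sum_i a i ^+ 2.
Proof.
rewrite expr2 mulr_suml.
have -> : m%:R * (\sum_i a i ^+ 2) = \sum_i \sum_j (a i ^+ 2 + a j ^+ 2) / 2.
  under [RHS]eq_bigr => i _ do rewrite -mulr_suml big_split /= sumr_const card_ord.
  rewrite -mulr_suml big_split /= sumr_const card_ord sumrMnl -mulr_natl.
  by field.
apply: ler_sum => i _; rewrite mulr_sumr; apply: ler_sum => j _.
by have := sqr_ge0 (a i - a j); nra.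
Qed.

(** A matrix with small entries has small operator norm. *)
Lemma sqn_small (e : R) M x : (forall i j, `|M i j| <= e) ->
  sqn (x *m M) <= (m%:R * e) ^+ 2 * sqn x.
Proof.
move=> h; rewrite sqnE.
have -> : (m%:R * e) ^+ 2 * sqn x = \sum_(j < m) m%:R * (e ^+ 2 * sqn x).
  by rewrite sumr_const card_ord -[RHS]mulr_natl; ring.
apply: ler_sum => j _; rewrite mxE; apply: le_trans (sum_sqr_le _) _.
apply: ler_wpM2l => //; rewrite sqnE mulr_sumr; apply: ler_sum => i _.
rewrite exprMn mulrC ler_wpM2r ?sqr_ge0 // -[M i j ^+ 2]real_normK ?num_real //.
by rewrite lerXn2r ?nnegrE // (le_trans _ (h i j)).
Qed.

End Gram.

Section MatrixLimits.
Context (R : realType) (T : Type) (F : set_system T) {FF : Filter F}.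

Lemma cvg_eqE (U : topologicalType) (f g : T -> U) (a b : U) : f =1 g -> a = b ->
  g t @[t --> F] --> b -> f t @[t --> F] --> a.
Proof. by move=> /funext -> ->. Qed.

Lemma cvg_matrixP k l (B : T -> 'M[R]_(k, l)) (A : 'M[R]_(k, l)) :
  (B t @[t --> F] --> A) <-> (forall i j, B t i j @[t --> F] --> A i j).
Proof.
split=> [h i j|h W [P nP PW]].
  apply: (@continuous_cvg _ _ _ F FF B (fun M : 'M[R]_(k, l) => M i j)) => //.
  exact: coord_continuous.
have : \forall t \near F, forall i j, P i j (B t i j).
  apply: filter_forall => i; apply: filter_forall => j.
  exact: (h i j _ (nP i j)).
by apply: filterS => t Pt; exact: PW.
Qed.

Lemma cvg_sumr (I : Type) (r : seq I) (P : pred I) (f : I -> T -> R) (a : I -> R) :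
  (forall i, P i -> f i t @[t --> F] --> a i) ->
  \sum_(i <- r | P i) f i t @[t --> F] --> \sum_(i <- r | P i) a i.
Proof. by apply: cvg_big; exact: add_continuous. Qed.

Lemma cvg_prodr (I : Type) (r : seq I) (P : pred I) (f : I -> T -> R) (a : I -> R) :
  (forall i, P i -> f i t @[t --> F] --> a i) ->
  \prod_(i <- r | P i) f i t @[t --> F] --> \prod_(i <- r | P i) a i.
Proof. by apply: cvg_big; exact: mul_continuous. Qed.

Lemma cvg_mulmx k l m (B : T -> 'M[R]_(k, l)) (B' : T -> 'M[R]_(l, m))
    (A : 'M[R]_(k, l)) (A' : 'M[R]_(l, m)) :
  B t @[t --> F] --> A -> B' t @[t --> F] --> A' ->
  B t *m B' t @[t --> F] --> A *m A'.
Proof.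
move=> /cvg_matrixP h /cvg_matrixP h'; apply/cvg_matrixP => i j.
apply: (cvg_eqE (fun t => mxE _ _ i j) (mxE _ _ i j)).
by apply: cvg_sumr => u _; apply: cvgM; [exact: h | exact: h'].
Qed.

Lemma cvg_trmx k l (B : T -> 'M[R]_(k, l)) (A : 'M[R]_(k, l)) :
  B t @[t --> F] --> A -> (B t)^T @[t --> F] --> A^T.
Proof.
move=> /cvg_matrixP h; apply/cvg_matrixP => i j.
by apply: (cvg_eqE (fun t => mxE _ _ i j) (mxE _ _ i j)); exact: h.
Qed.

Lemma cvg_block_mx k1 k2 l1 l2 (B1 : T -> 'M[R]_(k1, l1)) (B2 : T -> 'M[R]_(k1, l2))
    (B3 : T -> 'M[R]_(k2, l1)) (B4 : T -> 'M[R]_(k2, l2))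
    (A1 : 'M[R]_(k1, l1)) (A2 : 'M[R]_(k1, l2)) (A3 : 'M[R]_(k2, l1)) (A4 : 'M[R]_(k2, l2)) :
  B1 t @[t --> F] --> A1 -> B2 t @[t --> F] --> A2 ->
  B3 t @[t --> F] --> A3 -> B4 t @[t --> F] --> A4 ->
  block_mx (B1 t) (B2 t) (B3 t) (B4 t) @[t --> F] --> block_mx A1 A2 A3 A4.
Proof.
move=> /cvg_matrixP h1 /cvg_matrixP h2 /cvg_matrixP h3 /cvg_matrixP h4.
apply/cvg_matrixP => i j; rewrite -(splitK i) -(splitK j).
case: (fintype.split i) => i' /=; case: (fintype.split j) => j' /=.
- by apply: (cvg_eqE (fun t => block_mxEul _ _ _ _ i' j') (block_mxEul _ _ _ _ i' j')); exact: h1.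
- by apply: (cvg_eqE (fun t => block_mxEur _ _ _ _ i' j') (block_mxEur _ _ _ _ i' j')); exact: h2.
- by apply: (cvg_eqE (fun t => block_mxEdl _ _ _ _ i' j') (block_mxEdl _ _ _ _ i' j')); exact: h3.
- by apply: (cvg_eqE (fun t => block_mxEdr _ _ _ _ i' j') (block_mxEdr _ _ _ _ i' j')); exact: h4.
Qed.

Lemma cvg_det m (B : T -> 'M[R]_m) (A : 'M[R]_m) :
  B t @[t --> F] --> A -> \det (B t) @[t --> F] --> \det A.
Proof.
move=> /cvg_matrixP h; apply: cvg_sumr => s _; apply: cvgM; first exact: cvg_cst.
by apply: cvg_prodr => i _.
Qed.

Lemma cvg_invmx m (B : T -> 'M[R]_m) (A : 'M[R]_m) : A \in unitmx ->
  (\forall t \near F, B t \in unitmx) ->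
  B t @[t --> F] --> A -> invmx (B t) @[t --> F] --> invmx A.
Proof.
move=> uA uB h.
have dA : \det A != 0 by rewrite unitmxE unitfE in uA.
have hd := cvg_det h.
have : (\det (B t))^-1 *: \adj (B t) @[t --> F] --> (\det A)^-1 *: \adj A.
  apply/cvg_matrixP => i j.
  apply: (cvg_eqE (fun t => mxE _ _ i j) (mxE _ _ i j)); apply: cvgM; first exact: cvgV.
  apply: (cvg_eqE (fun t => mxE _ _ i j) (mxE _ _ i j)).
  apply: cvgM; first exact: cvg_cst.
  apply: cvg_det; apply/cvg_matrixP => i' j'; rewrite /row' /col'.
  apply: (@cvg_eqE _ _ (fun t => B t (lift j i') (lift i j')) _ (A (lift j i') (lift i j')));
    [by move=> t; rewrite !mxE | by rewrite !mxE |].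
  by move/cvg_matrixP: h; apply.
rewrite {2}/invmx uA; apply: cvg_trans; apply: near_eq_cvg.
by near do rewrite /invmx ifT //.
Unshelve. all: by end_near. Qed.

Lemma near_matrix_small m (B : T -> 'M[R]_m) (A : 'M[R]_m) (e : R) : 0 < e -> A \in unitmx ->
  B t @[t --> F] --> A ->
  \forall t \near F, forall i j, `|(invmx A *m B t - 1%:M) i j| <= e.
Proof.
move=> e0 uA h.
have h' : invmx A *m B t @[t --> F] --> (1%:M : 'M[R]_m).
  by rewrite -(mulVmx uA); apply: cvg_mulmx => //; exact: cvg_cst.
apply: filter_forall => i; apply: filter_forall => j.
move/cvg_matrixP: h' => /(_ i j)/cvgrPdist_le/(_ _ e0); apply: filterS => t /=.
have D (U V : 'M[R]_m) : (U - V) i j = U i j - V i j by rewrite !mxE.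
by rewrite D distrC.
Qed.

End MatrixLimits.

Section Perturbation.
Context (R : realType) (m : nat).
Implicit Types (u w x : 'rV[R]_m) (A B M : 'M[R]_m).

Lemma sqn_perturb (t : R) u w : 0 < t -> sqn w <= t ^+ 2 * sqn u ->
  (1 - 2 * t) * sqn u <= sqn (u + w) <= (1 + t) ^+ 2 * sqn u.
Proof.
move=> t0 h.
have hi : sqn (u + w) <= (1 + t) * sqn u + (1 + t^-1) * sqn w.
  rewrite !sqnE !mulr_sumr -big_split; apply: ler_sum => i _; rewrite mxE.
  move: (u 0 i) (w 0 i) => a b /=.
  have : 0 <= (t * a - b) ^+ 2 * t^-1 by rewrite mulr_ge0 ?sqr_ge0 // invr_ge0 ltW.
  have -> : (t * a - b) ^+ 2 * t^-1 = t * a ^+ 2 - 2 * a * b + t^-1 * b ^+ 2.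
    by field; exact: lt0r_neq0.
  by lra.
have lo : (1 - t) * sqn u + (1 - t^-1) * sqn w <= sqn (u + w).
  rewrite !sqnE !mulr_sumr -big_split; apply: ler_sum => i _; rewrite mxE.
  move: (u 0 i) (w 0 i) => a b /=.
  have : 0 <= (t * a + b) ^+ 2 * t^-1 by rewrite mulr_ge0 ?sqr_ge0 // invr_ge0 ltW.
  have -> : (t * a + b) ^+ 2 * t^-1 = t * a ^+ 2 + 2 * a * b + t^-1 * b ^+ 2.
    by field; exact: lt0r_neq0.
  by lra.
have h' : t^-1 * sqn w <= t * sqn u.
  have := ler_wpM2l (ltW (_ : 0 < t^-1)) h; rewrite invr_gt0 => /(_ t0).
  by rewrite expr2 !mulrA mulVf ?lt0r_neq0 // mul1r.
have w0 := sqn_ge0 w; have u0 := sqn_ge0 u.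
by apply/andP; split; nra.
Qed.

Lemma perturb_unit (t : R) M : 0 < t -> t < 2^-1 ->
  (forall x, sqn (x *m M) <= t ^+ 2 * sqn x) -> 1%:M + M \in unitmx.
Proof.
move=> t0 t2 h; rewrite unitmxE unitfE; apply/negP => /det0P [v v0 vM].
have := @sqn_perturb t v (v *m M) t0 (h v).
have -> : v + v *m M = 0 by rewrite -vM mulmxDr mulmx1.
rewrite sqn0 => /andP[+ _].
have : 0 < sqn v by rewrite lt0r sqn_ge0 sqn_eq0 v0.
by nra.
Qed.

(** The relative difference M is small in operator norm, so that lengths
    change by a factor close to 1, and no nonzero vector is killed. *)
Lemma perturb_near (t : R) A M : 0 < t -> t < 2^-1 ->
  (forall i j, `|M i j| <= t / m.+1%:R) ->
  nearmx ((1 + t) ^+ 2 / (1 - 2 * t)) A (A *m (1%:M + M)) /\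
  forall r, 0 <= r <= 1 -> 1%:M + r *: M \in unitmx.
Proof.
move=> t0 t2 h.
have small M' : (forall i j, `|M' i j| <= t / m.+1%:R) ->
    forall x, sqn (x *m M') <= t ^+ 2 * sqn x.
  move=> hM x; apply: le_trans (sqn_small x hM) _.
  apply: ler_wpM2r; first exact: sqn_ge0.
  have b0 : 0 <= m%:R * (t / m.+1%:R).
    by rewrite mulr_ge0 ?ler0n // divr_ge0 ?ler0n // ltW.
  have b1 : m%:R * (t / m.+1%:R) <= t.
    by rewrite mulrCA ger_pMr // ler_pdivrMr ?ltr0n // mul1r ler_nat.
  by rewrite lerXn2r ?nnegrE // ltW.
split=> [x y|r /andP[r0 r1]]; last first.
  apply: (perturb_unit t0 t2); apply: small => i j; rewrite mxE normrM ger0_norm //.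
  by apply: le_trans (h i j); rewrite ler_piMl.
have Dx z : z *m (A *m (1%:M + M)) = z *m A + z *m A *m M.
  by rewrite mulmxA mulmxDr mulmx1.
rewrite !Dx.
have /andP[x1 x2] := @sqn_perturb t (x *m A) _ t0 (small _ h (x *m A)).
have /andP[y1 y2] := @sqn_perturb t (y *m A) _ t0 (small _ h (y *m A)).
have d0 : 0 < 1 - 2 * t by lra.
apply: le_trans (ler_wpM2l (sqn_ge0 _) y2) _.
have x1' : sqn (x *m A) <= sqn (x *m A + x *m A *m M) / (1 - 2 * t).
  by rewrite ler_pdivlMr // mulrC.
apply: le_trans (ler_wpM2r _ x1') _; first by rewrite mulr_ge0 ?sqr_ge0 ?sqn_ge0.
by rewrite le_eqVlt; apply/orP; left; apply/eqP; ring.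
Qed.

Lemma perturb_const (C : R) : 1 < C ->
  exists t : R, [/\ 0 < t, t < 2^-1 & (1 + t) ^+ 2 / (1 - 2 * t) <= C].
Proof.
move=> C1; exists (Num.min (1/10) ((C - 1) / 10)).
set t := Num.min _ _.
have t0 : 0 < t by rewrite lt_min; apply/andP; split; lra.
have t1 : t <= 1 / 10 by rewrite ge_min lexx.
have t2 : t <= (C - 1) / 10 by rewrite ge_min lexx orbT.
split=> //; first by lra.
rewrite ler_pdivrMr; last by lra.
by nra.
Qed.

End Perturbation.

(** * Cholesky factors *)

Section Cholesky.
Context (R : realType).

Fixpoint chol m : 'M[R]_m -> 'M[R]_m :=
  match m with
  | 0 => fun p => p
  | k.+1 => fun p : 'M[R]_(1 + k) =>
      let a := Num.sqrt (p 0 0) in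
      block_mx a%:M 0 (a^-1 *: dlsubmx p)
        (chol (drsubmx p - (p 0 0)^-1 *: (dlsubmx p *m ursubmx p))) : 'M[R]_(1 + k)
  end.

Definition posdef m (p : 'M[R]_m) : Prop :=
  p^T = p /\ forall x : 'rV[R]_m, x != 0 -> 0 < (x *m p *m x^T) 0 0.

Lemma posdef_gram m (A : 'M[R]_m) : A \in unitmx -> posdef (A *m A^T).
Proof.
move=> uA; split; first exact: gram_sym.
by move=> x x0; rewrite -sqn_mul; exact: sqn_gt0.
Qed.

Lemma posdef_scale m (c : R) (p : 'M[R]_m) : 0 < c -> posdef p -> posdef (c *: p).
Proof.
move=> c0 [sp pp]; split; first by rewrite linearZ /= sp.
by move=> x x0; rewrite -scalemxAr -scalemxAl mxE mulr_gt0 // pp.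
Qed.

Lemma block11 k (p : 'M[R]_(1 + k)) : ulsubmx p = (p 0 0)%:M.
Proof.
apply/matrixP => i j; rewrite !ord1 !mxE eqxx mulr1n.
by congr (p _ _); apply/val_inj.
Qed.

(** The Schur complement is the restriction of the form to the orthogonal of
    the first basis vector. *)
Lemma posdef_schur k (p : 'M[R]_(1 + k)) : posdef p ->
  [/\ 0 < p 0 0, ursubmx p = (dlsubmx p)^T &
      posdef (drsubmx p - (p 0 0)^-1 *: (dlsubmx p *m ursubmx p))].
Proof.
move=> [sp pp].
have ur : ursubmx p = (dlsubmx p)^T by rewrite -[in LHS]sp -trmx_dlsub.
have dr : (drsubmx p)^T = drsubmx p by rewrite -[in RHS]sp trmx_drsub.
have pE : p = block_mx (p 0 0)%:M (ursubmx p) (dlsubmx p) (drsubmx p).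
  by rewrite -block11 submxK.
have quad (a : R) (x : 'rV[R]_k) :
    (row_mx a%:M x *m p *m (row_mx a%:M x)^T) 0 0 =
    a ^+ 2 * p 0 0 + 2 * a * (x *m dlsubmx p) 0 0 + (x *m drsubmx p *m x^T) 0 0.
  have D (u v : 'M[R]_1) i j : (u + v) i j = u i j + v i j by rewrite mxE.
  rewrite {1}pE mul_row_block tr_row_mx mul_row_col tr_scalar_mx mulmxDl !D.
  rewrite mulmxDl D -!scalar_mxM !mul_mx_scalar !mul_scalar_mx.
  rewrite ur -scalemxAl -[a *: ((dlsubmx p)^T *m x^T)]/(a *: _) -trmx_mul.
  have Z (c : R) (u : 'M[R]_1) i j : (c *: u) i j = c * u i j by rewrite mxE.
  have Tr (u : 'M[R]_1) i j : u^T i j = u j i by rewrite mxE.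
  have Sc (c : R) : (c%:M : 'M[R]_1) 0 0 = c by rewrite mxE eqxx.
  by rewrite !Z Tr Sc; ring.
have p0 : 0 < p 0 0.
  have := pp (row_mx 1%:M 0); rewrite quad !mul0mx !mxE !mulr0 !addr0 expr1n mul1r; apply.
  apply/eqP => /rowP/(_ (lshift _ 0)); rewrite row_mxEl !mxE eqxx => /eqP.
  by rewrite oner_eq0.
split=> //; split.
  by rewrite linearB /= dr linearZ /= ur trmx_mul trmxK.
move=> x x0; have := pp (row_mx (- (x *m dlsubmx p) 0 0 / p 0 0)%:M x).
have -> : row_mx (- (x *m dlsubmx p) 0 0 / p 0 0)%:M x != 0.
  by apply: contra_neq x0 => /eqP; rewrite row_mx_eq0 => /andP[_ /eqP].
move=> /(_ isT); rewrite quad; congr (0 < _).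
rewrite mulmxBr mulmxBl.
have D (u v : 'M[R]_1) i j : (u - v) i j = u i j - v i j by rewrite !mxE.
have Z (c : R) (u : 'M[R]_1) i j : (c *: u) i j = c * u i j by rewrite mxE.
have Tr (u : 'M[R]_1) : (u *m u^T) 0 0 = u 0 0 * u 0 0.
  by rewrite mxE big_ord1 mxE.
have E : x *m (dlsubmx p *m (dlsubmx p)^T) *m x^T = (x *m dlsubmx p) *m (x *m dlsubmx p)^T.
  by rewrite trmx_mul !mulmxA.
rewrite D -scalemxAr -scalemxAl Z ur E Tr.
by field; exact: lt0r_neq0.
Qed.

Lemma chol_gram m (p : 'M[R]_m) : posdef p -> chol p *m (chol p)^T = p.
Proof.
elim: m p => [|k IH] p pp; first by apply/matrixP => -[].
have [p0 ur ps] := posdef_schur pp.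
pose B : 'M[R]_(1 + k) := block_mx (Num.sqrt (p 0 0))%:M 0
  ((Num.sqrt (p 0 0))^-1 *: dlsubmx (p : 'M[R]_(1 + k)))
  (chol (drsubmx (p : 'M[R]_(1 + k)) -
     (p 0 0)^-1 *: (dlsubmx (p : 'M[R]_(1 + k)) *m ursubmx (p : 'M[R]_(1 + k))))).
suff : B *m B^T = p by [].
rewrite /B tr_block_mx mulmx_block.
rewrite !trmx0 !mulmx0 !mul0mx !addr0 tr_scalar_mx -scalar_mxM -expr2 sqr_sqrtr ?ltW //.
have s0 : Num.sqrt (p 0 0) != 0 by rewrite sqrtr_eq0 -ltNge.
rewrite linearZ /= mul_scalar_mx scalerA mulfV // scale1r -ur.
rewrite mul_mx_scalar scalerA mulfV // scale1r IH //.
rewrite -scalemxAl -scalemxAr scalerA -invfM -expr2 sqr_sqrtr ?ltW //.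
by rewrite addrC subrK -block11 submxK.
Qed.

Lemma chol1 m : chol (1%:M : 'M[R]_m) = 1%:M.
Proof.
elim: m => [|k IH]; first by apply/matrixP => -[].
rewrite /= (scalar_mx_block 1 k 1) block_mxKdl block_mxKdr block_mxKur.
have -> : (block_mx 1%:M 0 0 1%:M : 'M[R]_(1 + k)) 0 0 = 1.
  by rewrite -scalar_mx_block mxE eqxx.
by rewrite mulmx0 !scaler0 subr0 IH sqrtr1.
Qed.

Lemma chol_unit m (p : 'M[R]_m) : posdef p -> chol p \in unitmx.
Proof.
move=> pp; rewrite unitmxE unitfE; apply/negP => /det0P [v v0 vc].
have := pp.2 v v0; rewrite -(chol_gram pp) mulmxA vc !mul0mx mxE ltxx //.
Qed.

(** The Cholesky factor is a continuous section of A |-> A A^T. *)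
Lemma cvg_chol (T : Type) (F : set_system T) {FF : Filter F} m (q : T -> 'M[R]_m) p :
  posdef p -> q t @[t --> F] --> p -> chol (q t) @[t --> F] --> chol p.
Proof.
elim: m q p => [|k IH] q p pp h; first exact: h.
have [p0 ur ps] := posdef_schur pp.
have hij i j : q t i j @[t --> F] --> p i j by move/cvg_matrixP: h; apply.
have hs : Num.sqrt (q t 0 0) @[t --> F] --> Num.sqrt (p 0 0).
  by apply: (@continuous_cvg _ _ _ F FF (fun t => q t 0 0) (@Num.sqrt R));
    [exact: sqrt_continuous | exact: hij].
have s0 : Num.sqrt (p 0 0) != 0 by rewrite sqrtr_eq0 -ltNge.
have hsub a b (f : 'I_a -> 'I_(1 + k)) (g : 'I_b -> 'I_(1 + k)) (r : T -> 'M[R]_(a, b))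
    (r' : 'M[R]_(a, b)) : (forall t i j, r t i j = q t (f i) (g j)) -> (forall i j, r' i j = p (f i) (g j)) ->
    r t @[t --> F] --> r'.
  move=> rE r'E; apply/cvg_matrixP => i j.
  by apply: (cvg_eqE (fun t => rE t i j) (r'E i j)); exact: hij.
have hdl : dlsubmx (q t : 'M[R]_(1 + k)) @[t --> F] --> dlsubmx (p : 'M[R]_(1 + k)).
  by apply: hsub => *; rewrite !mxE.
have hur : ursubmx (q t : 'M[R]_(1 + k)) @[t --> F] --> ursubmx (p : 'M[R]_(1 + k)).
  by apply: hsub => *; rewrite !mxE.
have hdr : drsubmx (q t : 'M[R]_(1 + k)) @[t --> F] --> drsubmx (p : 'M[R]_(1 + k)).
  by apply: hsub => *; rewrite !mxE.
have scale a b (c : T -> R) (c' : R) (r : T -> 'M[R]_(a, b)) (r' : 'M[R]_(a, b)) : c t @[t --> F] --> c' ->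
    r t @[t --> F] --> r' -> c t *: r t @[t --> F] --> c' *: r'.
  move=> hc /cvg_matrixP hr; apply/cvg_matrixP => i j.
  by apply: (cvg_eqE (fun t => mxE _ _ i j) (mxE _ _ i j)); apply: cvgM.
have hS : chol (drsubmx (q t : 'M[R]_(1 + k)) - (q t 0 0)^-1 *:
       (dlsubmx (q t : 'M[R]_(1 + k)) *m ursubmx (q t : 'M[R]_(1 + k)))) @[t --> F] -->
    chol (drsubmx (p : 'M[R]_(1 + k)) - (p 0 0)^-1 *:
       (dlsubmx (p : 'M[R]_(1 + k)) *m ursubmx (p : 'M[R]_(1 + k)))).
  apply: IH; first exact: ps.
  apply: cvgB; first exact: hdr.
  apply: scale; last exact: cvg_mulmx.
  by apply: cvgV; [rewrite lt0r_neq0 | exact: hij].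
have hl : (Num.sqrt (q t 0 0))^-1 *: dlsubmx (q t : 'M[R]_(1 + k)) @[t --> F] -->
    (Num.sqrt (p 0 0))^-1 *: dlsubmx (p : 'M[R]_(1 + k)).
  by apply: scale => //; exact: cvgV.
have h00 : (Num.sqrt (q t 0 0))%:M @[t --> F] --> ((Num.sqrt (p 0 0))%:M : 'M[R]_1).
  apply/cvg_matrixP => i j; rewrite !ord1.
  have S0 (c : R) : (c%:M : 'M[R]_1) 0 0 = c by rewrite mxE eqxx.
  exact: (cvg_eqE (fun t => S0 _) (S0 _)).
exact: (cvg_block_mx h00 (cvg_cst _) hl hS).
Qed.


End Cholesky.

(** * Lifting simplices *)

Section SimplexCovering.
Context (R : realType) (q : nat).
Local Notation Dq := (stdsimplex R q).

Lemma simplex_nbhs (x : Dq) (U : set Dq) : nbhs x U ->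
  exists2 W : set 'rV[R]_q.+1, nbhs (val x) W & forall y : Dq, W (val y) -> U y.
Proof.
case=> _ /= [[W oW <-] /= Wx sWU]; exists W; first exact: open_nbhs_nbhs.
by move=> y Wy; exact: sWU.
Qed.

Lemma simplex_nbhs_ball (x : Dq) (U : set Dq) : nbhs x U ->
  exists2 e : R, 0 < e & forall y : Dq, (forall i, `|val x 0 i - val y 0 i| < e) -> U y.
Proof.
move=> /simplex_nbhs [W /nbhs_ballP [e e0 eW] WU]; exists e => // y xy.
by apply: WU; apply: eW; split=> // i j; rewrite !ord1; exact: xy.
Qed.

Lemma simplex_nbhs_val (x : Dq) (W : set 'rV[R]_q.+1) : nbhs (val x) W ->
  \forall y \near x, W (val y).
Proof. exact: (@initial_continuous _ _ (@set_val _ (stdsimplex R q)) x W). Qed.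

Lemma simplex_compact : compact (stdsimplex R q).
Proof.
have K : compact [set v : 'rV[R]_q.+1 | forall i, (fun=> `[0, 1]%classic) i (v ord0 i)].
  by apply: (@rV_compact R _ (fun=> `[0, 1]%classic)) => i; exact: segment_compact.
apply: subclosed_compact K _; last first.
  move=> v [v0 v1] i /=; rewrite in_itv /= v0 /= -v1 (bigD1 i) //= lerDl.
  by apply: sumr_ge0 => j _; exact: v0.
have -> : stdsimplex R q = \bigcap_i [set v | 0 <= v 0 i] `&` [set v | \sum_i v 0 i = 1].
  by apply/seteqP; split=> v [h1 h2]; split=> // i; [move=> _; exact: h1|exact: (h1 i I)].
apply: closedI.
  apply: closed_bigI => i _.
  apply: (@closed_comp _ _ (fun v : 'rV[R]_q.+1 => v 0 i) [set r | 0 <= r]).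
    by move=> v _; exact: coord_continuous.
  exact: closed_ge.
apply: (@closed_comp _ _ (fun v : 'rV[R]_q.+1 => \sum_i v 0 i) [set r | r = 1]).
  move=> v _; apply: (@cvg_sumr _ _ (nbhs v) _ _ _ _ (fun i (w : 'rV[R]_q.+1) => w 0 i)) => i _.
  exact: coord_continuous.
exact: closed_eq.
Qed.

(** Compactness of the simplex. *)
Lemma simplex_covering (I : Type) (F : set_system I) {FF : Filter F} (Pr : I -> Dq -> Prop) :
  (forall x : Dq, \forall x' \near x & i \near F, Pr i x') ->
  \forall i \near F, forall x, Pr i x.
Proof.
move=> h; have /compact_near_coveringP := simplex_compact.
move=> /(_ I F (fun i v => forall hv : v \in stdsimplex R q, Pr i (exist _ v hv)) FF).
move=> H; have : \near F, stdsimplex R q `<=` (fun v => forall hv : v \in stdsimplex R q,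
    Pr F (exist _ v hv)).
  apply: H => v vK; have hv := mem_set vK.
  have [[A B] /= [/simplex_nbhs [W nW WA] FB] AB] := h (exist _ v hv).
  exists (W, B) => // -[w i] /= [Ww Bi] hw.
  by apply: (AB (exist _ w hw, i)); split => //=; exact: WA.
apply: filterS => i Hi [v hv]; exact: (Hi v (set_mem hv) hv).
Qed.

End SimplexCovering.

(** Points h, h' with close 1 h h' are to be thought of as equal. Then P is a
    metric space, with the logarithm of the least C as distance, on which G
    acts by isometries, and Lift is the graph of an open map that is constant
    on the orbits of G and separates them. Proper discontinuity appears as
    lift_inj, with one radius for a whole fibre. *)
Section Lifting.
Context (R : realType) (X : topologicalType) (P G : Type).
Context (close : R -> P -> P -> Prop) (Lift : X -> P -> Prop) (act : G -> P -> P).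
Hypothesis close_refl : forall h, close 1 h h.
Hypothesis close_le : forall C C' h h', C <= C' -> close C h h' -> close C' h h'.
Hypothesis close_sym : forall C h h', close C h h' -> close C h' h.
Hypothesis close_trans : forall C C' h1 h2 h3, 0 <= C ->
  close C h1 h2 -> close C' h2 h3 -> close (C * C') h1 h3.
Hypothesis close_act : forall C g h h', close C h h' -> close C (act g h) (act g h').
Hypothesis lift_act : forall g z h, Lift z h -> Lift z (act g h).
Hypothesis lift_uniq : forall z h h', Lift z h -> Lift z h' ->
  exists g, close 1 (act g h) h'.
Hypothesis lift_inj : forall z h0, Lift z h0 -> exists2 C, 1 < C &
  forall h g, Lift z h -> close C h (act g h) -> forall h', close 1 h' (act g h').
Hypothesis lift_open : forall z h C, Lift z h -> 1 < C ->
  \forall z' \near z, exists2 h', Lift z' h' & close C h h'.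

Lemma close_root (C : R) : 1 < C -> exists2 D, 1 < D & D ^+ 16 <= C.
Proof.
have sq (c : R) : 1 < c -> exists2 d, 1 < d & d ^+ 2 <= c.
  move=> c1; exists (Num.sqrt c); last first.
    by rewrite sqr_sqrtr // ltW // (lt_trans ltr01).
  by rewrite -[ltLHS](@sqrtr1 R) ltr_sqrt // (lt_trans ltr01).
move=> /sq[c1 c11 h1]; have [c2 c21 h2] := sq _ c11.
have [c3 c31 h3] := sq _ c21; have [c4 c41 h4] := sq _ c31.
exists c4 => //; have p (a b : R) : 1 < a -> a ^+ 2 <= b -> 0 <= a.
  by move=> a1 _; rewrite ltW // (lt_trans ltr01).
have mono (a b : R) k : 1 < a -> a ^+ 2 <= b -> a ^+ (2 * k) <= b ^+ k.
  move=> a1 ab; rewrite exprM; apply: lerXn2r => //; rewrite nnegrE ?sqr_ge0 //.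
  by apply: le_trans ab; exact: sqr_ge0.
apply: le_trans (mono _ _ 8 c41 h4) _; apply: le_trans (mono _ _ 4 c31 h3) _.
by apply: le_trans (mono _ _ 2 c21 h2) _.
Qed.

Context (q : nat) (s : stdsimplex R q -> X) (s_cont : continuous s).
Hypothesis s_lift : forall x, exists h, Lift (s x) h.
Local Notation Dq := (stdsimplex R q).

(** The exponent 8 leaves room for the chain of comparisons through which two
    neighbouring lifts are related in approx_lift_step. *)
Lemma uniform_injectivity : exists2 E : R, 1 < E & forall x f g, Lift (s x) f ->
  close (E ^+ 8) f (act g f) -> forall h', close 1 h' (act g h').
Proof.
have : \forall E \near 1^'+, forall x f g, Lift (s x) f ->
  close (E ^+ 8) f (act g f) -> forall h', close 1 h' (act g h').
  apply: simplex_covering => x.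
  have [h xh] := s_lift x; have [C C1 hC] := lift_inj xh.
  have [D D1 DC] := close_root C1.
  exists ([set x' | exists2 h', Lift (s x') h' & close D h h'], [set E | 1 < E < D]).
    split=> /=; first by have := lift_open xh D1; exact: s_cont.
    by near=> E; apply/andP; split; near: E; [exact: nbhs_right_gt | exact: nbhs_right_lt].
  move=> [x' E] [/= [h' x'h' hh'] /andP[E1 ED]] f g x'f ff.
  have [g' g'f] := lift_uniq x'h' x'f.
  have D0 : 0 <= D by lra.
  have E0 : 0 <= E ^+ 8 by rewrite exprn_ge0 //; lra.
  have a1 : close (D * 1) (act g' h) f.
    by apply: close_trans g'f => //; exact: close_act.
  apply: (hC _ _ (lift_act g' xh)).
  apply: close_le (close_trans (mulr_ge0 D0 ler01) a1
    (close_trans E0 ff (close_act g (close_sym a1)))).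
  apply: le_trans DC; rewrite !mulr1.
  have E8 : E ^+ 8 <= D ^+ 8 by rewrite lerXn2r ?nnegrE //; lra.
  apply: le_trans (ler_wpM2l D0 (ler_wpM2r D0 E8)) _.
  rewrite -exprSr -exprS; apply: ler_weXn2l => //; exact: ltW.
move=> /(filterI (nbhs_right_gt 1)) /filter_ex [E [E1 hE]]; exists E => //.
Unshelve. all: by end_near. Qed.

(** By compactness, one modulus of continuity serves for lifting from all
    points of the simplex. *)
Lemma uniform_transport (E : R) : 1 < E -> exists2 e : R, 0 < e &
  forall x y : Dq, (forall i, `|val x 0 i - val y 0 i| < e) ->
  forall f, Lift (s x) f -> exists2 f', Lift (s y) f' & close (E ^+ 2) f f'.
Proof.
move=> E1; have E0 : 0 <= E by lra.
have : \forall e \near 0^'+, forall x y : Dq, (forall i, `|val x 0 i - val y 0 i| < e) ->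
  forall f, Lift (s x) f -> exists2 f', Lift (s y) f' & close (E ^+ 2) f f'.
  apply: simplex_covering => x; have [h xh] := s_lift x.
  have : \forall y \near x, exists2 h', Lift (s y) h' & close E h h'.
    by have := lift_open xh E1; exact: s_cont.
  move=> /simplex_nbhs_ball [r r0 hr].
  have r2 : 0 < r / 2 by lra.
  exists ([set y : Dq | forall i, `|val x 0 i - val y 0 i| < r / 2], [set e | 0 < e < r / 2]).
    split=> /=.
      have W : nbhs (val x) [set v : 'rV[R]_q.+1 | forall i, `|val x 0 i - v 0 i| < r / 2].
        apply/nbhs_ballP; exists (r / 2) => //= v [_ xv] i; exact: xv.
      exact: (simplex_nbhs_val W).
    by near=> e; apply/andP; split; near: e; [exact: nbhs_right_gt | exact: nbhs_right_lt].
  move=> [x' e] [/= xx' /andP[e0 er]] y x'y f x'f.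
  have [h1 x'h1 hh1] : exists2 h', Lift (s x') h' & close E h h'.
    by apply: hr => i; apply: lt_trans (xx' i) _; lra.
  have [h2 yh2 hh2] : exists2 h', Lift (s y) h' & close E h h'.
    apply: hr => i; have := xx' i; have := x'y i; rewrite !ltr_norml; lra.
  have [g gf] := lift_uniq x'h1 x'f.
  exists (act g h2); first exact: lift_act.
  have a1 := close_trans ler01 (close_sym gf)
    (close_trans E0 (close_act g (close_sym hh1)) (close_act g hh2)).
  by move: a1; rewrite mul1r -expr2.
move=> /(filterI (nbhs_right_gt 0)) /filter_ex [e [e0 he]]; by exists e.
Unshelve. all: by end_near. Qed.

(** Straight scaling of the simplex towards a vertex, through which lifts are
    extended in small steps. *)
Definition vertex_vec : 'rV[R]_q.+1 := delta_mx 0 0.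

Lemma vertex_simplex : vertex_vec \in stdsimplex R q.
Proof.
apply/mem_set; split=> [i|]; first by rewrite mxE; case: (_ && _).
rewrite (bigD1 0) //= big1 ?addr0 ?mxE ?eqxx // => i i0.
by rewrite mxE (negPf i0) andbF.
Qed.

Definition vertex : Dq := exist _ vertex_vec vertex_simplex.

Definition scaling_vec (t : R) (x : Dq) : 'rV[R]_q.+1 :=
  vertex_vec + t *: (val x - vertex_vec).

Lemma scaling_simplex t x : 0 <= t <= 1 -> scaling_vec t x \in stdsimplex R q.
Proof.
move=> /andP[t0 t1]; have [x0 x1] := set_mem (valP x).
have [v0 v1] := set_mem vertex_simplex.
have E i : scaling_vec t x 0 i = (1 - t) * vertex_vec 0 i + t * val x 0 i.
  by rewrite !mxE; ring.
apply/mem_set; split=> [i|].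
  by rewrite E addr_ge0 // mulr_ge0 // subr_ge0.
under eq_bigr => i _ do rewrite E.
by rewrite big_split /= -!mulr_sumr v1 x1 !mulr1 subrK.
Qed.

Definition scaling (t : R) (x : Dq) : Dq := insubd x (scaling_vec t x).

Lemma val_scaling t x : 0 <= t <= 1 -> val (scaling t x) = scaling_vec t x.
Proof. by move=> t01; rewrite /scaling val_insubd scaling_simplex. Qed.

Lemma scaling_continuous t : 0 <= t <= 1 -> continuous (scaling t).
Proof.
move=> t01 x U /simplex_nbhs_ball [r r0 hr].
have W : nbhs (val x) [set v : 'rV[R]_q.+1 | forall i, `|val x 0 i - v 0 i| < r].
  apply/nbhs_ballP; exists r => //= v [_ xv] i; exact: xv.
apply: filterS (simplex_nbhs_val W) => y xy; apply: hr => i.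
rewrite !val_scaling // !mxE.
rewrite (_ : _ - _ = t * (val x 0 i - val y 0 i)); last by ring.
rewrite normrM; apply: le_lt_trans (xy i); case/andP: t01 => t0 t1.
by rewrite ger0_norm // ler_piMl.
Qed.

Definition approx_lift (t : R) (f : Dq -> P) : Prop :=
  (forall x, Lift (s (scaling t x)) (f x)) /\
  forall (x : Dq) C, 1 < C -> \forall x' \near x, close C (f x) (f x').

(** Carry the lift over point by point. To see that the result is continuous
    at x, compare its value at x' with a lift close to its value at x: the
    two differ by an element of G that moves a point little, and which
    hence acts trivially. *)
Lemma approx_lift_step (E e t t' : R) f : 1 < E ->
  (forall x f g, Lift (s x) f -> close (E ^+ 8) f (act g f) -> forall h', close 1 h' (act g h')) ->
  (forall x y : Dq, (forall i, `|val x 0 i - val y 0 i| < e) ->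
     forall f, Lift (s x) f -> exists2 f', Lift (s y) f' & close (E ^+ 2) f f') ->
  0 <= t <= 1 -> 0 <= t' <= 1 -> `|t - t'| < e ->
  approx_lift t f -> exists f', approx_lift t' f'.
Proof.
move=> E1 inj tr t01 t'01 tt' [fl fc]; have E0 : 0 <= E by lra.
have /choice [f' f'P] : forall x, exists f', Lift (s (scaling t' x)) f' /\ close (E ^+ 2) (f x) f'.
  move=> x; have [|f' l c] := tr (scaling t x) (scaling t' x) _ (f x) (fl x); last by exists f'.
  move=> i; rewrite !val_scaling // !mxE.
  have [x0 x1] := set_mem (valP x); have [v0 v1] := set_mem vertex_simplex.
  have le1 (v : 'rV[R]_q.+1) : (forall i, 0 <= v 0 i) -> \sum_i v 0 i = 1 -> v 0 i <= 1.
    by move=> w0 <-; rewrite (bigD1 i) //= lerDl; apply: sumr_ge0.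
  rewrite (_ : _ - _ = (t - t') * (val x 0 i - vertex_vec 0 i)); last by rewrite !mxE; ring.
  rewrite normrM; apply: le_lt_trans tt'; rewrite ler_piMr // ler_norml.
  have := x0 i; have := v0 i; have := le1 _ x0 x1; have := le1 _ v0 v1.
  by move: (vertex_vec 0 i) (val x 0 i) => a b; lra.
exists f'; split=> [x|x C C1]; first by have [] := f'P x.
have [C' [C'1 C'C C'E]] : exists C', [/\ 1 < C', C' <= C & C' <= E].
  exists (Num.min C E); split; [by rewrite lt_min C1 | by rewrite ge_min lexx |].
  by rewrite ge_min lexx orbT.
have C'0 : 0 <= C' by lra.
have [lx cx] := f'P x.
have op := lift_open lx C'1.
have st : continuous (fun x => s (scaling t' x)).
  by move=> z; apply: (@continuous_comp _ _ _ (scaling t') s);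
    [exact: scaling_continuous | exact: s_cont].
have n1 : \forall x' \near (x : Dq), exists2 h', Lift (s (scaling t' x')) h' & close C' (f' x) h'.
  exact: st x _ op.
have n2 : \forall x' \near (x : Dq), close E (f x) (f x') by exact: fc.
apply: (@filterS2 _ (nbhs (x : Dq)) _ _ _ _ _ n1 n2) => x' [h'' lh'' ch''] ff'.
have [lx' cx'] := f'P x'.
have [g gh] := lift_uniq lh'' lx'.
have E2 : 0 <= E ^+ 2 by exact: sqr_ge0.
have big : close (C' * (1 * (E ^+ 2 * (E * E ^+ 2)))) (act g (f' x)) (f' x).
  apply: close_trans (close_act g ch'') _ => //.
  apply: close_trans gh _ => //.
  apply: close_trans (close_sym cx') _ => //.
  by apply: close_trans (close_sym ff') cx.
have triv := inj _ _ g lx.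
have trivg : forall h', close 1 h' (act g h').
  apply: triv; apply: close_sym; apply: close_le big.
  rewrite mul1r -exprS -exprD; apply: le_trans (ler_wpM2r _ C'E) _.
    exact: exprn_ge0.
  by rewrite -exprS; apply: ler_weXn2l => //; exact: ltW.
have := close_trans C'0 ch'' (close_trans ler01 (trivg h'') gh).
by rewrite !mulr1; exact: close_le.
Qed.

(** Scaling by 0 is constant, so its composite with s has a constant lift;
    raise the factor to 1 in small steps. *)
Theorem approximate_lift : exists f : Dq -> P, (forall x, Lift (s x) (f x)) /\
  forall (x : Dq) C, 1 < C -> \forall x' \near x, close C (f x) (f x').
Proof.
have [E E1 inj] := uniform_injectivity.
have [e e0 tr] := uniform_transport E1.
pose m := (Num.truncn e^-1).+1.
have m0 : 0 < (m%:R : R) by rewrite ltr0n.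
have me : (m%:R : R)^-1 < e.
  rewrite invf_plt ?posrE //; have := truncn_itv (ltW (_ : 0 < e^-1)).
  by rewrite invr_gt0 => /(_ e0)/andP[].
have tk k : (k <= m)%N -> 0 <= (k%:R / m%:R : R) <= 1.
  move=> km; rewrite divr_ge0 ?ler0n //= ler_pdivrMr // mul1r ler_nat //.
have main k : (k <= m)%N -> exists f, approx_lift (k%:R / m%:R) f.
  elim: k => [_|k IH km].
    have [h h0] := s_lift vertex; exists (fun=> h); split=> [x|x C C1].
      rewrite (_ : scaling _ x = vertex) //; apply/val_inj.
      by rewrite val_scaling ?tk // /scaling_vec mul0r scale0r addr0.
    have hh : close C h h by apply: close_le (close_refl h); exact: ltW.
    exact: (@filterE _ (nbhs (x : Dq)) _ (fun=> close C h h) (fun=> hh)).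
  have [f hf] := IH (ltnW km).
  apply: (approx_lift_step E1 inj tr (tk _ (ltnW km)) (tk _ km) _ hf).
  rewrite -mulrBl -natr1 opprD addrA subrr add0r mulN1r normrN gtr0_norm //.
  by rewrite invr_gt0.
have [f [fl fc]] := main m (leqnn m); exists f; split=> // x.
have := fl x; rewrite mulfV ?lt0r_neq0 // (_ : scaling 1 x = x) //.
by apply/val_inj; rewrite val_scaling ?ler01 ?lexx // /scaling_vec scale1r addrC subrK.
Qed.

End Lifting.

(** * The real group and its normal form *)

Section RealGroup.
Context (R : realType) (n : nat) (N : field_data R).
Local Notation S := (Sinf N).
Local Notation H := (Hinf n N).
Implicit Types h k : H.

Definition mulH h k : H := (mulinf h.1 k.1, mulinf h.2 k.2).
Definition invH h : H := (fun s => invmx (h.1 s), fun s => invmx (h.2 s)).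

Lemma H_eq h k : (forall s, h.1 s = k.1 s) -> (forall s, h.2 s = k.2 s) -> h = k.
Proof.
by case: h k => [h1 h2] [k1 k2] /= e1 e2; congr (_, _); apply/funext.
Qed.

Lemma mulHA h k l : mulH h (mulH k l) = mulH (mulH h k) l.
Proof. by apply: H_eq => s; rewrite /= /mulinf mulmxA. Qed.

Lemma mulH1 h : mulH h (oneHinf n N) = h.
Proof. by apply: H_eq => s; rewrite /= /mulinf /oneinf mulmx1. Qed.

Lemma mul1H h : mulH (oneHinf n N) h = h.
Proof. by apply: H_eq => s; rewrite /= /mulinf /oneinf mul1mx. Qed.

Lemma mulVH h : HR h -> mulH (invH h) h = oneHinf n N.
Proof. by move=> [h1 h2]; apply: H_eq => s; rewrite /= /mulinf mulVmx. Qed.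

Lemma mulHV h : HR h -> mulH h (invH h) = oneHinf n N.
Proof. by move=> [h1 h2]; apply: H_eq => s; rewrite /= /mulinf mulmxV. Qed.

Lemma HR_mul h k : HR h -> HR k -> HR (mulH h k).
Proof. by move=> [h1 h2] [k1 k2]; split=> s; rewrite unitmx_mul ?h1 ?h2 ?k1 ?k2. Qed.

Lemma HR_inv h : HR h -> HR (invH h).
Proof. by move=> [h1 h2]; split=> s; rewrite /= unitmx_inv. Qed.

Lemma HR_1 : HR (oneHinf n N).
Proof. by split=> s; exact: unitmx1. Qed.

Lemma iotaM h k s : iotainf (mulH h k) s = iotainf h s *m iotainf k s.
Proof. by rewrite /iotainf /= mulmx_block !mulmx0 !mul0mx !addr0 add0r. Qed.

Lemma iota1 s : iotainf (oneHinf n N) s = 1%:M.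
Proof. by rewrite /iotainf /= -scalar_mx_block. Qed.

Lemma iota_unit h s :
  (iotainf h s \in unitmx) = (h.1 s \in unitmx) && (h.2 s \in unitmx).
Proof. by rewrite /iotainf [LHS]unitmxE det_ublock unitrM -!unitmxE. Qed.

Lemma iota_unitE h : HR h <-> forall s, iotainf h s \in unitmx.
Proof.
split=> [[h1 h2] s|hu]; first by rewrite iota_unit h1 h2.
by split=> s; have := hu s; rewrite iota_unit => /andP[].
Qed.

Lemma iotaV h s : HR h -> iotainf (invH h) s = invmx (iotainf h s).
Proof.
move=> hh; have hu := (iota_unitE h).1 hh s.
by rewrite -[LHS](mulmxK hu) -iotaM mulVH // iota1 mul1mx.
Qed.

Lemma iota_inj h k : (forall s, iotainf h s = iotainf k s) -> h = k.
Proof.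
by move=> e; apply: H_eq => s; have /eq_block_mx [] := e s.
Qed.

Lemma cvgH (T : Type) (F : set_system T) {FF : Filter F} (f : T -> H) h :
  (forall s, (f t).1 s @[t --> F] --> h.1 s) ->
  (forall s, (f t).2 s @[t --> F] --> h.2 s) -> f t @[t --> F] --> h.
Proof.
move=> h1 h2; case: h h1 h2 => a b h1 h2.
have -> : f = (fun t => ((f t).1, (f t).2)) by apply/funext => t; case: (f t).
have c1 : (f t).1 @[t --> F] --> a by exact: ptws_cvg.
have c2 : (f t).2 @[t --> F] --> b by exact: ptws_cvg.
move=> W [[A B] /= [/c1 nA /c2 nB] AB].
apply: (@filterS2 _ F _ (fun t => A (f t).1) (fun t => B (f t).2)
  (fun t => W ((f t).1, (f t).2))) nA nB => t At Bt.
by apply: AB.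
Qed.

Lemma cvgH1 (T : Type) (F : set_system T) {FF : Filter F} (f : T -> H) h s :
  f t @[t --> F] --> h -> (f t).1 s @[t --> F] --> h.1 s.
Proof.
move=> fh; apply: (@continuous_cvg _ _ _ F FF (fun t => (f t).1) (fun g : infmx N n => g s)).
  exact: (@ptws_proj_continuous _ _ s).
exact: (cvg_comp _ _ fh cvg_fst).
Qed.

Lemma cvgH2 (T : Type) (F : set_system T) {FF : Filter F} (f : T -> H) h s :
  f t @[t --> F] --> h -> (f t).2 s @[t --> F] --> h.2 s.
Proof.
move=> fh; apply: (@continuous_cvg _ _ _ F FF (fun t => (f t).2) (fun g : infmx N n => g s)).
  exact: (@ptws_proj_continuous _ _ s).
exact: (cvg_comp _ _ fh cvg_snd).
Qed.

Lemma cvg_iota (T : Type) (F : set_system T) {FF : Filter F} (f : T -> H) h s :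
  f t @[t --> F] --> h -> iotainf (f t) s @[t --> F] --> iotainf h s.
Proof.
move=> fh; apply: cvg_block_mx; [exact: cvgH1|exact: cvg_cst|exact: cvg_cst|exact: cvgH2].
Qed.

Lemma cvg_mulH (T : Type) (F : set_system T) {FF : Filter F} (f g : T -> H) h k :
  f t @[t --> F] --> h -> g t @[t --> F] --> k ->
  mulH (f t) (g t) @[t --> F] --> mulH h k.
Proof.
move=> fh gk; apply: cvgH => s.
  by rewrite /mulH /mulinf /=; apply: cvg_mulmx; exact: cvgH1.
by rewrite /mulH /mulinf /=; apply: cvg_mulmx; exact: cvgH2.
Qed.

Lemma mulH_continuous h : continuous (mulH h).
Proof. by move=> k; apply: cvg_mulH; [exact: cvg_cst | exact: cvg_id]. Qed.

Lemma HR0_sub h : HR0 h -> HR h.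
Proof. exact: connected_component_sub. Qed.

Lemma HR0_group :
  (forall h k, HR0 h -> HR0 k -> HR0 (mulH h k)) /\ (forall h, HR0 h -> HR0 (invH h)).
Proof.
apply: (@unit_component_group _ (@HR R n N) _ mulH invH).
- exact: HR_inv.
- exact: HR_mul.
- exact: mulH1.
- exact: mulVH.
- by move=> h _; apply: continuous_subspaceT; exact: mulH_continuous.
Qed.

Lemma HR0_mul h k : HR0 h -> HR0 k -> HR0 (mulH h k).
Proof. by have [l _] := HR0_group; exact: l. Qed.

Lemma HR0_inv h : HR0 h -> HR0 (invH h).
Proof. by have [_ l] := HR0_group; exact: l. Qed.

Lemma LinfE h : Linf h <->
  HR h /\ forall s, exists2 z, 0 < z & iotainf h s *m (iotainf h s)^T = z%:M.
Proof.
split=> [[hh hK]|[hh hz]]; split=> // s.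
  have [z [k [z0 kk ->]]] := hK s; exists (z ^+ 2); first by rewrite exprn_even_gt0.
  by rewrite linearZ /= -scalemxAl -scalemxAr kk scalerA scalemx1.
have [z z0 zE] := hz s; have s0 : Num.sqrt z != 0 by rewrite sqrtr_eq0 -ltNge.
exists (Num.sqrt z), ((Num.sqrt z)^-1 *: iotainf h s); split=> //.
  rewrite linearZ /= -scalemxAl -scalemxAr zE scalerA -invfM -expr2 sqr_sqrtr ?ltW //.
  by rewrite scale_scalar_mx mulVf // lt0r_neq0.
by rewrite scalerA mulfV // scale1r.
Qed.

Lemma Linf_mul h k : Linf h -> Linf k -> Linf (mulH h k).
Proof.
move=> /LinfE[hh hz] /LinfE[kk kz]; apply/LinfE; split; first exact: HR_mul.
move=> s; have [z z0 zE] := hz s; have [w w0 wE] := kz s.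
exists (w * z); first exact: mulr_gt0.
rewrite iotaM trmx_mul mulmxA -[_ *m iotainf k s *m _]mulmxA wE.
by rewrite mul_mx_scalar -scalemxAl zE -scale_scalar_mx.
Qed.

Lemma Linf_inv h : Linf h -> Linf (invH h).
Proof.
move=> /LinfE[hh hz]; apply/LinfE; split; first exact: HR_inv.
move=> s; have [z z0 zE] := hz s; exists z^-1; first by rewrite invr_gt0.
have hu := (iota_unitE h).1 hh s.
have iE : invmx (iotainf h s) = z^-1 *: (iotainf h s)^T.
  have -> : z^-1 *: (iotainf h s)^T = invmx (iotainf h s) *m (z^-1 *: z%:M).
    by rewrite -zE -scalemxAr mulmxA mulVmx // mul1mx.
  by rewrite scale_scalar_mx mulVf ?lt0r_neq0 // mulmx1.
by rewrite iotaV // {2}iE linearZ /= trmxK -scalemxAr mulVmx // scalemx1.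
Qed.

Lemma Linf_1 : Linf (oneHinf n N).
Proof.
apply/LinfE; split; first exact: HR_1.
by move=> s; exists 1 => //; rewrite iota1 trmx1 mulmx1.
Qed.

Lemma Linf0_group :
  (forall h k, Linf0 h -> Linf0 k -> Linf0 (mulH h k)) /\ (forall h, Linf0 h -> Linf0 (invH h)).
Proof.
apply: (@unit_component_group _ (@Linf R n N) _ mulH invH).
- exact: Linf_inv.
- exact: Linf_mul.
- exact: mulH1.
- by move=> h /LinfE[hh _]; exact: mulVH.
- by move=> h _; apply: continuous_subspaceT; exact: mulH_continuous.
Qed.

Lemma Linf0_mul h k : Linf0 h -> Linf0 k -> Linf0 (mulH h k).
Proof. by have [l _] := Linf0_group; exact: l. Qed.

Lemma Linf0_inv h : Linf0 h -> Linf0 (invH h).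
Proof. by have [_ l] := Linf0_group; exact: l. Qed.

Lemma invHK h : HR h -> invH (invH h) = h.
Proof.
move=> hh; rewrite -[LHS]mulH1 -(mulVH hh) mulHA mulVH ?mul1H //; exact: HR_inv.
Qed.

Lemma Linf0_1 : Linf0 (oneHinf n N).
Proof. by apply: connected_component_refl; exact: Linf_1. Qed.

Lemma Linf0_sub h : Linf0 h -> Linf h.
Proof. exact: connected_component_sub. Qed.

Lemma Linf0_HR0 h : Linf0 h -> HR0 h.
Proof.
apply: (@connected_component_map _ _ (@Linf R n N) (@HR R n N) id).
  by apply: continuous_subspaceT => x; exact: cvg_id.
by move=> k [].
Qed.

Lemma Linf0_Kinf0 h : Linf0 h -> Kinf0 (iotainf h).
Proof.
move=> h0; rewrite /Kinf0 (_ : oneinf N (n + n) = iotainf (oneHinf n N)); last first.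
  by apply/funext => s; rewrite iota1.
move: h0; apply: connected_component_map; last by move=> k [].
apply: continuous_subspaceT => k; apply: ptws_cvg => s; apply: cvg_iota; exact: cvg_id.
Qed.

(** Closeness of the similarity classes of the quadratic forms h h^T, at all
    real places. *)
Definition closeH (C : R) h k : Prop := forall s, nearmx C (iotainf h s) (iotainf k s).

Lemma closeH_refl h : closeH 1 h h.
Proof. by move=> s; exact: nearmx_refl. Qed.

Lemma closeH_le C C' h k : C <= C' -> closeH C h k -> closeH C' h k.
Proof. by move=> CC hk s; exact: nearmx_le (hk s). Qed.

Lemma closeH_sym C h k : closeH C h k -> closeH C k h.
Proof. by move=> hk s; exact: nearmx_sym. Qed.

Lemma closeH_trans C C' h k l : 0 <= C -> HR k -> closeH C h k -> closeH C' k l ->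
  closeH (C * C') h l.
Proof.
move=> C0 kk hk kl s; apply: nearmx_trans (hk s) (kl s) => //.
exact: (iota_unitE k).1.
Qed.

Lemma closeH_mull C g h k : closeH C h k -> closeH C (mulH g h) (mulH g k).
Proof. by move=> hk s; rewrite !iotaM; exact: nearmx_mull. Qed.

Lemma closeH_Linf h k : Linf k -> closeH 1 h (mulH h k).
Proof.
move=> /LinfE[_ kz] s; have [z _ zE] := kz s; rewrite iotaM; exact: nearmx_mulr zE.
Qed.

Definition segment_H h k (r : R) : H :=
  (fun s => h.1 s + r *: (k.1 s - h.1 s), fun s => h.2 s + r *: (k.2 s - h.2 s)).

Lemma close_nbhs h (C : R) : HR h -> 1 < C -> \forall k \near h,
  closeH C h k /\ forall r, 0 <= r <= 1 -> HR (segment_H h k r).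
Proof.
move=> hh C1; have [t [t0 t2 tC]] := perturb_const C1.
have hu s := (iota_unitE h).1 hh s.
pose M k s := invmx (iotainf h s) *m iotainf k s - 1%:M.
have : \forall k \near h, forall s i j, `|M k s i j| <= t / (n + n).+1%:R.
  apply: (@filter_forall _ _ (fun s k => forall i j, `|M k s i j| <= t / (n + n).+1%:R) (nbhs h)) => s.
  apply: (@near_matrix_small _ _ (nbhs h)) => //; first by rewrite divr_gt0.
  by apply: cvg_iota; exact: cvg_id.
apply: (@filterS _ (nbhs h)) => k kM.
have kE s : iotainf k s = iotainf h s *m (1%:M + M k s).
  by rewrite /M addrC subrK mulmxA mulmxV // mul1mx.
have pn s := perturb_near (iotainf h s) t0 t2 (kM s).
split=> [s|r r01].
  by rewrite kE; have [hn _] := pn s; apply: nearmx_le hn.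
apply/iota_unitE => s; have [_ /(_ r r01) ur] := pn s.
suff -> : iotainf (segment_H h k r) s = iotainf h s *m (1%:M + r *: M k s).
  by rewrite unitmx_mul hu.
rewrite mulmxDr mulmx1 -scalemxAr /M mulmxBr mulmx1 mulmxA mulmxV // mul1mx.
rewrite /iotainf opp_block_mx add_block_mx scale_block_mx add_block_mx.
by rewrite !subr0 !scaler0 !addr0.
Qed.

(** Short segments stay inside the group, so its identity component is open. *)
Lemma HR0_nbhs h : HR0 h -> \forall k \near h, HR0 k.
Proof.
move=> h0; have h2 : (1 : R) < 2 by lra.
apply: (@filterS _ (nbhs h) _ _ _ _ (close_nbhs (HR0_sub h0) h2)) => k [_ seg].
apply: connected_component_trans h0 _.
have s0 : segment_H h k 0 = h by apply: H_eq => s /=; rewrite scale0r addr0.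
have s1 : segment_H h k 1 = k by apply: H_eq => s /=; rewrite scale1r addrC subrK.
exists (segment_H h k @` `[0, 1]%classic); last first.
  by exists 1 => //=; rewrite in_itv /= lexx ler01.
split.
- by exists 0 => //=; rewrite in_itv /= lexx ler01.
- by move=> _ [r /= r01 <-]; apply: seg; rewrite in_itv in r01.
apply: connected_continuous_connected; first exact: segment_connected.
apply: continuous_subspaceT => r.
have sc (A B : 'M[R]_n) : A + r' *: B @[r' --> r] --> A + r *: B.
  apply/cvg_matrixP => i j.
  have E x : (A + x *: B) i j = A i j + x * B i j by rewrite !mxE.
  apply: (cvg_eqE (fun x => E x) (E r)); apply: cvgD; first exact: cvg_cst.
  by apply: cvgM; [exact: cvg_id | exact: cvg_cst].
by apply: cvgH => s; exact: sc.
Qed.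

End RealGroup.

Section NormalForm.
Context (R : realType) (n : nat) (N : field_data R) (hn : (0 < n)%N).
Local Notation S := (Sinf N).
Local Notation H := (Hinf n N).
Implicit Types h k : H.

Let e1 : 'rV[R]_n := delta_mx 0 (Ordinal hn).
Let e0 : 'rV[R]_(n + n) := row_mx e1 0.

Lemma e0_neq0 : e0 != 0.
Proof.
apply/eqP => /rowP/(_ (lshift n (Ordinal hn))).
by rewrite row_mxEl !mxE !eqxx => /eqP; rewrite oner_eq0.
Qed.

(** The quadratic form of h, scaled to take the value 1 at a fixed vector. *)
Definition scale_of h s : R := (sqn (e0 *m iotainf h s))^-1.

Lemma scale_gt0 h s : HR h -> 0 < scale_of h s.
Proof.
move=> hh; rewrite invr_gt0; apply: sqn_gt0; last exact: e0_neq0.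
exact: (iota_unitE h).1.
Qed.

Definition normal_form h : H :=
  (fun s => chol (scale_of h s *: (h.1 s *m (h.1 s)^T)),
   fun s => chol (scale_of h s *: (h.2 s *m (h.2 s)^T))).

Lemma normal_posdef h s : HR h ->
  posdef (scale_of h s *: (h.1 s *m (h.1 s)^T)) /\
  posdef (scale_of h s *: (h.2 s *m (h.2 s)^T)).
Proof.
move=> hh; have c0 := scale_gt0 s hh; case: hh => h1 h2.
by split; apply: posdef_scale => //; apply: posdef_gram; [exact: h1 | exact: h2].
Qed.

Lemma normal_HR h : HR h -> HR (normal_form h).
Proof. by move=> hh; split=> s; apply: chol_unit; have [] := normal_posdef s hh. Qed.

Lemma iota_gram h s : iotainf h s *m (iotainf h s)^T =
  block_mx (h.1 s *m (h.1 s)^T) 0 0 (h.2 s *m (h.2 s)^T).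
Proof.
by rewrite /iotainf tr_block_mx mulmx_block !trmx0 !mulmx0 !mul0mx !addr0 add0r.
Qed.

Lemma normal_gram h s : HR h ->
  iotainf (normal_form h) s *m (iotainf (normal_form h) s)^T =
  scale_of h s *: (iotainf h s *m (iotainf h s)^T).
Proof.
move=> hh; have [p1 p2] := normal_posdef s hh.
by rewrite !iota_gram scale_block_mx !scaler0 !chol_gram.
Qed.

Lemma normal_Linf h : HR h -> Linf (mulH (invH h) (normal_form h)).
Proof.
move=> hh; apply/LinfE; split; first by apply: HR_mul; [exact: HR_inv | exact: normal_HR].
move=> s; exists (scale_of h s); first exact: scale_gt0.
have hu := (iota_unitE h).1 hh s.
rewrite iotaM iotaV // trmx_mul mulmxA -[_ *m _ *m (iotainf _ s)^T]mulmxA normal_gram //.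
rewrite -scalemxAr -scalemxAl mulmxA mulVmx // mul1mx -trmx_mul mulVmx // trmx1.
by rewrite scalemx1.
Qed.

Lemma normal_similar h s z : HR h -> 0 < z ->
  iotainf h s *m (iotainf h s)^T = z%:M -> iotainf (normal_form h) s = 1%:M.
Proof.
move=> hh z0 zE; have cz : scale_of h s = z^-1.
  rewrite /scale_of sqn_mul zE mul_mx_scalar -scalemxAl mxE -/(sqn e0).
  rewrite (_ : sqn e0 = 1) ?mulr1 //.
  rewrite /sqn tr_row_mx mul_row_col trmx0 mulmx0 addr0 trmx_delta mul_delta_mx.
  by rewrite mxE !eqxx.
have := zE; rewrite iota_gram (scalar_mx_block n n) => /eq_block_mx [a1 _ _ a2].
rewrite /iotainf /normal_form /= cz a1 a2 !scale_scalar_mx mulVf ?lt0r_neq0 // !chol1.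
by rewrite -scalar_mx_block.
Qed.

Lemma cvg_normal_gram (T : Type) (F : set_system T) {FF : Filter F} (f : T -> H) h :
  HR h -> (forall s, scale_of (f t) s *: (iotainf (f t) s *m (iotainf (f t) s)^T) @[t --> F]
    --> scale_of h s *: (iotainf h s *m (iotainf h s)^T)) ->
  normal_form (f t) @[t --> F] --> normal_form h.
Proof.
move=> hh fh.
have E k s : scale_of k s *: (iotainf k s *m (iotainf k s)^T) =
    block_mx (scale_of k s *: (k.1 s *m (k.1 s)^T)) 0 0 (scale_of k s *: (k.2 s *m (k.2 s)^T)).
  by rewrite iota_gram scale_block_mx !scaler0.
apply: cvgH => s /=; have [p1 p2] := normal_posdef s hh; apply: cvg_chol => //.
  apply/cvg_matrixP => i j; have /cvg_matrixP/(_ (lshift n i) (lshift n j)) := fh s.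
  have B k : (scale_of k s *: (iotainf k s *m (iotainf k s)^T)) (lshift n i) (lshift n j) =
    (scale_of k s *: (k.1 s *m (k.1 s)^T)) i j by rewrite E block_mxEul.
  by apply: cvg_eqE => [t|]; rewrite B.
apply/cvg_matrixP => i j; have /cvg_matrixP/(_ (rshift n i) (rshift n j)) := fh s.
have B k : (scale_of k s *: (iotainf k s *m (iotainf k s)^T)) (rshift n i) (rshift n j) =
  (scale_of k s *: (k.2 s *m (k.2 s)^T)) i j by rewrite E block_mxEdr.
by apply: cvg_eqE => [t|]; rewrite B.
Qed.

Lemma normal_continuous h : HR h -> {for h, continuous normal_form}.
Proof.
move=> hh; apply: cvg_normal_gram => // s.
have ci : iotainf k s @[k --> h] --> iotainf h s by apply: cvg_iota; exact: cvg_id.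
have cg : iotainf k s *m (iotainf k s)^T @[k --> h] --> iotainf h s *m (iotainf h s)^T.
  by apply: cvg_mulmx => //; exact: cvg_trmx.
have cs : scale_of k s @[k --> h] --> scale_of h s.
  apply: cvgV; first by rewrite -invr_eq0 lt0r_neq0 // scale_gt0.
  have Q k : sqn (e0 *m iotainf k s) =
    (e0 *m (iotainf k s *m (iotainf k s)^T) *m e0^T) 0 0 by rewrite sqn_mul.
  apply: (cvg_eqE Q (Q h)).
  have : e0 *m (iotainf k s *m (iotainf k s)^T) *m e0^T @[k --> h] -->
     e0 *m (iotainf h s *m (iotainf h s)^T) *m e0^T.
    apply: cvg_mulmx; last exact: cvg_cst.
    by apply: cvg_mulmx => //; exact: cvg_cst.
  by move/cvg_matrixP; apply.
apply/cvg_matrixP => i j; apply: (cvg_eqE (fun k => mxE _ _ i j) (mxE _ _ i j)).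
by apply: cvgM => //; move/cvg_matrixP: cg; apply.
Qed.

(** The normal form depends continuously on the similarity class only. *)
Lemma normal_cvg_close (T : Type) (F : set_system T) {FF : Filter F} (f : T -> H) h :
  HR h -> (forall t, HR (f t)) ->
  (forall C : R, 1 < C -> \forall t \near F, closeH C h (f t)) ->
  normal_form (f t) @[t --> F] --> normal_form h.
Proof.
move=> hh fh cl; apply: cvg_normal_gram => // s.
pose P k := scale_of k s *: (iotainf k s *m (iotainf k s)^T).
pose Q k x := scale_of k s * sqn (x *m iotainf k s).
have cQ x : Q (f t) x @[t --> F] --> Q h x.
  have [->|x0] := eqVneq x 0.
    have Q0 k : Q k 0 = 0 by rewrite /Q mul0mx sqn0 mulr0.
    by apply: (cvg_eqE (fun t => Q0 _) (Q0 h)); exact: cvg_cst.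
  have bound (C : R) k : HR k -> closeH C h k -> Q h x <= C * Q k x /\ Q k x <= C * Q h x.
    move=> kk hk; have := hk s x e0; have := closeH_sym hk s x e0; rewrite /Q /scale_of.
    have a0 := sqn_gt0 ((iota_unitE h).1 hh s) e0_neq0.
    have b0 := sqn_gt0 ((iota_unitE k).1 kk s) e0_neq0.
    move: a0 b0; set a := sqn _; set b := sqn _; set c := sqn _; set d := sqn _ => a0 b0 l1 l2.
    have ab0 : 0 < a * b by exact: mulr_gt0.
    split; rewrite -(ler_pM2l ab0).
      rewrite (_ : a * b * (a^-1 * d) = d * b); last by field; exact: lt0r_neq0.
      by rewrite (_ : a * b * (C * (b^-1 * c)) = C * (a * c)) //; field; exact: lt0r_neq0.
    rewrite (_ : a * b * (b^-1 * c) = c * a); last by field; exact: lt0r_neq0.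
    by rewrite (_ : a * b * (C * (a^-1 * d)) = C * (b * d)) //; field; exact: lt0r_neq0.
  apply/cvgrPdist_le => e e_gt0.
  have Qh0 : 0 < Q h x by rewrite mulr_gt0 ?scale_gt0 // sqn_gt0 // (iota_unitE h).1.
  pose C : R := 1 + e / (Q h x).
  have C1 : 1 < C by rewrite ltrDl divr_gt0.
  apply: filterS (cl C C1) => t hC; have [b1 b2] := bound _ _ (fh t) hC.
  have eE : e = (C - 1) * Q h x by rewrite /C addrC addKr divfK // lt0r_neq0.
  by rewrite ler_norml; nra.
have Pij k i j : P k i j = (Q k (delta_mx 0 i + delta_mx 0 j) - Q k (delta_mx 0 i)
    - Q k (delta_mx 0 j)) / 2.
  rewrite (polarization i j) /=; last by rewrite linearZ /= gram_sym.
  have QE x : (x *m P k *m x^T) 0 0 = Q k x.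
    by rewrite /P /Q -scalemxAr -scalemxAl mxE sqn_mul.
  by rewrite !QE.
apply/cvg_matrixP => i j; apply: (cvg_eqE (fun t => Pij (f t) i j) (Pij h i j)).
apply: cvgM; last exact: cvg_cst.
by apply: cvgB => //; exact: cvgB.
Qed.

Lemma normal_1 : normal_form (oneHinf n N) = oneHinf n N.
Proof.
apply: iota_inj => s; rewrite (@normal_similar _ s 1) ?iota1 //; first exact: HR_1.
by rewrite trmx1 mulmx1.
Qed.

(** The continuous map taking h to h^-1 times its normal form sends HR to Linf
    and fixes the unit, hence respects the identity components. *)
Lemma normal_Linf0 h : HR0 h -> Linf0 (mulH (invH h) (normal_form h)).
Proof.
move=> h0; have e : oneHinf n N = mulH (invH (oneHinf n N)) (normal_form (oneHinf n N)).
  by rewrite normal_1 mulVH //; exact: HR_1.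
rewrite /Linf0 {1}e.
apply: (@connected_component_map _ _ (@HR R n N) (@Linf R n N)
  (fun h => mulH (invH h) (normal_form h))) h0; last exact: normal_Linf.
apply: continuous_in_subspaceT => k /set_mem kk.
apply: cvg_mulH; last exact: normal_continuous.
have h2 : (1 : R) < 2 by lra.
have HRk : \forall l \near k, HR l.
  apply: (@filterS _ (nbhs k) _ _ _ _ (close_nbhs kk h2)) => l [_ /(_ 1)].
  rewrite ler01 lexx => /(_ isT); rewrite (_ : segment_H k l 1 = l) //.
  by apply: H_eq => s /=; rewrite scale1r addrC subrK.
have kid : l @[l --> k] --> k by exact: cvg_id.
apply: cvgH => s.
  apply: cvg_invmx; [exact: kk.1| |exact: cvgH1].
  by apply: (@filterS _ (nbhs k) _ _ _ _ HRk) => l [].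
apply: cvg_invmx; [exact: kk.2| |exact: cvgH2].
by apply: (@filterS _ (nbhs k) _ _ _ _ HRk) => l [].
Qed.

(** The normal form of a similitude is 1, so normal_Linf0 applies. *)
Lemma Linf_HR0 h : Linf h -> HR0 h -> Linf0 h.
Proof.
move=> /LinfE[hh hz] h0; have := normal_Linf0 h0.
have -> : normal_form h = oneHinf n N.
  apply: iota_inj => s; have [z z0 zE] := hz s.
  by rewrite (normal_similar hh z0 zE) iota1.
by rewrite mulH1 => /Linf0_inv; rewrite invHK.
Qed.

End NormalForm.

(** * Level structures *)

Section IntegralMatrices.
Context (K : fieldType) (w : dval K).

Definition intmx (a : int) k l (g : 'M[K]_(k, l)) : Prop :=
  forall i j, ordge w a (g i j).

Lemma intmx_mul a b k l m (g : 'M[K]_(k, l)) (h : 'M[K]_(l, m)) :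
  intmx a g -> intmx b h -> intmx (a + b) (g *m h).
Proof.
by move=> hg hh i j; rewrite mxE; apply: ordge_sum => u _; apply: ordgeM.
Qed.

Lemma intmx_add a k l (g h : 'M[K]_(k, l)) : intmx a g -> intmx a h -> intmx a (g + h).
Proof. by move=> hg hh i j; rewrite mxE; exact: ordgeD. Qed.

Lemma intmx_opp a k l (g : 'M[K]_(k, l)) : intmx a g -> intmx a (- g).
Proof. by move=> hg i j; rewrite mxE ordgeN. Qed.

Lemma intmx_le a b k l (g : 'M[K]_(k, l)) : a <= b -> intmx b g -> intmx a g.
Proof. by move=> ab hg i j; exact: ordge_le (hg i j). Qed.

Lemma intmx_0 a k l : intmx a (0 : 'M[K]_(k, l)).
Proof. by move=> i j; rewrite mxE; exact: ordge0. Qed.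

Lemma intmx_1 m : intmx 0 (1%:M : 'M[K]_m).
Proof. by move=> i j; rewrite mxE; case: eqP => _; [exact: ordge1 | exact: ordge0]. Qed.

Lemma intmx_block a k1 k2 l1 l2 (A : 'M[K]_(k1, l1)) (B : 'M[K]_(k1, l2))
    (C : 'M[K]_(k2, l1)) (D : 'M[K]_(k2, l2)) :
  intmx a A -> intmx a B -> intmx a C -> intmx a D -> intmx a (block_mx A B C D).
Proof.
move=> hA hB hC hD i j; rewrite -(splitK i) -(splitK j).
by case: (fintype.split i) => i' /=; case: (fintype.split j) => j' /=;
  rewrite ?block_mxEul ?block_mxEur ?block_mxEdl ?block_mxEdr.
Qed.

Lemma intmx_det m (g : 'M[K]_m) : intmx 0 g -> ordge w 0 (\det g).
Proof.
move=> hg; apply: ordge_sum => s _; apply: ordge0M.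
  by case: (perm.odd_perm s); rewrite ?expr1 ?expr0 ?ordgeN; exact: ordge1.
by apply: (big_ind (fun x => ordge w 0 x)) => [|x y|i _]; [exact: ordge1|exact: ordge0M|].
Qed.

Lemma intmx_adj m (g : 'M[K]_m) : intmx 0 g -> intmx 0 (\adj g).
Proof.
move=> hg i j; rewrite mxE; apply: ordge0M.
  by elim: (_ + _)%N => [|e IH]; rewrite ?expr0 ?exprS ?mulN1r ?ordgeN //; exact: ordge1.
by apply: intmx_det => i' j'; rewrite !mxE.
Qed.

End IntegralMatrices.

Section LocalGroups.
Context (R : realType) (N : field_data R) (m : nat) (v : place N).
Local Notation K := (Fv N v).
Local Notation w := (cval (Fv N v)).
Implicit Types g h : 'M[K]_m.

Lemma GLO_mul g h : GLO v g -> GLO v h -> GLO v (g *m h).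
Proof.
move=> [ug ig dg] [uh ih dh]; split; first by rewrite unitmx_mul ug.
  by rewrite -[0]/((0 : int) + 0); exact: intmx_mul.
by rewrite det_mulmx invfM; exact: ordge0M.
Qed.

Lemma GLO_inv g : GLO v g -> GLO v (invmx g).
Proof.
move=> [ug ig dg]; split; first by rewrite unitmx_inv.
  move=> i j; rewrite /invmx ug mxE; apply: ordge0M => //; exact: intmx_adj.
by rewrite det_inv invrK; exact: intmx_det.
Qed.

Lemma GLO_1 : GLO v (1%:M : 'M[K]_m).
Proof.
split; [exact: unitmx1 | exact: intmx_1 |]; rewrite det1 invr1; exact: ordge1.
Qed.

Lemma Kprin_mul a g h : Kprin v a g -> Kprin v a h -> Kprin v a (g *m h).
Proof.
move=> [gO ga] [hO ha]; split; first exact: GLO_mul.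
have e : g *m h - 1%:M = g *m (h - 1%:M) + (g - 1%:M).
  by rewrite mulmxBr mulmx1 addrA subrK.
have D (A : 'M[K]_m) i j : (A - 1%:M) i j = A i j - (i == j)%:R by rewrite !mxE.
move=> i j; rewrite -D e; apply: intmx_add i j; last by move=> i j; rewrite D.
have [_ gi _] := gO.
have := @intmx_mul _ w 0 a%:Z _ _ _ g (h - 1%:M) gi; rewrite add0r; apply.
by move=> i2 j2; rewrite D.
Qed.

Lemma Kprin_inv a g : Kprin v a g -> Kprin v a (invmx g).
Proof.
move=> [gO ga]; split; first exact: GLO_inv.
have [ug _ _] := gO; have [_ igi _] := GLO_inv gO.
have e : invmx g - 1%:M = - (invmx g *m (g - 1%:M)).
  by rewrite mulmxBr mulVmx // mulmx1 opprB.
have D (A : 'M[K]_m) i j : (A - 1%:M) i j = A i j - (i == j)%:R by rewrite !mxE.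
move=> i j; rewrite -D e; apply: intmx_opp i j.
have := @intmx_mul _ w 0 a%:Z _ _ _ (invmx g) (g - 1%:M) igi; rewrite add0r; apply.
by move=> i2 j2; rewrite D.
Qed.

Lemma Kprin_1 a : Kprin v a (1%:M : 'M[K]_m).
Proof. by split=> [|i j]; [exact: GLO_1 | rewrite mxE subrr; exact: ordge0]. Qed.

End LocalGroups.

Section FiniteLevel.
Context (R : realType) (p n : nat) (N : field_data R) (C : coef_data p N).
Context (D : datum n C) (hD : standing D).
Local Notation Hf := (Hfin n N).
Implicit Types l : Hf.

Definition mulHf l l' : Hf := (mulfin l.1 l'.1, mulfin l.2 l'.2).
Definition invfin m (g : finmx N m) : finmx N m := fun v => invmx (g v).
Definition invHf l : Hf := (invfin l.1, invfin l.2).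
Definition oneHf : Hf := (onefin N n, onefin N n).

Lemma fin_eq m (g h : finmx N m) : (forall v, g v = h v) -> g = h.
Proof. by move=> e; apply: functional_extensionality_dep. Qed.

Lemma iotafinM l l' v : iotafin (mulHf l l') v = iotafin l v *m iotafin l' v.
Proof. by rewrite /iotafin /= mulmx_block !mulmx0 !mul0mx !addr0 add0r. Qed.

Lemma iotafin1 v : iotafin oneHf v = 1%:M.
Proof. by rewrite /iotafin /= -scalar_mx_block. Qed.

Lemma iotafin_unit l v :
  (iotafin l v \in unitmx) = (l.1 v \in unitmx) && (l.2 v \in unitmx).
Proof. by rewrite /iotafin [LHS]unitmxE det_ublock unitrM -!unitmxE. Qed.

Lemma iotafinV l v : iotafin l v \in unitmx -> iotafin (invHf l) v = invmx (iotafin l v).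
Proof.
move=> u; rewrite -[LHS](mulmxK u) -iotafinM.
have := u; rewrite iotafin_unit => /andP[u1 u2].
have -> : iotafin (mulHf (invHf l) l) v = 1%:M.
  by rewrite /iotafin /= /mulfin /invfin !mulVmx // -scalar_mx_block.
by rewrite mul1mx.
Qed.

Lemma Kfin_GLO k v : Kfin D k -> GLO v (k v).
Proof.
move=> /(_ v); case: ifP => [pv /(st_KJ hD pv) [] //|_ [] //].
Qed.

Lemma Kfin_mul k k' : Kfin D k -> Kfin D k' -> Kfin D (mulfin k k').
Proof.
move=> hk hk' v; have := hk v; have := hk' v; rewrite /mulfin; case: ifP => pv h h'.
  exact: (st_KM hD pv).
exact: Kprin_mul.
Qed.

Lemma Kfin_inv k : Kfin D k -> Kfin D (invfin k).
Proof.
move=> hk v; have := hk v; rewrite /invfin; case: ifP => pv h; last exact: Kprin_inv.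
exact: (st_KV hD pv).
Qed.

Lemma Kfin_1 : Kfin D (onefin N (n + n)).
Proof.
by move=> v; case: ifP => pv; [exact: (st_K1 hD pv) | exact: Kprin_1].
Qed.

Lemma Kfin_sub_max k : Kfin D k -> Kfin_max D k.
Proof.
by move=> hk v; have := hk v; case: ifP => pv // kp; have [] := st_KJ hD pv kp.
Qed.

Context (beta : place N -> nat).
Local Notation XB := (mulfin (@xi R p n N) (tp D beta)).

Definition xit_inv : finmx N (n + n) := fun v =>
  if overp p v then block_mx ((unif D v ^- beta v)%:M) 0 0 1%:M *m
    block_mx 1%:M (- 1%:M) 0 (antidiag n _) else 1%:M.

Lemma xit_invK v : xit_inv v *m XB v = 1%:M.
Proof.
rewrite /xit_inv /mulfin /xi /tp; case: ifP => pv; last by rewrite !mulmx1.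
have [u0 _] := st_unif hD pv.
have k1 : block_mx 1%:M (- 1%:M) 0 (antidiag n (Fv N v)) *m
    block_mx 1%:M (antidiag n (Fv N v)) 0 (antidiag n (Fv N v)) = 1%:M.
  rewrite mulmx_block !mulmx0 !mul0mx !mul1mx !addr0 add0r antidiagK mulNmx mul1mx subrr.
  by rewrite -(scalar_mx_block n n 1).
rewrite -mulmxA [block_mx 1%:M (- _) _ _ *m _]mulmxA k1 mul1mx.
rewrite mulmx_block !mulmx0 !mul0mx !mulmx1 !addr0 !add0r -scalar_mxM mulVf ?expf_neq0 //.
by rewrite -scalar_mx_block.
Qed.

Lemma xit_invKV v : XB v *m xit_inv v = 1%:M.
Proof. exact: mulmx1C (xit_invK v). Qed.

Lemma LfinE l : Lfin D beta l <->
  Kfin D (iotafin l) /\ Kfin D (fun v => xit_inv v *m (iotafin l v *m XB v)).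
Proof.
split=> [[hl [k hk e]]|[hl hk]]; split=> //.
  rewrite (_ : (fun v => _) = k) //; apply: fin_eq => v.
  have /(congr1 (fun g => g v)) := e; rewrite /mulfin /= => ->.
  by rewrite mulmxA -/(mulfin _ _ v) xit_invK mul1mx.
exists (fun v => xit_inv v *m (iotafin l v *m XB v)) => //.
apply: fin_eq => v; rewrite /mulfin -!/(mulfin _ _ v) [RHS]mulmxA xit_invKV mul1mx //.
Qed.

Lemma Lfin_mul l l' : Lfin D beta l -> Lfin D beta l' -> Lfin D beta (mulHf l l').
Proof.
move=> /LfinE[hl hk] /LfinE[hl' hk']; apply/LfinE; split.
  rewrite (_ : iotafin _ = mulfin (iotafin l) (iotafin l')); first exact: Kfin_mul.
  by apply: fin_eq => v; exact: iotafinM.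
rewrite (_ : (fun v => _) = mulfin (fun v => xit_inv v *m (iotafin l v *m XB v))
    (fun v => xit_inv v *m (iotafin l' v *m XB v))); first exact: Kfin_mul.
apply: fin_eq => v; rewrite iotafinM.
set Y := xit_inv v; set Z := XB v; set A := iotafin l v; set A' := iotafin l' v.
have ZY : Z *m Y = 1%:M := xit_invKV v.
change (Y *m (A *m A' *m Z) = Y *m (A *m Z) *m (Y *m (A' *m Z))).
have -> : Y *m (A *m Z) *m (Y *m (A' *m Z)) = Y *m (A *m (Z *m Y *m (A' *m Z))).
  by rewrite !mulmxA.
by rewrite ZY mul1mx !mulmxA.
Qed.

Lemma Lfin_unit l v : Lfin D beta l -> iotafin l v \in unitmx.
Proof. by move=> [/(Kfin_GLO v) []]. Qed.

Lemma Lfin_inv l : Lfin D beta l -> Lfin D beta (invHf l).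
Proof.
move=> hl; have lu v := Lfin_unit v hl; move: hl => /LfinE[hl hk]; apply/LfinE; split.
  rewrite (_ : iotafin _ = invfin (iotafin l)); first exact: Kfin_inv.
  by apply: fin_eq => v; exact: iotafinV.
rewrite (_ : (fun v => _) = invfin (fun v => xit_inv v *m (iotafin l v *m XB v))).
  exact: Kfin_inv.
apply: fin_eq => v; rewrite /invfin iotafinV //.
set Y := xit_inv v; set Z := XB v; set A := iotafin l v.
have YZ : Y *m Z = 1%:M := xit_invK v.
have ZY : Z *m Y = 1%:M := xit_invKV v.
have [uY uZ] := mulmx1_unit YZ.
have e : (Y *m (invmx A *m Z)) *m (Y *m (A *m Z)) = 1%:M.
  have -> : Y *m (invmx A *m Z) *m (Y *m (A *m Z)) =
      Y *m (invmx A *m (Z *m Y) *m (A *m Z)) by rewrite !mulmxA.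
  by rewrite ZY mulmx1 [invmx A *m _]mulmxA mulVmx ?lu // mul1mx.
have u : Y *m (A *m Z) \in unitmx by rewrite unitmx_mul uY unitmx_mul lu uZ.
by rewrite -[LHS](mulmxK u) e mul1mx.
Qed.

Lemma Lfin_1 : Lfin D beta oneHf.
Proof.
apply/LfinE; split.
  by rewrite (_ : iotafin _ = onefin N (n + n)); [exact: Kfin_1 | apply: fin_eq; exact: iotafin1].
rewrite (_ : (fun v => _) = onefin N (n + n)); first exact: Kfin_1.
by apply: fin_eq => v; rewrite iotafin1 mul1mx xit_invK.
Qed.

(** Conjugation by xi t_p^beta costs at most beta v in the depth of the
    congruence at v. *)
Lemma Lfin_small : finite_set [set v : place N | overp p v] ->
  exists2 a : place N -> nat, finite_set [set v | a v <> 0%N] &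
  forall l, (forall v, Kprin v (a v) (l.1 v) /\ Kprin v (a v) (l.2 v)) -> Lfin D beta l.
Proof.
move=> fp.
have /choice [b hb] : forall v, exists a, overp p v -> Kprin v a `<=` Kp D (v := v).
  move=> v; have [pv|] := boolP (overp p v); last by exists 0%N.
  by have [a ha] := st_Kopen hD pv; exists a.
exists (fun v => if overp p v then (b v + beta v)%N else modulus D v).
  apply: (@sub_finite_set _ _ ([set v | overp p v] `|` [set v | modulus D v <> 0%N])).
    by move=> v /=; case: ifP => pv; [left | right].
  by rewrite finite_setU; split=> //; exact: (st_modulus hD).
move=> l hl.
have hi v : Kprin v (if overp p v then (b v + beta v)%N else modulus D v) (iotafin l v).
  have [[[u1 i1 d1] k1] [[u2 i2 d2] k2]] := hl v; split.
    split; first by rewrite iotafin_unit u1 u2.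
      by apply: intmx_block => //; exact: intmx_0.
    by rewrite /iotafin det_ublock invfM; exact: ordge0M.
  have E : iotafin l v - 1%:M = block_mx (l.1 v - 1%:M) 0 0 (l.2 v - 1%:M).
    by rewrite (scalar_mx_block n n) /iotafin opp_block_mx add_block_mx oppr0 !addr0.
  have D' k (A : 'M[Fv N v]_k) i j : (A - 1%:M) i j = A i j - (i == j)%:R by rewrite !mxE.
  move=> i j; rewrite -D' E; apply: intmx_block; [|exact: intmx_0|exact: intmx_0|].
    by move=> i' j'; rewrite D'.
  by move=> i' j'; rewrite D'.
apply/LfinE; split=> v; have := hi v; case: ifP => pv hv //.
- by apply: (hb v pv); apply: Kprin_le hv; rewrite leq_addr.
- apply: (hb v pv); have [[uA iA dA] kA] := hv.
  set A := iotafin l v in uA iA dA kA *.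
  have [u0 vu] := st_unif hD pv.
  have D' (B : 'M[Fv N v]_(n + n)) i j : (B - 1%:M) i j = B i j - (i == j)%:R by rewrite !mxE.
  have E : xit_inv v *m (A *m XB v) - 1%:M = xit_inv v *m ((A - 1%:M) *m XB v).
    by rewrite mulmxBl mul1mx mulmxBr xit_invK.
  have anti : intmx (cval (Fv N v)) 0 (antidiag n (Fv N v)).
    by move=> i j; rewrite mxE; case: eqP => _; [exact: ordge1 | exact: ordge0].
  have sc a (x : Fv N v) : ordge (cval (Fv N v)) a x -> intmx (cval (Fv N v)) a (x%:M : 'M[Fv N v]_n).
    by move=> hx i j; rewrite mxE; case: eqP => _ //=; exact: ordge0.
  have iX : intmx (cval (Fv N v)) (0 + 0) (XB v).
    rewrite /mulfin /xi /tp pv; apply: intmx_mul; apply: intmx_block => //;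
      try exact: intmx_0; try exact: intmx_1.
    by apply: sc; rewrite ordgeE ?expf_neq0 // ordX // vu.
  have iXi : intmx (cval (Fv N v)) (- (beta v)%:Z + 0) (xit_inv v).
    rewrite /xit_inv pv; apply: intmx_mul; apply: intmx_block => //;
      try exact: intmx_0; try (apply: intmx_opp); try exact: intmx_1.
    - by apply: sc; rewrite ordgeE ?invr_eq0 ?expf_neq0 // ordV ?expf_neq0 // ordX // vu natz.
    - by apply: (@intmx_le _ _ _ 0); [rewrite oppr_le0 | exact: intmx_1].
  have small : intmx (cval (Fv N v)) (b v)%:Z (xit_inv v *m (A *m XB v) - 1%:M).
    rewrite E (_ : (b v)%:Z = (- (beta v)%:Z + 0) + ((b v + beta v)%N%:Z + (0 + 0))).
      by apply: intmx_mul => //; apply: intmx_mul => // i j; rewrite D'.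
    by rewrite !addr0 PoszD [RHS]addrC addrK.
  split; last by move=> i j; rewrite -D'.
  have dE : \det (xit_inv v *m (A *m XB v)) = \det A.
    have := congr1 determinant (xit_invK v); rewrite det1 det_mulmx => d1.
    by rewrite det_mulmx [\det (A *m _)]det_mulmx mulrCA d1 mulr1.
  split; [|move=> i j|].
  + by rewrite unitmxE dE -unitmxE.
  + have -> : xit_inv v *m (A *m XB v) = (xit_inv v *m (A *m XB v) - 1%:M) + 1%:M.
      by rewrite subrK.
    apply: intmx_add; last exact: intmx_1.
    by apply: intmx_le small.
  + by rewrite dE.
- rewrite /xit_inv /mulfin /xi /tp pv mul1mx !mulmx1 //.
Qed.

End FiniteLevel.

(** * Double cosets of the subgroup H *)

Section DoubleCosets.
Context (R : realType) (p n : nat) (N : field_data R) (C : coef_data p N).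
Context (D : datum n C) (hD : standing D) (beta : place N -> nat).
Local Notation Hf := (Hfin n N).
Local Notation H := (Hinf n N).
Local Notation M2 := ('M[NF N]_n * 'M[NF N]_n)%type.
Implicit Types (f : Hf) (h k : H) (c : M2) (x : HA n N).

Definition ratH c : H :=
  (fun s => map_mx (realemb N s) c.1, fun s => map_mx (realemb N s) c.2).
Definition finH c : Hf :=
  (fun v => map_mx (cinj (Fv N v)) c.1, fun v => map_mx (cinj (Fv N v)) c.2).
Definition mulc c c' : M2 := (c.1 *m c'.1, c.2 *m c'.2).
Definition invc c : M2 := (invmx c.1, invmx c.2).
Definition unitc c : Prop := c.1 \in unitmx /\ c.2 \in unitmx.

Definition finpart x : Hf := (x.1.1, x.2.1).
Definition infpart x : H := (x.1.2, x.2.2).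

Lemma mkH_parts x : x = mkH (finpart x) (infpart x).
Proof. by case: x => [[? ?] [? ?]]. Qed.

Lemma Hf_eq f f' : (forall v, f.1 v = f'.1 v) -> (forall v, f.2 v = f'.2 v) -> f = f'.
Proof.
by case: f f' => [a b] [a' b'] /= e1 e2; congr (_, _); exact: functional_extensionality_dep.
Qed.

Lemma mulHfA f g l : mulHf f (mulHf g l) = mulHf (mulHf f g) l.
Proof. by apply: Hf_eq => v; rewrite /= /mulfin mulmxA. Qed.

Lemma mulHf1 f : mulHf f (oneHf n N) = f.
Proof. by apply: Hf_eq => v; rewrite /= /mulfin /onefin mulmx1. Qed.

Lemma mul1Hf f : mulHf (oneHf n N) f = f.
Proof. by apply: Hf_eq => v; rewrite /= /mulfin /onefin mul1mx. Qed.

Lemma mulHfV f : (forall v, iotafin f v \in unitmx) -> mulHf f (invHf f) = oneHf n N.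
Proof.
by move=> u; apply: Hf_eq => v; have := u v; rewrite iotafin_unit => /andP[u1 u2];
  rewrite /= /mulfin /invfin mulmxV.
Qed.

Lemma mulVHf f : (forall v, iotafin f v \in unitmx) -> mulHf (invHf f) f = oneHf n N.
Proof.
by move=> u; apply: Hf_eq => v; have := u v; rewrite iotafin_unit => /andP[u1 u2];
  rewrite /= /mulfin /invfin mulVmx.
Qed.

Lemma ratH_mul c c' : ratH (mulc c c') = mulH (ratH c) (ratH c').
Proof. by apply: H_eq => s; rewrite /= map_mxM. Qed.

Lemma finH_mul c c' : finH (mulc c c') = mulHf (finH c) (finH c').
Proof. by apply: Hf_eq => s; rewrite /= map_mxM. Qed.

Lemma ratH_inv c : ratH (invc c) = invH (ratH c).
Proof. by apply: H_eq => s; rewrite /= map_invmx. Qed.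

Lemma finH_inv c : finH (invc c) = invHf (finH c).
Proof. by apply: Hf_eq => s; rewrite /= map_invmx. Qed.

Lemma ratH_HR c : unitc c -> HR (ratH c).
Proof. by move=> [u1 u2]; split=> s; rewrite /= map_unitmx. Qed.

Lemma finH_unit c v : unitc c -> iotafin (finH c) v \in unitmx.
Proof. by move=> [u1 u2]; rewrite iotafin_unit !map_unitmx u1 u2. Qed.

Lemma unitc_mul c c' : unitc c -> unitc c' -> unitc (mulc c c').
Proof. by move=> [u1 u2] [u1' u2']; split; rewrite unitmx_mul ?u1 ?u2. Qed.

Lemma unitc_inv c : unitc c -> unitc (invc c).
Proof. by move=> [u1 u2]; split; rewrite unitmx_inv. Qed.

Definition onec : M2 := (1%:M, 1%:M).

Lemma ratH_1 : ratH onec = oneHinf n N.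
Proof. by apply: H_eq => s; rewrite /= map_mx1. Qed.

Lemma finH_1 : finH onec = oneHf n N.
Proof. by apply: Hf_eq => s; rewrite /= map_mx1. Qed.

Lemma unitc_1 : unitc onec.
Proof. by split; exact: unitmx1. Qed.

Lemma dcosetHE f h f' h' : dcosetH D beta (mkH f h) (mkH f' h') <->
  exists c l k, [/\ unitc c, Lfin D beta l, Linf0 k,
    f' = mulHf (mulHf (finH c) f) l & h' = mulH (mulH (ratH c) h) k].
Proof.
split=> [[c1 [c2 [l [k [[u1 u2] hl hk e]]]]]|[c [l [k [[u1 u2] hl hk -> ->]]]]].
  exists (c1, c2), l, k; split=> //.
    by case: f' e => ? ? [-> _ -> _].
  by case: h' e => ? ? [_ -> _ ->].
by exists c.1, c.2, l, k; split.
Qed.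

Lemma Lfin_units l : Lfin D beta l -> forall v, iotafin l v \in unitmx.
Proof. by move=> hl v; exact: (Lfin_unit hD v hl). Qed.

Lemma dcosetH_sym x y : dcosetH D beta x y -> dcosetH D beta y x.
Proof.
rewrite (mkH_parts x) (mkH_parts y) => /dcosetHE [c [l [k [uc hl hk -> ->]]]].
apply/dcosetHE; exists (invc c), (invHf l), (invH k); split.
- exact: unitc_inv.
- exact: Lfin_inv.
- exact: Linf0_inv.
- rewrite finH_inv -!mulHfA mulHfV ?mulHf1; last exact: Lfin_units.
  by rewrite mulHfA mulVHf ?mul1Hf // => v; exact: finH_unit.
- have kk : HR k by have /LinfE [] := Linf0_sub hk.
  rewrite ratH_inv -!mulHA mulHV // mulH1 mulHA mulVH ?mul1H //; exact: ratH_HR.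
Qed.

Lemma dcosetH_trans x y z : dcosetH D beta x y -> dcosetH D beta y z -> dcosetH D beta x z.
Proof.
rewrite (mkH_parts x) (mkH_parts y) (mkH_parts z).
move=> /dcosetHE [c [l [k [uc hl hk -> ->]]]] /dcosetHE [c' [l' [k' [uc' hl' hk' -> ->]]]].
apply/dcosetHE; exists (mulc c' c), (mulHf l l'), (mulH k k'); split.
- exact: unitc_mul.
- exact: Lfin_mul.
- exact: Linf0_mul.
- by rewrite finH_mul !mulHfA.
- by rewrite ratH_mul !mulHA.
Qed.

Lemma dcosetH_eq x y : dcosetH D beta x y -> dcosetH D beta y = dcosetH D beta x.
Proof.
move=> xy; apply/seteqP; split=> z; first exact: dcosetH_trans.
by apply: dcosetH_trans; exact: dcosetH_sym.
Qed.

Lemma fiber_eq (z : SH D beta) x : fiber z x -> fiber z = dcosetH D beta x.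
Proof. by move=> zx; rewrite (dcosetH_eq zx). Qed.

Lemma fiber_sym (z : SH D beta) x y : fiber z x -> dcosetH D beta x y -> fiber z y.
Proof. by move=> /fiber_eq ->. Qed.

(** The rational elements acting on the lifts, to the identity component of the
    real group, of the points of one component of the double coset space. *)
Record deck (delta : Hf) c : Prop := Deck {
  deck_unit : unitc c;
  deck_HR0 : HR0 (ratH c);
  deck_fin : exists2 l, Lfin D beta l & mulHf (mulHf (finH c) delta) l = delta
}.

Lemma deck_mul delta c c' : deck delta c -> deck delta c' -> deck delta (mulc c c').
Proof.
move=> [u r [l hl e]] [u' r' [l' hl' e']]; split; first exact: unitc_mul.
  by rewrite ratH_mul; exact: HR0_mul.
exists (mulHf l' l); first exact: Lfin_mul.
by rewrite finH_mul !mulHfA -[mulHf (mulHf (finH c) _) delta]mulHfA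
  -[mulHf (mulHf _ _) l']mulHfA e' e.
Qed.

Lemma deck_inv delta c : deck delta c -> deck delta (invc c).
Proof.
move=> [u r [l hl e]]; split; first exact: unitc_inv.
  by rewrite ratH_inv; exact: HR0_inv.
exists (invHf l); first exact: Lfin_inv.
rewrite -{1}e finH_inv -!mulHfA mulHfV ?mulHf1; last exact: Lfin_units.
by rewrite mulHfA mulVHf ?mul1Hf // => v; exact: finH_unit.
Qed.

Definition lifts (delta : Hf) (z : SH D beta) h : Prop := HR0 h /\ fiber z (mkH delta h).

Lemma lifts_act delta c z h : deck delta c -> lifts delta z h ->
  lifts delta z (mulH (ratH c) h).
Proof.
move=> [u r [l hl e]] [h0 zh]; split; first exact: HR0_mul.
apply: (fiber_sym zh); apply/dcosetHE; exists c, l, (oneHinf n N); split=> //.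
  exact: Linf0_1.
by rewrite mulH1.
Qed.

Lemma lifts_uniq delta z h h' : lifts delta z h -> lifts delta z h' ->
  exists2 c, deck delta c & exists2 k, Linf0 k & h' = mulH (mulH (ratH c) h) k.
Proof.
move=> [h0 zh] [h'0 zh'].
have := zh'; rewrite (fiber_eq zh) => /dcosetHE [c [l [k [uc hl hk e e']]]].
exists c; last by exists k.
split=> //; last by exists l.
have -> : ratH c = mulH (mulH h' (invH k)) (invH h).
  have kk : HR k by have /LinfE [] := Linf0_sub hk.
  rewrite e' -!mulHA [mulH k (mulH _ _)]mulHA mulHV // mul1H mulHV ?mulH1 //.
  exact: HR0_sub.
apply: HR0_mul; last exact: HR0_inv.
by apply: HR0_mul => //; apply/HR0_inv/Linf0_HR0.
Qed.

Lemma lifts_right delta z h k : Linf0 k -> lifts delta z h -> lifts delta z (mulH h k).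
Proof.
move=> hk [h0 zh]; split; first by apply: HR0_mul => //; exact: Linf0_HR0.
apply: (fiber_sym zh); apply/dcosetHE; exists onec, (oneHf n N), k; split=> //.
- exact: unitc_1.
- exact: Lfin_1.
- by rewrite finH_1 mul1Hf mulHf1.
- by rewrite ratH_1 mul1H.
Qed.

End DoubleCosets.

(** * Injectivity radius *)

Section RealBounds.
Context (R : realType) (m : nat).
Implicit Types A B : 'M[R]_m.

Lemma entry_bound B : B \in unitmx -> exists2 k : R, 0 <= k &
  forall (w : 'rV[R]_m) j, w 0 j ^+ 2 <= k * sqn (w *m B).
Proof.
move=> uB; pose E := \sum_i \sum_j `|invmx B i j|.
have hE i j : `|invmx B i j| <= E.
  rewrite /E (bigD1 i) //= (bigD1 j) //= -addrA lerDl addr_ge0 //.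
    by apply: sumr_ge0 => *.
  by apply: sumr_ge0 => *; apply: sumr_ge0 => *.
exists ((m%:R * E) ^+ 2) => [|w j]; first exact: sqr_ge0.
have := sqn_small (w *m B) hE; rewrite mulmxK //; apply: le_trans.
rewrite sqnE (bigD1 j) //= lerDl; apply: sumr_ge0 => i _; exact: sqr_ge0.
Qed.

(** If g moves the form of B little, the products of the entries of g and of
    its inverse are bounded: these are the matrix entries of the conjugation
    by g. *)
Lemma conjugation_bound B : B \in unitmx -> exists X : R, forall g, g \in unitmx ->
  nearmx 2 B (g *m B) -> forall i j k l, `|g i j * invmx g k l| <= X.
Proof.
move=> uB; have [k k0 hk] := entry_bound uB.
pose s := \sum_i sqn (delta_mx 0 i *m B).
have hs i : sqn (delta_mx 0 i *m B) <= s.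
  rewrite /s (bigD1 i) //= lerDl; apply: sumr_ge0 => *; exact: sqn_ge0.
have s0 : 0 <= s by apply: sumr_ge0 => *; exact: sqn_ge0.
exists (1 + k * k * (2 * (s * s))) => g ug near2 i j u l.
pose x : 'rV[R]_m := delta_mx 0 u *m invmx g; pose y : 'rV[R]_m := delta_mx 0 i *m g.
have xE : x 0 l = invmx g u l by rewrite /x -rowE mxE.
have yE : y 0 j = g i j by rewrite /y -rowE mxE.
have := near2 x (delta_mx 0 i); rewrite !mulmxA -/y /x -[_ *m invmx g *m g]mulmxA mulVmx //.
rewrite mulmx1 -/x => h.
have hx := hk x l; have hy := hk y j; rewrite xE in hx; rewrite yE in hy.
have h1 : (g i j * invmx g u l) ^+ 2 <= k * k * (2 * (s * s)).
  rewrite exprMn; have := ler_pM (sqr_ge0 _) (sqr_ge0 _) hy hx; move/le_trans; apply.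
  have -> : k * sqn (y *m B) * (k * sqn (x *m B)) = k * k * (sqn (x *m B) * sqn (y *m B)).
    by ring.
  apply: ler_wpM2l; first exact: mulr_ge0.
  apply: le_trans h _; rewrite ler_pM2l //.
  by apply: ler_pM => //; exact: sqn_ge0.
have := real_normK (num_real (g i j * invmx g u l)).
have := normr_ge0 (g i j * invmx g u l).
move: h1; move: (_ * (_ * (_ * _))) `|_| (_ ^+ 2) => a b c.
by nra.
Qed.

(** Whether g moves the form of B by at most C depends on the conjugation by g
    only. *)
Lemma nearmx_conjugation C B g g' : g \in unitmx -> g' \in unitmx ->
  (forall i j k l, g i j * invmx g k l = g' i j * invmx g' k l) ->
  nearmx C B (g *m B) -> nearmx C B (g' *m B).
Proof.
move=> ug ug' e h.
have prodE (f : 'M[R]_m) (x y : 'rV[R]_m) :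
    sqn (x *m invmx f *m B) * sqn (y *m f *m B) =
    \sum_a \sum_b (\sum_j \sum_l \sum_i \sum_u
      x 0 u * B l a * (y 0 i * B j b) * (f i j * invmx f u l)) ^+ 2.
  rewrite !sqnE mulr_suml; apply: eq_bigr => a _; rewrite mulr_sumr; apply: eq_bigr => b _.
  rewrite -exprMn; congr (_ ^+ 2).
  have F (z : 'rV[R]_m) M c : (z *m M *m B) 0 c = \sum_j \sum_i z 0 i * M i j * B j c.
    by rewrite mxE; apply: eq_bigr => j _; rewrite mxE mulr_suml.
  rewrite !F mulrC mulr_suml; apply: eq_bigr => j _; rewrite mulr_sumr; apply: eq_bigr => l _.
  rewrite mulr_suml; apply: eq_bigr => i _; rewrite mulr_sumr; apply: eq_bigr => u _.
  by ring.
move=> x y.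
have := h (x *m g' *m invmx g) y.
rewrite !mulmxA -[_ *m invmx g *m g]mulmxA mulVmx // mulmx1.
have -> : sqn (x *m g' *m invmx g *m B) * sqn (y *m g *m B) =
    sqn (x *m B) * sqn (y *m g' *m B).
  rewrite prodE; have := prodE g' (x *m g') y; rewrite -[_ *m g' *m invmx g']mulmxA mulmxV //.
  rewrite mulmx1 => ->; apply: eq_bigr => a _; apply: eq_bigr => b _; congr (_ ^+ 2).
  apply: eq_bigr => j _; apply: eq_bigr => l _; apply: eq_bigr => i _; apply: eq_bigr => u _.
  by rewrite e.
done.
Qed.

Lemma nearmx_limit B B' : ~ nearmx 1 B B' -> \forall C \near (1 : R)^'+, ~ nearmx C B B'.
Proof.
move=> /existsNP [x /existsNP [y /negP]]; rewrite -ltNge mul1r.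
set a := sqn _ * sqn _; set b := sqn _ * sqn _ => ba.
have a0 : 0 <= a by rewrite mulr_ge0 ?sqn_ge0.
have [D D1 DP] : exists2 D, 1 < D & D * a <= b.
  have [a00|a1] := eqVneq a 0; first by exists 2; rewrite ?a00 ?mulr0 ?ltr1n // ltW // -a00.
  have a2 : 0 < a by rewrite lt0r a1.
  by exists (b / a); rewrite ?divfK // ltr_pdivlMr // mul1r.
have : \forall C \near (1 : R)^'+, C < D by exact: nbhs_right_lt.
apply: filterS => C CD /(_ x y); rewrite -/a -/b leNgt => /negP; apply.
have [a00|a1] := eqVneq a 0; first by rewrite a00 mulr0 -a00.
by apply: lt_le_trans DP; rewrite ltr_pM2r // lt0r a1.
Qed.

End RealBounds.

Section Injectivity.
Context (R : realType) (p n : nat) (N : field_data R) (C : coef_data p N).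
Context (hn : (0 < n)%N) (D : datum n C) (hD : standing D) (beta : place N -> nat).
Context (T T' : class_family C -> class_family C) (hT : is_eps_cyc T T').
Local Notation H := (Hinf n N).
Local Notation M2 := ('M[NF N]_n * 'M[NF N]_n)%type.
Context (delta : Hfin n N) (d1 : GLfin delta.1) (d2 : GLfin delta.2).

Definition blkc (c : M2) : 'M[NF N]_(n + n) := block_mx c.1 0 0 c.2.

Lemma blkc_real c s : map_mx (realemb N s) (blkc c) = iotainf (ratH c) s.
Proof. by rewrite /blkc map_block_mx !map_mx0. Qed.

Lemma blkc_fin c v : map_mx (cinj (Fv N v)) (blkc c) = iotafin (finH c) v.
Proof. by rewrite /blkc map_block_mx !map_mx0. Qed.

Lemma blkc_unit c : unitc c -> blkc c \in unitmx.
Proof. by move=> [u1 u2]; rewrite unitmxE det_ublock unitrM -!unitmxE u1 u2. Qed.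

Lemma delta_unit v : iotafin delta v \in unitmx.
Proof. by rewrite iotafin_unit d1.1 d2.1. Qed.

Lemma GLO_iota v : GLO v (delta.1 v) -> GLO v (delta.2 v) -> GLO v (iotafin delta v).
Proof.
move=> [u1 i1 e1] [u2 i2 e2]; split; first by rewrite iotafin_unit u1 u2.
  by apply: intmx_block => //; exact: intmx_0.
by rewrite /iotafin det_ublock invfM; exact: ordge0M.
Qed.

Lemma iota_GLfin : GLfin (iotafin delta).
Proof.
split; first exact: delta_unit.
apply: (@sub_finite_set _ _ ([set v | ~ GLO v (delta.1 v)] `|` [set v | ~ GLO v (delta.2 v)])).
  move=> v /= h; have [h1|] := pselect (GLO v (delta.1 v)); last by left.
  by right => h2; apply: h; exact: GLO_iota.
by rewrite finite_setU; split; [exact: d1.2 | exact: d2.2].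
Qed.

Lemma intmx_ex (K : fieldType) (w : dval K) k l (g : 'M[K]_(k, l)) :
  exists a : nat, intmx w (- a%:Z) g.
Proof.
exists (\sum_i \sum_j `|w (g i j)|)%N => i j; have [->|g0] := eqVneq (g i j) 0.
  exact: ordge0.
rewrite ordgeE // (bigD1 i) //= (bigD1 j) //= !PoszD.
by set u := (\sum_(_ | _) _)%N; set t := (\sum_(_ | _) _)%N; move: (w _) u t => x y z; lia.
Qed.

(** c is the conjugate by delta of an element of the compact group L_beta, so
    the denominators of its entries, and of those of its inverse, are at
    most those of delta times those of its inverse. *)
Lemma deck_fractional : exists2 a : place N -> nat, finite_set [set v | a v <> 0%N] &
  forall c, deck D beta delta c -> forall v i j k l,
    ordge v (- (a v)%:Z) (blkc c i j * invmx (blkc c) k l).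
Proof.
have /choice [b hb] : forall v, exists b : nat,
    [/\ intmx (cval (Fv N v)) (- b%:Z) (iotafin delta v),
        intmx (cval (Fv N v)) (- b%:Z) (invmx (iotafin delta v)) &
        GLO v (iotafin delta v) -> b = 0%N].
  move=> v; have [g|ng] := pselect (GLO v (iotafin delta v)).
    exists 0%N; rewrite oppr0; split=> //; first by have [_ ? _] := g.
    by have [_ ? _] := GLO_inv g.
  have [b1 h1] := intmx_ex (cval (Fv N v)) (iotafin delta v).
  have [b2 h2] := intmx_ex (cval (Fv N v)) (invmx (iotafin delta v)).
  exists (b1 + b2)%N; split=> //.
    by apply: intmx_le h1; rewrite PoszD; lia.
  by apply: intmx_le h2; rewrite PoszD; lia.
exists (fun v => 4 * b v)%N.
  apply: sub_finite_set iota_GLfin.2 => v /= h g; apply: h.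
  by have [_ _ ->] := hb v; rewrite ?muln0.
move=> c dc v i j k l; have [uc _ [l0 hl e]] := dc.
have [h1 h2 _] := hb v.
pose A := iotafin delta v; pose B := iotafin l0 v; pose G := iotafin (finH c) v.
have uA : A \in unitmx := delta_unit v.
have uB : B \in unitmx := Lfin_unit hD v hl.
have uG : G \in unitmx := finH_unit v uc.
have GE : G *m A *m B = A by rewrite /G /A /B -!iotafinM e.
have [_ iB _] : GLO v B by exact: (Kfin_GLO hD v hl.1).
have [_ iBV _] : GLO v (invmx B) by apply: GLO_inv; exact: (Kfin_GLO hD v hl.1).
have G1 : G = A *m invmx B *m invmx A by rewrite -{1}GE mulmxK // mulmxK.
have G2 : invmx G = A *m B *m invmx A.
  have e1 : G *m (A *m B *m invmx A) = 1%:M by rewrite !mulmxA GE mulmxV.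
  by rewrite -[RHS](mulKmx uG) e1 mulmx1.
have iG : intmx (cval (Fv N v)) (- (b v)%:Z + 0 + - (b v)%:Z) G.
  by rewrite G1; apply: intmx_mul => //; exact: intmx_mul.
have iGV : intmx (cval (Fv N v)) (- (b v)%:Z + 0 + - (b v)%:Z) (invmx G).
  by rewrite G2; apply: intmx_mul => //; exact: intmx_mul.
have E1 : cinj (Fv N v) (blkc c i j) = G i j by rewrite /G -blkc_fin [RHS]mxE.
have E2 : cinj (Fv N v) (invmx (blkc c) k l) = invmx G k l.
  by rewrite /G -blkc_fin -map_invmx [RHS]mxE.
have := ordgeM (iG i j) (iGV k l); rewrite -E1 -E2 -rmorphM.
rewrite /ordge fmorph_eq0 cinjE => /orP[->//|h]; apply/orP; right; apply: le_trans h.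
by rewrite PoszM; lia.
Qed.

Lemma scalar_deck_close (a : NF N) h (c : M2) : c = (a%:M, a%:M) ->
  closeH 1 h (mulH (ratH c) h).
Proof.
move=> -> s; rewrite iotaM -blkc_real /blkc /= -scalar_mx_block map_scalar_mx.
rewrite mul_scalar_mx -mul_mx_scalar.
apply: (@nearmx_mulr _ _ _ _ (realemb N s a * realemb N s a)).
by rewrite tr_scalar_mx -scalar_mxM.
Qed.

(** h0^-1 c h0 is a similitude in the identity component, hence lies in the
    identity component of L_oo. So c is conjugate by (delta, h0) to an
    element of the level group, and neatness makes it central. *)
Lemma neat_deck c h0 : deck D beta delta c -> HR0 h0 -> closeH 1 h0 (mulH (ratH c) h0) ->
  exists a : NF N, c = (a%:M, a%:M).
Proof.
move=> [uc c0 [l hl e]] h00 cl.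
have hh := HR0_sub h00.
pose k := mulH (invH h0) (mulH (ratH c) h0).
have k0 : HR0 k by apply: HR0_mul; [exact: HR0_inv | exact: HR0_mul].
have kL : Linf k.
  apply/LinfE; split; first exact: HR0_sub.
  move=> s; have u1 := (iota_unitE h0).1 hh s.
  have u2 := (iota_unitE (mulH (ratH c) h0)).1 (HR0_sub (HR0_mul c0 h00)) s.
  have nn : (0 < n + n)%N by rewrite addn_gt0 hn.
  by have [z z0 zE] := nearmx1_simil nn u1 u2 (cl s); exists z => //; rewrite iotaM iotaV.
have kK := Linf0_Kinf0 (Linf_HR0 hn kL k0).
have gG : @GLA _ N (n + n) (iotafin delta, iotainf h0).
  by split; [exact: iota_GLfin | exact: (iota_unitE h0).1].
have [] := st_neat hD gG (blkc_unit uc).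
have lV : iotafin (invHf l) = invfin (iotafin l).
  by apply: fin_eq => v; rewrite iotafinV //; exact: (Lfin_unit hD v hl).
move=> /(_ _) [].
  exists (iotafin (invHf l), iotainf k); split=> //.
    by apply: Kfin_sub_max => //; have [] := Lfin_inv hD hl.
  rewrite /mulad /=; congr (_, _).
    apply: fin_eq => v; rewrite /mulfin /= blkc_fin -!iotafinM.
    congr (iotafin _ v); rewrite -{2}e -!mulHfA mulHfV ?mulHf1 //.
    exact: (Lfin_units hD hl).
  apply/funext => s; rewrite /mulinf /= blkc_real -!iotaM.
  by rewrite /k !mulHA mulHV // mul1H.
move=> /is_scalar_mxP [a aE] _ _ _; exists a.
have := aE; rewrite /blkc scalar_mx_block => /eq_block_mx [e1 _ _ e2].
by case: (c) e1 e2 => x y /= -> ->.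
Qed.

(** The elements moving h0 little are among finitely many conjugations, as the
    matrix entries of the latter lie in a bounded part of a fractional ideal;
    so a small move is no move, and neatness applies. *)
Lemma injectivity_radius h0 : HR0 h0 -> exists2 B : R, 1 < B &
  forall c, deck D beta delta c -> closeH B h0 (mulH (ratH c) h0) ->
  exists a : NF N, c = (a%:M, a%:M).
Proof.
move=> h00; have hh := HR0_sub h00; have hu s := (iota_unitE h0).1 hh s.
have [a fa ha] := deck_fractional.
have /choice [X hX] : forall s, exists X : R, forall g, g \in unitmx ->
  nearmx 2 (iotainf h0 s) (g *m iotainf h0 s) -> forall i j k l, `|g i j * invmx g k l| <= X.
  by move=> s; exact: conjugation_bound (hu s).
pose Y := \sum_s `|X s|.
have XY s : X s <= Y.
  by rewrite /Y (bigD1 s) //= (le_trans (ler_norm _)) // lerDl sumr_ge0.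
have := finite_bounded hT Y fa; set A := [set g | _] => /finite_seqP [l lA].
pose I4 := ('I_(n + n) * 'I_(n + n) * 'I_(n + n) * 'I_(n + n))%type.
pose phi c : {ffun I4 -> NF N} :=
  [ffun t => blkc c t.1.1.1 t.1.1.2 * invmx (blkc c) t.1.2 t.2].
pose dec (k : {ffun I4 -> 'I_(size l).+1}) : {ffun I4 -> NF N} := [ffun t => nth 0 l (k t)].
have near2 c : deck D beta delta c -> closeH 2 h0 (mulH (ratH c) h0) ->
    exists k, phi c = dec k.
  move=> dc cl; have uc := deck_unit dc.
  have val t : phi c t \in l.
    have : A (phi c t); last by rewrite lA.
    rewrite /phi ffunE; split=> [v|s]; first exact: ha.
    apply: le_trans (XY s); rewrite rmorphM.
    have -> : realemb N s (blkc c t.1.1.1 t.1.1.2) = iotainf (ratH c) s t.1.1.1 t.1.1.2.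
      by rewrite -blkc_real [RHS]mxE.
    have -> : realemb N s (invmx (blkc c) t.1.2 t.2) = invmx (iotainf (ratH c) s) t.1.2 t.2.
      by rewrite -blkc_real -map_invmx [RHS]mxE.
    apply: hX; first by apply: (iota_unitE _).1; exact: ratH_HR.
    by rewrite -iotaM; exact: cl.
  exists [ffun t => inord (index (phi c t) l)]; apply/ffunP => t.
  rewrite [RHS]ffunE.
  have -> : [ffun t0 => inord (index (phi c t0) l)] t = inord (index (phi c t) l) :> 'I_(size l).+1.
    by rewrite ffunE.
  rewrite inordK; first by rewrite nth_index.
  by rewrite ltnS index_size.
have main : \forall B \near (1 : R)^'+, forall k, forall c, deck D beta delta c -> phi c = dec k ->
    closeH B h0 (mulH (ratH c) h0) -> closeH 1 h0 (mulH (ratH c) h0).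
  apply: filter_forall => k.
  have [[c0 [dc0 pc0]]|no] := pselect (exists c, deck D beta delta c /\ phi c = dec k); last first.
    by apply: nearW => B c dc pc; case: no; exists c.
  have trans B c c' : deck D beta delta c -> deck D beta delta c' -> phi c = phi c' ->
      closeH B h0 (mulH (ratH c) h0) -> closeH B h0 (mulH (ratH c') h0).
    move=> dc dc' pp cl s; rewrite iotaM.
    apply: (@nearmx_conjugation _ _ _ _ (iotainf (ratH c) s)).
    - by apply: (iota_unitE _).1; apply: ratH_HR; exact: deck_unit dc.
    - by apply: (iota_unitE _).1; apply: ratH_HR; exact: deck_unit dc'.
    - move=> i j u w; have := congr1 (fun f : {ffun I4 -> NF N} => f (i, j, u, w)) pp.
      rewrite !ffunE /= => /(congr1 (realemb N s)).
      by rewrite !rmorphM -!blkc_real -!map_invmx !mxE.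
    - by rewrite -iotaM; exact: cl.
  have [c1|nc1] := pselect (closeH 1 h0 (mulH (ratH c0) h0)).
    apply: nearW => B c dc pc _; apply: (trans _ _ _ dc0 dc _ c1); by rewrite pc0 pc.
  have [s ns] : exists s, ~ nearmx 1 (iotainf h0 s) (iotainf (mulH (ratH c0) h0) s).
    by apply/existsNP.
  apply: filterS (nearmx_limit ns) => B nB c dc pc cl; exfalso; apply: nB.
  by apply: (trans _ _ _ dc dc0 _ cl); rewrite pc0 pc.
have lt2 : \forall B \near (1 : R)^'+, B < 2 by apply: nbhs_right_lt; lra.
have : \forall B \near (1 : R)^'+, [/\ (1 < B), (B < 2) &
  forall k, forall c, deck D beta delta c -> phi c = dec k ->
    closeH B h0 (mulH (ratH c) h0) -> closeH 1 h0 (mulH (ratH c) h0)].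
  have gt1 : \forall B \near (1 : R)^'+, 1 < B by exact: nbhs_right_gt.
  by apply: filterS3 gt1 lt2 main => B; split.
move=> /filter_ex [B [B1 B2 hB]]; exists B => // c dc cl.
apply: (neat_deck dc h00).
have [k hk] := near2 c dc (closeH_le (ltW B2) cl).
exact: hB hk cl.
Qed.

End Injectivity.

(** * Lifting simplices of the double coset space *)

Section QuotientFibers.
Context (T : topologicalType) (A : set T) (cl : T -> set T).
Local Notation Q := (qspace A cl).

Definition qproj (x : A) : Q := \pi_({eq_quot (@qrel_canonical T A cl)})%qT x.

Lemma fiber_qproj x : fiber (qproj x) = cl (val x).
Proof.
rewrite /fiber /qproj.
have /eqmodP : ((\pi_({eq_quot (@qrel_canonical T A cl)}) (repr (\pi_({eq_quot (@qrel_canonical T A cl)}) x))) = \pi_({eq_quot (@qrel_canonical T A cl)}) x)%qT.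
  by rewrite reprK.
by move=> /asboolP.
Qed.

Lemma qspace_open (O : set Q) :
  (forall x : A, O (qproj x) -> \forall y \near (val x : T), forall hy : y \in A, O (qproj (exist _ y hy))) ->
  open O.
Proof.
move=> h; suff : open (qproj @^-1` O) by [].
rewrite openE => x Ox; rewrite /interior.
have := @initial_continuous _ _ (@set_val T A) x _ (h x Ox).
by apply: (@filterS _ (nbhs x)) => -[y hy] /= /(_ hy).
Qed.

End QuotientFibers.

Section LiftSimplices.
Context (R : realType) (p n : nat) (N : field_data R) (C : coef_data p N).
Context (hp : prime p) (hn : (0 < n)%N).
Context (D : datum n C) (hD : standing D) (beta : place N -> nat).
Context (T T' : class_family C -> class_family C) (hT : is_eps_cyc T T').
Local Notation H := (Hinf n N).
Context (delta : Hfin n N) (d1 : GLfin delta.1) (d2 : GLfin delta.2).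

Definition adm_box m (g : adm N m) (a : place N -> nat) (W : set (infmx N m)) : set (adm N m) :=
  [set g' | exists2 u, (forall v, Kprin v (a v) (u v)) & g'.1 = mulfin g.1 u /\ W g'.2].

Lemma adm_nbhs m (g : adm N m) (a : place N -> nat) (W : set (infmx N m)) :
  finite_set [set v | a v <> 0%N] -> nbhs g.2 W -> nbhs g (adm_box g a W).
Proof.
move=> fa gW; pose U := adm_box g a (W°)%classic.
have oU : open U.
  suff : adm_open U by [].
  move=> g' [u hu [e Wg']]; exists a, W°; split=> //.
    by apply: open_nbhs_nbhs; split=> //; exact: open_interior.
  move=> k h hk Wh; exists (mulfin u k).
    by move=> v; exact: Kprin_mul.
  by split=> //=; rewrite e; apply: fin_eq => v; rewrite /mulfin mulmxA.
have Ug : U g.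
  exists (onefin N m); first by move=> v; exact: Kprin_1.
  by split=> //; apply: fin_eq => v; rewrite /mulfin /onefin mulmx1.
apply: (@filterS _ (nbhs g) _ U); last exact: open_nbhs_nbhs.
by move=> g' [u hu [e Wg']]; exists u => //; split=> //; exact: interior_subset.
Qed.

Lemma mulH2_continuous (a b : H) : continuous (fun w => mulH (mulH a w) b).
Proof.
move=> w; apply: (@cvg_mulH R n N _ (nbhs w) _ (mulH a) (fun=> b) (mulH a w) b).
  exact: mulH_continuous.
exact: cvg_cst.
Qed.

(** Representatives of the double cosets near z differ from delta h by a small
    element at the real places, and at the finite places by an element
    that L_beta absorbs. *)
Lemma lifts_open (z : SH D beta) h (B : R) : lifts delta z h -> 1 < B ->
  \forall z' \near z, exists2 h', lifts delta z' h' & closeH B h h'.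
Proof.
move=> zh B1.
pose O := [set z' : SH D beta | exists h' B', [/\ lifts delta z' h', 1 <= B', B' < B &
  closeH B' h h']].
have Oz : O z by exists h, 1; split=> //; exact: closeH_refl.
suff oO : open O.
  apply: (@filterS _ (nbhs z) _ O); last exact: open_nbhs_nbhs.
  by move=> z' [h' [B' [l _ BB cl]]]; exists h' => //; apply: closeH_le cl; exact: ltW.
apply: qspace_open => x [h' [B' [[h'0 xh'] B'1 B'B cl]]].
have xE : fiber (qproj (dcosetH D beta) x) = dcosetH D beta (val x) by exact: fiber_qproj.
move: xh'; rewrite xE => /(dcosetH_sym hD).
rewrite (mkH_parts (val x)) => /dcosetHE [c [l [k [uc hl hk ef ei]]]].
have [a fa ha] := Lfin_small hD beta (finite_places_prime N hp).
have kk : HR k by have /LinfE [] := Linf0_sub hk.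
have cc := ratH_HR uc.
pose F (w : H) := mulH (mulH (invH (ratH c)) w) (invH k).
have Fc : continuous F by exact: mulH2_continuous.
have Fx : F (infpart (val x)) = h'.
  by rewrite /F ei -!mulHA mulHV // mulH1 mulHA mulVH // mul1H.
have FK w : w = mulH (mulH (ratH c) (F w)) k.
  by rewrite /F -!mulHA mulVH // mulH1 mulHA mulHV // mul1H.
have B'0 : 0 < B' by lra.
have BB1 : 1 < B / B' by rewrite ltr_pdivlMr // mul1r.
pose B2 := (1 + B / B') / 2.
have B21 : 1 < B2 by rewrite /B2; lra.
have B2B : B' * B2 < B.
  by rewrite mulrC -ltr_pdivlMr // /B2; lra.
have nQ : \forall w \near infpart (val x), HR0 (F w) /\ closeH B2 h' (F w).
  have n1 : \forall w \near h', HR0 w /\ closeH B2 h' w.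
    have n2 := HR0_nbhs h'0; have n3 := close_nbhs (HR0_sub h'0) B21.
    by apply: (@filterS2 _ (nbhs h') _ _ _ _ _ n2 n3) => w ? [].
  have Fcx : F w @[w --> infpart (val x)] --> h' by rewrite -Fx; exact: Fc.
  exact: (Fcx _ n1).
have [[A1 A2] /= [nA1 nA2] AA] := nQ.
have m1 := adm_nbhs fa nA1; have m2 := adm_nbhs fa nA2.
rewrite -mkH_parts.
exists (adm_box (val x).1 a A1, adm_box (val x).2 a A2); first by split; [exact: m1 | exact: m2].
move=> [y1 y2] /= [[u1 hu1 [e1 w1]] [u2 hu2 [e2 w2]]] hy.
have [HF cF] : HR0 (F (y1.2, y2.2)) /\ closeH B2 h' (F (y1.2, y2.2)) by apply: AA.
exists (F (y1.2, y2.2)), (B' * B2); split=> //; last first.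
- by apply: closeH_trans cl cF; [exact: ltW | exact: HR0_sub].
- have := ler_pM ler01 ler01 B'1 (ltW B21); rewrite mulr1 //.
split=> //.
have -> : fiber (qproj (dcosetH D beta) (exist _ (y1, y2) hy)) = dcosetH D beta (y1, y2) by exact: fiber_qproj.
apply: (dcosetH_sym hD); rewrite (mkH_parts (y1, y2)); apply/dcosetHE.
exists c, (mulHf l (u1, u2)), k; split=> //.
- by apply: Lfin_mul => //; apply: ha.
- rewrite mulHfA -ef; apply: Hf_eq => v /=; by rewrite ?e1 ?e2.
Qed.

(** Deck transformations act by left translations, which preserve closeness,
    so approximate_lift applies. Replacing the values by their normal
    forms, which depend continuously on the similarity class, makes the
    lift continuous, and changes it by elements of the identity component
    of L_oo only. *)
Theorem simplex_lift q (s : stdsimplex R q -> SH D beta) : continuous s ->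
  (forall x, exists2 h, HR0 h & fiber (s x) (mkH delta h)) ->
  exists h : stdsimplex R q -> H, continuous h /\
    forall x, HR0 (h x) /\ fiber (s x) (mkH delta (h x)).
Proof.
move=> sc sl.
pose P := {h : H | HR0 h}.
pose G := {c | deck D beta delta c}.
pose close (B : R) (h h' : P) := closeH B (sval h) (sval h').
pose Lift (z : SH D beta) (h : P) := fiber z (mkH delta (sval h)).
pose act (g : G) (h : P) : P := exist _ (mulH (ratH (sval g)) (sval h))
  (HR0_mul (deck_HR0 (svalP g)) (svalP h)).
have LiftE z h : Lift z h <-> lifts delta z (sval h).
  by split=> [?|[]//]; split=> //; exact: svalP.
have [f [fl fc]] : exists f : stdsimplex R q -> P, (forall x, Lift (s x) (f x)) /\
    forall (x : stdsimplex R q) B, 1 < B -> \forall x' \near x, close B (f x) (f x').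
  apply: (@approximate_lift _ _ P G close Lift act).
  - by move=> h; exact: closeH_refl.
  - by move=> B B' h h'; exact: closeH_le.
  - by move=> B h h'; exact: closeH_sym.
  - by move=> B B' h1 h2 h3 B0; apply: closeH_trans => //; apply: HR0_sub; exact: svalP.
  - by move=> B g h h'; exact: closeH_mull.
  - by move=> g z h /LiftE l; apply/LiftE; apply: lifts_act => //; exact: svalP.
  - move=> z h h' /LiftE l /LiftE l'; have [c dc [k hk e]] := lifts_uniq hD l l'.
    exists (exist _ c dc); rewrite /close /= e; apply: closeH_Linf; exact: Linf0_sub.
  - move=> z h0 /LiftE l0.
    have [B B1 hB] := injectivity_radius hn hD beta hT d1 d2 (svalP h0).
    exists B => // h g /LiftE l cl h'.
    have [c dc [k hk e]] := lifts_uniq hD l0 l.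
    have {cl} cl : closeH B (sval h) (mulH (ratH (sval g)) (sval h)) by exact: cl.
    have dg : deck D beta delta (sval g) := svalP g.
    rewrite /close /act /=; move: (sval g) dg cl => g' dg cl {g}.
    have h00 := HR0_sub (svalP h0); have hh := HR0_sub (svalP h).
    have cc := ratH_HR (deck_unit dc).
    have lk := Linf0_sub hk.
    have a1 : closeH 1 (mulH (ratH c) (sval h0)) (sval h) by rewrite e; exact: closeH_Linf.
    have gh : HR (mulH (ratH g') (sval h)) by apply: HR_mul => //; exact: HR0_sub (deck_HR0 dg).
    have a2 := closeH_trans ler01 hh a1 (closeH_trans (ltW (lt_trans ltr01 B1)) gh cl
      (closeH_mull (ratH g') (closeH_sym a1))).
    rewrite mul1r mulr1 in a2.
    have dconj := deck_mul hD (deck_inv hD dc) (deck_mul hD dg dc).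
    have [|a aE] := hB _ dconj.
      have := closeH_mull (invH (ratH c)) a2; rewrite mulHA mulVH // mul1H.
      by rewrite !ratH_mul ratH_inv !mulHA.
    apply: (scalar_deck_close (a := a)).
    have [u1 u2] := deck_unit dc.
    have [e1 e2] : c.1 *m (invmx c.1 *m (g'.1 *m c.1)) *m invmx c.1 = a%:M /\
        c.2 *m (invmx c.2 *m (g'.2 *m c.2)) *m invmx c.2 = a%:M.
      have [-> ->] := aE.
      by rewrite !mul_mx_scalar -!scalemxAl !mulmxV // scalemx1.
    move: e1 e2; rewrite !mulKVmx // !mulmxK //.
    by case: (g') => x y /= -> ->.
  - move=> z h B /LiftE l B1.
    apply: (@filterS _ (nbhs z) _ _ _ _ (lifts_open l B1)) => z' [h' l' cl].
    have h'0 : HR0 h' by have [] := l'.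
    by exists (exist _ h' h'0) => //; apply/LiftE.
  - exact: sc.
  - by move=> x; have [h h0 xh] := sl x; exists (exist _ h h0).
exists (fun x => normal_form hn (sval (f x))); split=> [x|x].
  apply: (@normal_cvg_close _ _ _ _ _ (nbhs x)) => //.
  - by apply: HR0_sub; exact: svalP.
  - by move=> t; apply: HR0_sub; exact: svalP.
  - by move=> B B1; exact: (fc x B B1).
have f0 := svalP (f x).
have := lifts_right hD (normal_Linf0 hn f0) ((LiftE _ _).1 (fl x)).
by rewrite mulHA mulHV ?mul1H //; exact: HR0_sub.
Qed.

End LiftSimplices.

(** * Evaluations *)

Section FiniteIdeles.
Context (R : realType) (p n : nat) (N : field_data R) (C : coef_data p N).
Context (T T' : class_family C -> class_family C) (hT : is_eps_cyc T T').
Context (hn : (0 < n)%N).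

Lemma finid_idele (y : fidele N) : is_fidele y -> is_idele (finid y).
Proof. by move=> hy; split=> // s; exact: oner_neq0. Qed.

Lemma fidele_mul (y z : fidele N) : is_fidele y -> is_fidele z ->
  is_fidele (fun v => y v * z v).
Proof.
move=> [y0 yf] [z0 zf]; split=> [v|]; first by rewrite mulf_neq0 ?y0 ?z0.
apply: (@sub_finite_set _ _ ([set v | cval (Fv N v) (y v) <> 0] `|`
  [set v | cval (Fv N v) (z v) <> 0])); last by rewrite finite_setU.
move=> v /=; rewrite ordM ?y0 ?z0 // => h; have [hy|] := eqVneq (cval (Fv N v) (y v)) 0.
  by right => hz; apply: h; rewrite hy hz.
by move=> /eqP; left.
Qed.

Lemma fidele_exp (y : fidele N) (j : int) : is_fidele y -> is_fidele (fun v => y v ^ j).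
Proof.
move=> [y0 yf]; split=> [v|]; first by rewrite expfz_neq0 ?y0.
apply: sub_finite_set yf => v /= h hy; apply: h; rewrite ordXz ?y0 // hy mul0r //.
Qed.

Lemma eps_finid_mul (y z : fidele N) : is_fidele y -> is_fidele z ->
  eps_cyclo C (finid (fun v => y v * z v)) = eps_cyclo C (finid y) * eps_cyclo C (finid z).
Proof.
move=> hy hz; have [y0 yf] := hy; have [z0 zf] := hz.
have sg (u : fidele N) : eps_cyclo C (finid u) = normFp C u * ratr (idele_norm_fin u).
  rewrite /eps_cyclo /= [X in _ * X]big1 ?mulr1 // => s _.
  by rewrite ltNge ler01.
rewrite !sg.
pose A := [set v | cval (Fv N v) (y v) <> 0] `|` [set v | cval (Fv N v) (z v) <> 0].
have fA : finite_set A by rewrite finite_setU.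
have yA v : ~ A v -> cval (Fv N v) (y v) = 0 by move=> /not_orP[/contrapT].
have zA v : ~ A v -> cval (Fv N v) (z v) = 0 by move=> /not_orP[_ /contrapT].
rewrite (idele_norm_finE fA) => [|v hv]; last by rewrite ordM ?y0 ?z0 // yA // zA.
rewrite (idele_norm_finE fA yA) (idele_norm_finE fA zA) !ratr_E mulrACA -!rmorphM.
congr (_ * rat_to_E C _).
  by rewrite /normFp -big_split; apply: eq_bigr => s _; rewrite rmorphM.
rewrite -big_split; apply: eq_bigr => v _ /=; rewrite ordM ?y0 ?z0 // opprD expfzDr //.
by rewrite pnatr_eq0 -lt0n (normv_gt0 hT).
Qed.

Lemma det_diag1 (x : fidele N) v : \det (diag1 n x v) = x v.
Proof.
have -> : diag1 n x v = diag_mx (\row_i (if i == 0%N :> nat then x v else 1)).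
  apply/matrixP => i j; rewrite !mxE; case: eqP => [->|_]; last by rewrite mulr0n.
  by rewrite mulr1n.
rewrite det_diag (bigD1 (Ordinal hn)) //= mxE eqxx big1 ?mulr1 // => i i0.
rewrite mxE; case: eqP => // e; case/eqP: i0; exact/val_inj.
Qed.

Lemma diag1_GLfin (x : fidele N) : is_fidele x -> GLfin (diag1 n x).
Proof.
move=> [x0 xf]; have u v : diag1 n x v \in unitmx.
  by rewrite unitmxE unitfE det_diag1 x0.
split=> //; apply: sub_finite_set xf => v /= h xv; apply: h; split; first exact: u.
  move=> i j; rewrite mxE; case: eqP => _; last exact: ordge0.
  by case: eqP => _; [rewrite ordgeE ?x0 // xv | exact: ordge1].
by rewrite det_diag1 ordgeE ?invr_eq0 ?x0 // ordV ?x0 // xv oppr0.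
Qed.

Lemma delta_fidele (D : datum n C) (j : int) (x y : fidele N) : is_fidele x -> is_fidele y ->
  is_fidele (fun v => \det ((deltaxy n x y).1 v) ^ j * \det ((deltaxy n x y).2 v) ^ (purity D - j)).
Proof.
move=> hx hy; rewrite (_ : (fun v => _) = fun v => (x v * y v) ^ j * y v ^ (purity D - j)).
  by apply: (@fidele_mul (fun v => (x v * y v) ^ j) (fun v => y v ^ (purity D - j)));
    [apply: (@fidele_exp (fun v => x v * y v)); exact: fidele_mul | exact: fidele_exp].
by apply: functional_extensionality_dep => v; rewrite /= !det_diag1.
Qed.

(** The quotient of the two determinants of delta (x, y) is x. *)
Lemma eps_deltaS (D : datum n C) (j : int) (x y : fidele N) : is_fidele x -> is_fidele y ->
  eps_delta D (j + 1) (deltaxy n x y) = eps_delta D j (deltaxy n x y) * eps_cyclo C (finid x).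
Proof.
move=> hx hy; rewrite /eps_delta -eps_finid_mul //; last first.
  exact: delta_fidele.
congr (eps_cyclo C (finid _)); apply: functional_extensionality_dep => v /=.
have [x0 _] := hx; have [y0 _] := hy.
rewrite !det_diag1 expfzDr ?mulf_neq0 ?x0 ?y0 // expr1z.
have -> : purity D - j = (purity D - (j + 1)) + 1 by lia.
rewrite [y v ^ (_ + 1)]expfzDr ?y0 // expr1z -!mulrA; congr (_ * _).
by rewrite mulrA mulrC [y v * x v]mulrC.
Qed.

Lemma eps_delta_OE (D : datum n C) (j : int) (x y : fidele N) : is_fidele x -> is_fidele y ->
  OE (eps_delta D j (deltaxy n x y)).
Proof.
by move=> hx hy; apply: (eps_int hT); apply: finid_idele; exact: delta_fidele.
Qed.

End FiniteIdeles.

Section FiniteClassGroup.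
Context (R : realType) (p n : nat) (N : field_data R) (C : coef_data p N) (D : datum n C).

(** Every class contains a class of finer modulus, and hence one of finitely
    many representatives. *)
Lemma finite_classes (b : place N -> nat) (rx : ray_reps (pbetam D b)) :
  finite_set [set: Clp (N := N) b].
Proof.
pose g (k : 'I_(rsize rx)) : Clp (N := N) b := proj_class b (finid_idele (rrep_fidele k)).
apply: (@sub_finite_set _ _ (g @` setT)); last by apply: finite_image; exact: finite_finset.
move=> c _; have [y [hy cy]] := Clp_ex c.
have [k [hk _]] := rrep_class rx hy.
exists k => //; rewrite /g; symmetry; apply: mem_class.
rewrite cy; apply: class_le hk => v; exact: leq_addr.
Qed.

End FiniteClassGroup.

Section CapProducts.
Context (R : realType) (p n : nat) (N : field_data R) (C : coef_data p N).
Context (hp : prime p) (hn : (0 < n)%N) (D : datum n C) (hD : standing D).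
Context (T T' : class_family C -> class_family C) (hT : is_eps_cyc T T').
Local Notation q := (cycle_dim n N).
Local Notation E := (EF C).
Context (beta : place N -> nat) (delta : Hfin n N) (d1 : GLfin delta.1) (d2 : GLfin delta.2).
Context (o : YH n N -> chain R (YH n N) q) (Theta : chain R (SH D beta) q).
Hypothesis hTheta : fundamental_cycle o delta Theta.
Context (c : Gcochain D q) (hc : is_cochain (@VO R p n N C D) c).

Lemma VO0 : VO (0 : repV D).
Proof. by rewrite -(scale0r (lowv D)); apply: lat_scale; [exact: OE0 | exact: lat_gen]. Qed.

Lemma bullet_xit0 : bullet_xit beta (0 : repV D) = 0.
Proof. by rewrite /bullet_xit /bullet_t /actp linear0 scaler0 linear0. Qed.

(** The values in V of the pulled back cochain on the simplices of the cycle: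
    they lie in the lattice, and almost all vanish, because the cochain is
    compactly supported, the map to the ambient space is proper, and all
    simplices lift to the real group. *)
Definition cap_value (s : stdsimplex R q -> SH D beta) : repV D :=
  pull_iota beta c (fun x => mkH delta (xget (fun=> oneHinf n N)
    [set h : stdsimplex R q -> Hinf n N | continuous h /\
       forall x, HR0 (h x) /\ fiber (s x) (mkH delta (h x))] x)).

Lemma cap_value_VO s : VO (cap_value s).
Proof.
by rewrite /cap_value /pull_iota; case: asboolP => _; [exact: (coch_val hc) | exact: VO0].
Qed.

Lemma cap_value_finite : finite_set [set s | Theta s != 0 /\ cap_value s <> 0].
Proof.
have [pr|npr] := pselect (iota_proper D beta); last first.
  rewrite (_ : [set _ | _] = set0) // -subset0 => s [_]; apply.
  by rewrite /cap_value /pull_iota; case: asboolP.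
have [A cA hA] := coch_supp hc; have cB := pr A cA.
have [simp lf] := fund_fin hTheta.
apply: sub_finite_set (lf _ cB) => s [Ts cs]; split=> //.
apply: contrapT => noB; apply: cs.
rewrite /cap_value /pull_iota; case: asboolP => // _.
have [h0 [h0c h0l]] := simplex_lift hp hn hD hT d1 d2 (simp s Ts)
  (fund_supp hTheta Ts).
set h := xget _ _.
have [hc' hl] : continuous h /\ forall x, HR0 (h x) /\ fiber (s x) (mkH delta (h x)).
  rewrite /h; case: xgetP => [g -> //|/(_ h0) no]; by case: no.
have [gs|ngs] := pselect (is_Gsimplex (iota_beta D beta \o (fun x => mkH delta (h x)))).
  apply: hA => // x a Aa fa; apply: noB; exists x, (mkH delta (h x)).
  by split; [have [] := hl x | exists a].
exact: (coch_zero hc).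
Qed.

Lemma capchainE (kappa : 'Hom(repV D, E^o)) :
  capchain Theta (triv_map delta (kappa_map kappa (tau_map beta (pull_iota beta c)))) =
  \sum_(s <- finmap.enum_fset (fset_set [set s | Theta s != 0 /\ cap_value s <> 0]))
     (Theta s)%:~R * (kappa (bullet_xit beta (cap_value s)) : E).
Proof.
rewrite /capchain -fsbig_finite; last exact: cap_value_finite.
rewrite (@fsbig_widen _ _ _ _ [set s | Theta s != 0 /\ cap_value s <> 0] setT) //.
move=> s [_ /= h].
have [->|Ts] := eqVneq (Theta s) 0; first by rewrite mul0r.
have [->|cs] := pselect (cap_value s = 0); first by rewrite bullet_xit0 linear0 mulr0.
by case: h.
Qed.

Lemma cap_congruence (j : int) (kappa kappa' : 'Hom(repV D, E^o)) k :
  kappa_form j kappa -> kappa_form (j + 1) kappa' ->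
  (forall v, overp p v -> (v : place N) p%:R *+ k <= (beta v)%:Z) ->
  let I kp := capchain Theta (triv_map delta (kappa_map kp (tau_map beta (pull_iota beta c)))) in
  [/\ OE (I kappa), OE (I kappa') & padic_small k (I kappa - I kappa')].
Proof.
move=> hk hk' deep I; have cong v := kappa_congruence hD hk hk' deep (v := v).
rewrite /I !capchainE; split.
- apply: OE_sum => s _; apply: OEM; first exact: OE_int.
  by have [] := cong _ (cap_value_VO s).
- apply: OE_sum => s _; apply: OEM; first exact: OE_int.
  by have [] := cong _ (cap_value_VO s).
- rewrite -sumrB; apply: padic_sum => s _; rewrite -mulrBr; apply: padicMl; first exact: OE_int.
  by have [] := cong _ (cap_value_VO s).
Qed.

End CapProducts.

(** * The comparison of consecutive measures *)

Section Iterates.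
Context (R : realType) (p : nat) (N : field_data R) (C : coef_data p N).
Context (T T' : class_family C -> class_family C) (hT : is_eps_cyc T T').

Lemma iterz_iwasawa (z : int) (M : class_family C) : iwasawa M -> iwasawa (iterz T T' z M).
Proof.
have it f : (forall M0, iwasawa M0 -> iwasawa (f M0)) -> forall k, iwasawa M ->
    iwasawa (iter k f M : class_family C).
  by move=> hf; elim=> //= k IH hM; apply: hf; exact: IH.
by move=> hM; case: z => k; apply: it => //; [exact: (cyc_stable hT) | exact: (cyc_stableV hT)].
Qed.

Lemma iterz_pred (z : int) (M : class_family C) : iwasawa M ->
  iterz T T' (z - 1) (T M) = iterz T T' z M.
Proof.
move=> hM; case: z => [[|k]|k].
- by rewrite sub0r /= (cycK hT).
- have -> : Posz k.+1 - 1 = Posz k by lia.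
  by rewrite /iterz -iterSr.
- have -> : Negz k - 1 = Negz k.+1 by lia.
  by rewrite /iterz [LHS]iterSr (cycK hT).
Qed.

End Iterates.

Section Comparison.
Context (R : realType) (p n : nat) (N : field_data R) (C : coef_data p N).
Context (D : datum n C) (hp : prime p) (hn : (0 < n)%N) (hD : standing D).
Local Notation q := (cycle_dim n N).
Context (o : YH n N -> chain R (YH n N) q).
Context (Theta : forall (beta : level p N) (delta : Hfin n N), chain R (SH D (sval beta)) q).
Hypothesis hTheta : forall beta delta, GLfin delta.1 -> GLfin delta.2 ->
  fundamental_cycle o delta (@Theta beta delta).
Context (eta0 : idele N -> EF C) (heta0 : finite_order_character D eta0).
Context (ry : ray_reps (modulus D)) (rx : forall beta : level p N, ray_reps (pbetam D (sval beta))).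
Context (T T' : class_family C -> class_family C) (hT : is_eps_cyc T T').

Lemma finite_level_classes (b : level p N) : finite_set [set: Clp (N := N) (sval b)].
Proof. exact: finite_classes (rx b). Qed.

Lemma hecke_inv_cochain (M : set (Gcochain D q)) (b : place N -> nat) (phi : Gcochain D q) :
  invertible_submodule M -> is_cochain (@VO R p n N C D) (hecke_inv M b phi).
Proof.
move=> hM; rewrite /hecke_inv; case: xgetP => [c -> [Mc _]|_].
  by have [] := inv_cocycle hM Mc.
split=> // [_|s k g _ _ _ _ x|]; first exact: VO0.
  by rewrite /actp linear0.
by exists set0; [exact: compact0 | ].
Qed.

(** Term by term: the factors eps_delta for j and j + 1 differ by the value of
    the character at an idele in the class cx, which is congruent to that at y,
    and the cap products are congruent by cap_congruence. *)
Lemma evaluation_congruence (b : level p N) (j : int) (kappa kappa' : 'Hom(repV D, (EF C)^o))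
    (c : Gcochain D q) (cx : Clp (N := N) (sval b)) (y : idele N) k :
  is_cochain (@VO R p n N C D) c -> kappa_form j kappa -> kappa_form (j + 1) kappa' ->
  (forall v, overp p v -> (v : place N) p%:R *+ k <= (sval b v)%:Z) ->
  (forall x, is_idele x -> sval cx x -> padic_small k (eps_cyclo C y - eps_cyclo C x)) ->
  padic_small k (evaluation_eta j kappa (@Theta) eta0 ry rx c cx * eps_cyclo C y
    - evaluation_eta (j + 1) kappa' (@Theta) eta0 ry rx c cx).
Proof.
move=> hc hk hk' deep near_y; rewrite /evaluation_eta mulr_suml -sumrB.
apply: padic_sum => i _; rewrite mulr_suml -sumrB; apply: padic_sum => u /asboolP cu.
set x := rrep u; set z := rrep i; have hx : is_fidele x := rrep_fidele u.
have hz : is_fidele z := rrep_fidele i.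
set delta := deltaxy n x z.
have d1 : GLfin delta.1 by apply: diag1_GLfin => //; exact: fidele_mul.
have d2 : GLfin delta.2 by exact: diag1_GLfin.
have [I1 I2 I12] := cap_congruence hp hn hD hT d1 d2 (hTheta b d1 d2) hc hk hk' deep.
rewrite /evaluation (eps_deltaS hT) //.
set I := capchain _ _ in I1 I12 *; set I' := capchain _ _ in I2 I12 *.
set e := eps_delta D j delta; set ex := eps_cyclo C (finid x); set ey := eps_cyclo C y.
set et := eta0 _.
have etO : OE et by apply: (char_int heta0); exact: finid_idele.
have eO : OE e by exact: (eps_delta_OE hT).
have exO : OE ex by apply: (eps_int hT); exact: finid_idele.
have eyx : padic_small k (ey - ex) by apply: near_y => //; exact: finid_idele.
rewrite (_ : _ - _ = et * (e * (I * (ey - ex) + ex * (I - I')))).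
  apply: padicMl => //; apply: padicMl => //; apply: padicD; first exact: padicMl.
  exact: padicMl.
have e1 : I * (ey - ex) + ex * (I - I') = I * ey - ex * I'.
  by rewrite mulrBr mulrBr [ex * I]mulrC addrA subrK.
by rewrite e1 !mulrBr !mulrA.
Qed.

(** At a fixed level b1 and modulo p^k, both sides are sums over the classes
    of a deeper level b, where T multiplies the values of mu by those of
    the character; there evaluation_congruence compares them term by term. *)
Lemma twist_measure (M : set (Gcochain D q)) (phi : Gcochain D q) (j : int)
    (kappa kappa' : 'Hom(repV D, (EF C)^o)) (mu mu' : class_family C) :
  invertible_submodule M -> kappa_form j kappa -> kappa_form (j + 1) kappa' ->
  is_measure M j kappa (@Theta) eta0 ry rx phi mu ->
  is_measure M (j + 1) kappa' (@Theta) eta0 ry rx phi mu' -> T mu = mu'.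
Proof.
move=> hM hk hk' [hmu muE] [hmu' muE']; apply: class_family_eq => b1 c1.
apply/eqP; rewrite -subr_eq0; apply/eqP; apply: padic_separated => k.
have [b0 hb0] := T_approx hT finite_level_classes b1 k.
have [b2 hb2] := eps_congr hT finite_level_classes k.
pose f (v : place N) := (sval b0 v + sval b1 v + sval b2 v + `|v p%:R *+ k|)%N.
pose b := level_of p f.
have le0 : level_le b0 b by apply: level_ofP => v _; rewrite /f -!addnA leq_addr.
have le1 : level_le b1 b by apply: level_ofP => v _; rewrite /f; lia.
have le2 : level_le b2 b by apply: level_ofP => v _; rewrite /f; lia.
have deep v : overp p v -> (v : place N) p%:R *+ k <= (sval b v)%:Z.
  by move=> pv; rewrite /b /level_of /= pv /f; lia.
have /choice [y hy] : forall c : Clp (N := N) (sval b), exists y : idele N, is_idele y /\ sval c y.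
  by move=> c; have [y [hy e]] := Clp_ex c; exists y; rewrite e; split=> //; exact: class_refl.
have app := hb0 b le0 le1 y (fun c => (hy c).1) (fun c => (hy c).2) mu hmu c1.
rewrite (hmu'.2 b1 b c1 le1).
set S := \sum_(c \in _) _ in app; set S' := \sum_(d \in _) _.
rewrite -(subrK S (_ c1)) -addrA; apply: padicD => //.
have fa := finite_above finite_level_classes b c1.
rewrite /S /S' !fsbig_finite // -sumrB; apply: padic_sum => c _.
rewrite muE muE'; apply: evaluation_congruence => //; first exact: hecke_inv_cochain.
move=> x hx cx; have [yi yc] := hy c; apply: (hb2 b le2) => //.
have [w [hw e]] := Clp_ex c; rewrite e in cx yc.
by apply: class_trans cx; exact: class_sym.
Qed.

End Comparison.

Theorem theorem2p3 (R : realType) (p n : nat) (N : field_data R)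
    (C : coef_data p N) (D : datum n C)
    (hp : prime p) (hn : (0 < n)%N) (hD : standing D)
    (hE : large_enough D (cycle_dim n N))
    (kappa : int -> 'Hom(repV D, (EF C)^o))
    (hkappa : forall j, Crit D j -> kappa_form j (kappa j))
    (o : YH n N -> chain R (YH n N) (cycle_dim n N)) (ho : orientation o)
    (Theta : forall (beta : level p N) (delta : Hfin n N),
       chain R (SH D (sval beta)) (cycle_dim n N))
    (hTheta : forall beta delta, GLfin delta.1 -> GLfin delta.2 ->
       fundamental_cycle o delta (Theta beta delta))
    (eta0 : idele N -> EF C) (heta0 : finite_order_character D eta0)
    (ry : ray_reps (modulus D))
    (rx : forall beta : level p N, ray_reps (pbetam D (sval beta)))
    (T T' : class_family C -> class_family C) (hT : is_eps_cyc T T')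
    (Hord : set (Gcochain D (cycle_dim n N))) (hHord : Q_ordinary Hord)
    (phi : Gcochain D (cycle_dim n N)) (hphi : Hord phi)
    (mu : int -> class_family C)
    (hmu : forall j, Crit D j ->
       is_measure Hord j (kappa j) Theta eta0 ry rx phi (mu j)) :
  (forall j, Crit D j -> Crit D (j + 1) -> T (mu j) = mu (j + 1)) /\
  (forall j, Crit D j -> iwasawa (iterz T T' (- j) (mu j))) /\
  (forall j j', Crit D j -> Crit D j' ->
     iterz T T' (- j) (mu j) = iterz T T' (- j') (mu j')).
Proof.
have hM : invertible_submodule Hord by have [] := hHord.
have shift j : Crit D j -> Crit D (j + 1) -> T (mu j) = mu (j + 1).
  move=> hj hj1; apply: (twist_measure hp hn hD hTheta heta0 hT hM);
    [exact: hkappa | exact: hkappa | exact: hmu | exact: hmu].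
split; first exact: shift.
split; first by move=> j hj; apply: (iterz_iwasawa hT); have [] := hmu _ hj.
have up (m : nat) j : Crit D j -> Crit D (j + m%:Z) ->
    iterz T T' (- j) (mu j) = iterz T T' (- (j + m%:Z)) (mu (j + m%:Z)).
  elim: m => [|m IH] hj hm; first by rewrite addr0.
  have hm' : Crit D (j + m%:Z).
    move=> s i; have [a b] := hj s i; have [a' b'] := hm s i.
    by split=> ni; [have := a' ni | have := b ni]; lia.
  have E : j + m.+1%:Z = (j + m%:Z) + 1 by lia.
  rewrite E in hm *; rewrite IH // -(shift _ hm' hm) [- (_ + 1)]opprD (iterz_pred hT) //.
  by have [] := hmu _ hm'.
move=> j j' hj hj'; wlog le : j j' hj hj' / j <= j'.
  by move=> H; have [/H|/ltW /H] := leP j j'; [apply | move=> h; symmetry; exact: h].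
have e : j' = j + `|j' - j|%N%:Z by lia.
by rewrite e; apply: up => //; rewrite -e.
Qed.
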